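(* Let $\ell\in\mathbb{Z}_{\ge 0}$, let $f:\mathbb{C}_+\to\mathbb{C}$ and $g:\mathbb{C}_+\to\mathbb{C}_+$ be analytic functions, and let $W_{f,g}$ be a (not necessarily maximal) weighted composition operator, i.e. $W_{f,g}\preceq W_{f,g,\max}$. Then $W_{f,g}$ is $\mathcal{C}_\star$-selfadjoint on $\mathbb{B}_\ell(\mathbb{C}_+)$ if and only if both of the following conditions hold. (1) The operator $W_{f,g}$ is maximal, that is, $W_{f,g}=W_{f,g,\max}$. (2) One of the following three cases holds (for all $w\in\mathbb{C}_+$): (i) $g(w)=\alpha$ and $f(w)=\dfrac{\beta}{(1+\alpha w)^{\ell+2}}$, where $\alpha\in\mathbb{C}_+$ and $\beta\in\mathbb{C}$; (ii) $g(w)=\lambda w$ and $f(w)=\theta$, where $\lambda\in\mathbb{R}_{>0}$ and $\theta\in\mathbb{C}$; (iii) $g(w)=\delta+\dfrac{1-\delta\kappa}{w+\kappa}$ and $f(w)=\dfrac{r}{(w+\kappa)^{\ell+2}}$, where $\delta,\kappa,r\in\mathbb{C}$ and either $\delta\in i\mathbb{R}$, $\delta\kappa\in\mathbb{R}$, $\delta\kappa<1$ and $\operatorname{Re}\kappa\ge 0$, or $-\operatorname{Re}\delta<0\le\operatorname{Re}\kappa-\dfrac{\operatorname{Re}(\delta\kappa-1)+|\delta\kappa-1|}{2\operatorname{Re}\delta}$. In this case, the operator $W_{f,g}$ is bounded.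
   Context: $\mathbb{C}_+=\{z\in\mathbb{C}:\operatorname{Re}z>0\}$. For $\ell\in\mathbb{Z}_{\ge0}$, the weighted Bergman space $\mathbb{B}_\ell(\mathbb{C}_+)$ is the Hilbert space of analytic functions $h:\mathbb{C}_+\to\mathbb{C}$ with $\|h\|^2=\frac1\pi\int_{-\infty}^{\infty}\int_0^\infty x^\ell|h(x+iy)|^2\,dx\,dy<\infty$. For analytic $f:\mathbb{C}_+\to\mathbb{C}$ and $g:\mathbb{C}_+\to\mathbb{C}_+$, the maximal weighted composition operator $W_{f,g,\max}$ has domain $\{h\in\mathbb{B}_\ell(\mathbb{C}_+): f\cdot(h\circ g)\in\mathbb{B}_\ell(\mathbb{C}_+)\}$ and acts by $W_{f,g,\max}h=f\cdot(h\circ g)$. For linear operators, $A\preceq B$ means $\operatorname{dom}(A)\subseteq\operatorname{dom}(B)$ and $Ax=Bx$ for $x\in\operatorname{dom}(A)$; $W_{f,g}$ denotes an operator with $W_{f,g}\preceq W_{f,g,\max}$. It is called bounded if its domain is all of $\mathbb{B}_\ell(\mathbb{C}_+)$ and there is $L>0$ with $\|W_{f,g}h\|\le L\|h\|$ for every $h$. A conjugation is an anti-linear isometric involution. For a conjugation $\mathcal{C}$, a (densely defined, not necessarily bounded) linear operator $B$ is called $\mathcal{C}$-selfadjoint if $B=\mathcal{C}B^*\mathcal{C}$ (equality including domains). $\mathcal{C}_\star$ is the conjugation on $\mathbb{B}_\ell(\mathbb{C}_+)$ given by $\mathcal{C}_\star h(z)=\dfrac{1}{z^{\ell+2}}\overline{h\left(\dfrac{1}{\overline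 z}\right)}$.
   Formalization: The equivalence is stated for f not identically zero: if f = 0 the zero operator is selfadjoint for every g, e.g. g(w) = w+1, which is none of (i)–(iii). The ''if'' direction and the boundedness are stated for all f. *)

(* Defs.v *)
From HB Require Import structures.
From mathcomp Require Import all_boot all_order all_algebra.
From mathcomp Require Import all_classical all_reals all_analysis.
From mathcomp Require Import complex.

Set Implicit Arguments.
Unset Strict Implicit.
Unset Printing Implicit Defensive.

Import Order.TTheory GRing.Theory Num.Theory.
Import numFieldNormedType.Exports.

Local Open Scope classical_set_scope.
Local Open Scope ring_scope.
Local Open Scope complex_scope.

(* The modulus, with values in R; likewise complex.Re and complex.Im are
   R-valued, unlike 'Re and 'Im on a numClosedFieldType. *)
Local Notation normc := ComplexField.Normc.normc.

Definition Cplus (R : realType) : set R[i] := [set z | 0 < complex.Re z].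

(* R[i]^o carries the norm topology and the R[i]-module structure of the
   complex numbers, so that this is complex differentiability. *)
Definition analytic_on (R : realType) (U : set R[i]) (h : R[i] -> R[i]) : Prop :=
  forall z, U z -> derivable (h : R[i]^o -> R[i]^o) (z : R[i]^o) (1 : R[i]^o).

(* A function on the half-plane is encoded as a function on all of R[i] that
   vanishes off the half-plane, so that Leibniz equality is equality of
   functions on the half-plane; extend0 F is the encoding of F restricted to
   the half-plane. *)
Definition extend0 (R : realType) (F : R[i] -> R[i]) : R[i] -> R[i] :=
  fun z => if 0 < complex.Re z then F z else 0.

Definition Cplus_integral (R : realType) (F : R -> R -> R) : \bar R :=
  (\int[@lebesgue_measure R]_y
     \int[@lebesgue_measure R]_(x in `]0%R, +oo[) (F x y)%:E)%E.

Definition bergman_sqnorm (R : realType) (l : nat) (h : R[i] -> R[i]) : \bar R :=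
  ((pi^-1)%:E * Cplus_integral
     (fun x y => (x ^+ l * normc (h (x +i* y)) ^+ 2)%R))%E.

Definition bergman (R : realType) (l : nat) : set (R[i] -> R[i]) :=
  [set h | [/\ analytic_on (@Cplus R) h,
               forall z, ~ Cplus z -> h z = 0
             & (bergman_sqnorm l h < +oo)%E]].

Definition bergman_norm (R : realType) (l : nat) (h : R[i] -> R[i]) : R :=
  Num.sqrt (fine (bergman_sqnorm l h)).

(* The inner product inducing bergman_norm; the complex integral is taken
   through its real and imaginary parts. *)
Definition bergman_ip (R : realType) (l : nat) (h k : R[i] -> R[i]) : R[i] :=
  let F x y := (x ^+ l)%:C * (h (x +i* y) * (k (x +i* y))^*) in
  (pi^-1)%:C * (fine (Cplus_integral (fun x y => complex.Re (F x y)))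
            +i* fine (Cplus_integral (fun x y => complex.Im (F x y)))).

(* Partially defined operators: the values of app off dom are meaningless. *)
Record operator (R : realType) := Operator {
  dom : set (R[i] -> R[i]);
  app : (R[i] -> R[i]) -> (R[i] -> R[i]) }.

Definition linear_operator (R : realType) (l : nat) (A : operator R) : Prop :=
  [/\ dom A `<=` bergman l,
      (forall h, dom A h -> bergman l (app A h)),
      dom A (fun=> 0)
    & forall (a : R[i]) (h k : R[i] -> R[i]), dom A h -> dom A k ->
        dom A (fun z => a * h z + k z) /\
        app A (fun z => a * h z + k z) = (fun z => a * app A h z + app A k z)].

Definition ople (R : realType) (A B : operator R) : Prop :=
  dom A `<=` dom B /\ forall h, dom A h -> app A h = app B h.

Definition opeq (R : realType) (A B : operator R) : Prop :=
  ople A B /\ ople B A.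

Definition densely_defined (R : realType) (l : nat) (A : operator R) : Prop :=
  forall h, bergman l h -> forall e : R, 0 < e ->
    exists2 k, dom A k & bergman_norm l (fun z => h z - k z) < e.

Definition bounded_operator (R : realType) (l : nat) (A : operator R) : Prop :=
  dom A = bergman l /\
  exists2 L : R, 0 < L &
    forall h, bergman l h -> bergman_norm l (app A h) <= L * bergman_norm l h.

Definition adjoint_rel (R : realType) (l : nat) (A : operator R)
    (u v : R[i] -> R[i]) : Prop :=
  [/\ bergman l u, bergman l v &
      forall h, dom A h -> bergman_ip l (app A h) u = bergman_ip l h v].

(* For densely defined A the v related to u is unique, so that the choice made
   by xget is the value of the adjoint at u. *)
Definition adjoint (R : realType) (l : nat) (A : operator R) : operator R :=
  Operator [set u | exists v, adjoint_rel l A u v]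
           (fun u => xget (fun=> 0) [set v | adjoint_rel l A u v]).

Definition sandwich (R : realType) (l : nat)
    (C : (R[i] -> R[i]) -> (R[i] -> R[i])) (A : operator R) : operator R :=
  Operator [set h | bergman l h /\ dom A (C h)] (fun h => C (app A (C h))).

(* Meant for a conjugation C: an anti-linear isometric involution. *)
Definition conj_selfadjoint (R : realType) (l : nat)
    (C : (R[i] -> R[i]) -> (R[i] -> R[i])) (B : operator R) : Prop :=
  [/\ linear_operator l B, densely_defined l B
    & opeq B (sandwich l C (adjoint l B))].

Definition Cstar (R : realType) (l : nat) (h : R[i] -> R[i]) : R[i] -> R[i] :=
  extend0 (fun z => 1 / z ^+ (l + 2) * (h (1 / z^*))^*).

Definition wcomp_max (R : realType) (l : nat) (f g : R[i] -> R[i]) :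
    operator R :=
  let W h := extend0 (fun z => f z * h (g z)) in
  Operator [set h | bergman l h /\ bergman l (W h)] W.

Definition symbol_case_i (R : realType) (l : nat) (f g : R[i] -> R[i]) : Prop :=
  exists alpha beta : R[i], Cplus alpha /\
    forall w, Cplus w ->
      g w = alpha /\ f w = beta / (1 + alpha * w) ^+ (l + 2).

Definition symbol_case_ii (R : realType) (f g : R[i] -> R[i]) : Prop :=
  exists (lambda : R) (theta : R[i]), 0 < lambda /\
    forall w, Cplus w -> g w = lambda%:C * w /\ f w = theta.

Definition symbol_case_iii (R : realType) (l : nat) (f g : R[i] -> R[i]) :
    Prop :=
  exists delta kappa r : R[i],
    ([/\ complex.Re delta = 0, complex.Im (delta * kappa) = 0,
         complex.Re (delta * kappa) < 1 & 0 <= complex.Re kappa] \/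
     (- complex.Re delta < 0 /\
      0 <= complex.Re kappa -
           (complex.Re (delta * kappa - 1) +
            normc (delta * kappa - 1)) / (2 * complex.Re delta))) /\
    forall w, Cplus w ->
      g w = delta + (1 - delta * kappa) / (w + kappa) /\
      f w = r / (w + kappa) ^+ (l + 2).

(* Main.v *)
(** A weighted composition operator acts on the reproducing kernels
    k_w(z) = (z + w^* )^-(l + 2) through its adjoint by
    W^* k_w = (f w)^* k_(g w).  Since C_star k_w is z |-> (1 + w z)^-(l + 2),
    C_star-selfadjointness forces
      f z / (1 + w g z)^(l + 2) = f w / (1 + z g w)^(l + 2).
    Multiplying this around a triple z, w, v shows that
      (1 + z g w) (1 + w g v) (1 + v g z) / ((1 + w g z) (1 + v g w) (1 + z g v))
    is a root of unity, and it is 1 at z = w, hence 1 everywhere because the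
    half-plane is connected.  This is linear in g z, so g is a Moebius map, and
    the constraints on its coefficients come from g mapping the half-plane to
    itself.

    Conversely, up to a scalar each such W is a composition of translations
    h(z + a), dilations h(c z) and the inversion z^-(l + 2) h(1/z), or has rank
    one; each factor is bounded with an explicit adjoint, and C_star W C_star is
    then the adjoint of W.  The adjoint of a real translation by c is found by
    writing h(z + c) as the Poisson average of its imaginary translates, which
    are unitary.

    The reproducing formula at the point 1 is the mean value property along the
    hyperbolic rotations about 1, which preserve the measure carrying it. *)

Require Import Defs.
From HB Require Import structures.
From mathcomp Require Import all_boot all_order all_algebra.
From mathcomp Require Import all_classical all_reals all_analysis.
From mathcomp Require Import complex measurable_realfun.
From mathcomp Require Import ring lra.

Set Implicit Arguments.
Unset Strict Implicit.
Unset Printing Implicit Defensive.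

Import Order.TTheory GRing.Theory Num.Theory.
Import numFieldNormedType.Exports.

Local Open Scope classical_set_scope.
Local Open Scope ring_scope.
Local Open Scope complex_scope.

(* Redeclared because Num.Theory also exports Re, Im and the conjugation x^* of a
   numClosedFieldType. *)
Local Notation normc := ComplexField.Normc.normc.
Local Notation "x ^*" := (conjc x) : ring_scope.
Local Notation Re := complex.Re.
Local Notation Im := complex.Im.

(** * Complex differentiability *)

(** Changes of variables on the half-plane are built from one-variable ones: affine maps, and x |->
    1 / x, which rests on uniqueness of Haar measure. Inversion of the half-plane reduces to the
    latter in coordinates of which it changes only one. The mean value property comes from Goursat's
    theorem in logarithmic coordinates on the disc, where a circle becomes a side of a rectangle.
    The norm of the kernel at 1 is never computed: it enters the reproducing constant, of which only
    positivity is used.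

    The two directions meet in a statement about [f] and [g] alone, [csym]: the operator h |-> f (h
    o g) is bounded on the whole space and its adjoint is its conjugate by C_star. Boundedness,
    selfadjointness of the maximal operator and maximality of a selfadjoint [W] all follow from it,
    the last because the adjoint of [W] is then defined everywhere. If [f] vanishes on the
    half-plane, [csym] holds whatever [g] is. *)

Section complex_modulus.
Variable R : realType.
Local Notation C := R[i].
Implicit Types (z w : C) (x : R).

Lemma normr_normc z : `|z| = (normc z)%:C.
Proof. by case: z. Qed.

Lemma normc_ge0 z : 0 <= normc z.
Proof. by case: z => a b; exact: sqrtr_ge0. Qed.

Lemma normc_eq0 z : (normc z == 0) = (z == 0).
Proof.
apply/eqP/eqP => [|->]; last exact: ComplexField.Normc.normc0.
exact: ComplexField.Normc.eq0_normc.
Qed.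

Lemma normc_gt0 z : (0 < normc z) = (z != 0).
Proof. by rewrite lt_def normc_ge0 andbT normc_eq0. Qed.

Lemma normcM z w : normc (z * w) = normc z * normc w.
Proof. exact: ComplexField.Normc.normcM. Qed.

Lemma normcV z : normc z^-1 = (normc z)^-1.
Proof. exact: ComplexField.Normc.normcV. Qed.

Lemma normcX z n : normc (z ^+ n) = normc z ^+ n.
Proof.
elim: n => [|n IH]; first by rewrite !expr0 ComplexField.Normc.normc1.
by rewrite !exprS normcM IH.
Qed.

Lemma ler_normcD z w : normc (z + w) <= normc z + normc w.
Proof. exact: le_normcD. Qed.

Lemma normc_opp z : normc (- z) = normc z.
Proof. exact: normcN. Qed.

Lemma normc_distC z w : normc (z - w) = normc (w - z).
Proof. by rewrite -opprB normc_opp. Qed.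

Lemma normc_sqr z : normc z ^+ 2 = Re z ^+ 2 + Im z ^+ 2.
Proof. by case: z => a b /=; rewrite sqr_sqrtr// addr_ge0// sqr_ge0. Qed.

Lemma normc_conj z : normc z^* = normc z.
Proof. by case: z => a b /=; rewrite sqrrN. Qed.

Lemma normc_real x : normc x%:C = `|x|.
Proof. by rewrite /= expr0n addr0 sqrtr_sqr. Qed.

Lemma normcR_ge0 x : 0 <= x -> normc x%:C = x.
Proof. by move=> x0; rewrite normc_real ger0_norm. Qed.

Lemma ler_normRe z : `|Re z| <= normc z.
Proof.
rewrite -(ler_pXn2r (ltn0Sn 1)) ?nnegrE ?normc_ge0//.
by rewrite normc_sqr real_normK ?num_real// lerDl sqr_ge0.
Qed.

Lemma ler_normIm z : `|Im z| <= normc z.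
Proof.
rewrite -(ler_pXn2r (ltn0Sn 1)) ?nnegrE ?normc_ge0//.
by rewrite normc_sqr real_normK ?num_real// lerDr sqr_ge0.
Qed.

Lemma ler_Re z : Re z <= normc z.
Proof. exact: le_trans (ler_norm _) (ler_normRe z). Qed.

Lemma ler_normc_ReIm z : normc z <= `|Re z| + `|Im z|.
Proof.
rewrite -(ler_pXn2r (ltn0Sn 1)) ?nnegrE ?normc_ge0 ?addr_ge0//.
rewrite normc_sqr sqrrD !real_normK ?num_real//.
by rewrite addrAC lerDl mulrn_wge0// mulr_ge0.
Qed.

Lemma mulc_conj z : z * z^* = (normc z ^+ 2)%:C.
Proof.
by rewrite normc_sqr; case: z => a b; apply/eqP; rewrite eq_complex /=; apply/andP; split; apply/eqP; ring.
Qed.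

Lemma RecD z w : Re (z + w) = Re z + Re w.
Proof. by case: z; case: w. Qed.
Lemma ImcD z w : Im (z + w) = Im z + Im w.
Proof. by case: z; case: w. Qed.
Lemma RecN z : Re (- z) = - Re z.
Proof. by case: z. Qed.
Lemma ImcN z : Im (- z) = - Im z.
Proof. by case: z. Qed.
Lemma RecM z w : Re (z * w) = Re z * Re w - Im z * Im w.
Proof. by case: z; case: w. Qed.
Lemma ImcM z w : Im (z * w) = Re z * Im w + Im z * Re w.
Proof. by case: z; case: w. Qed.
Lemma RecV z : Re z^-1 = Re z / normc z ^+ 2.
Proof. by rewrite normc_sqr; case: z. Qed.
Lemma ImcV z : Im z^-1 = - (Im z / normc z ^+ 2).
Proof. by rewrite normc_sqr; case: z. Qed.
Lemma RecJ z : Re z^* = Re z.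
Proof. by case: z. Qed.
Lemma ImcJ z : Im z^* = - Im z.
Proof. by case: z. Qed.

Lemma complex_ext z w : Re z = Re w -> Im z = Im w -> z = w.
Proof. by case: z; case: w => a b c d /= -> ->. Qed.

Lemma ReImE z : z = Re z +i* Im z.
Proof. by case: z. Qed.

Lemma Re_neq0 z : 0 < Re z -> z != 0.
Proof. by move=> z0; apply: contraTneq z0 => ->; rewrite ltxx. Qed.

Lemma ReV_gt0 z : 0 < Re z -> 0 < Re z^-1.
Proof. by move=> z0; rewrite RecV divr_gt0// exprn_gt0// normc_gt0 Re_neq0. Qed.

Lemma ReVJ_gt0 z : 0 < Re z -> 0 < Re (1 / z^*).
Proof. by move=> z0; rewrite div1r ReV_gt0// RecJ. Qed.

End complex_modulus.

Section complex_derivative.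
Variable R : realType.
Local Notation C := R[i].
Implicit Types (h k : C -> C) (z w a b : C).

(** The derivative as a linear approximation instead of a limit of quotients: no division occurs,
    and the increment 0 is allowed. *)
Definition cderiv h z a := forall e : R, 0 < e ->
  exists2 d : R, 0 < d & forall v, normc v < d ->
    normc (h (z + v) - h z - a * v) <= e * normc v.

Lemma derivable_cderiv h z :
  derivable (h : C^o -> C^o) (z : C^o) (1 : C^o) <-> exists a, cderiv h z a.
Proof.
split.
  move=> /cvg_ex[a /cvgrPdist_le ha]; exists a => e e0.
  have := ha e%:C; rewrite ltcR => /(_ e0).
  (* The radius of a neighbourhood is an element of [R[i]]; its positivity forces its imaginary part
     to be 0. *)
  move=> [] [d1 d2] /= /[!ltcE] /= /andP[/eqP d20 d10] hd.
  rewrite {}d20 in hd *.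
  exists d1 => // v vd; have [->|v0] := eqVneq v 0.
    by rewrite addr0 subrr mulr0 subrr ComplexField.Normc.normc0 mulr0.
  have := hd v; rewrite /= sub0r normrN normr_normc ltcR => /(_ vd v0).
  rewrite normr_normc lecR /GRing.scale /= mulr1 (addrC v).
  have -> : h (z + v) - h z - a * v = - ((a - v^-1 * (h (z + v) - h z)) * v).
    by field.
  by rewrite normc_opp normcM => ?; rewrite ler_wpM2r// normc_ge0.
move=> [a ha]; apply/cvg_ex; exists a; apply/cvgrPdist_le => -[e1 e2] /=.
rewrite ltcE /= => /andP[/eqP -> e0].
have [d d0 hd] := ha _ e0.
exists d%:C; first by rewrite /= ltcR.
move=> v /=; rewrite sub0r normrN normr_normc ltcR => vd v0.
rewrite normr_normc lecR /GRing.scale /= mulr1 (addrC v).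
have := hd _ vd.
have -> : h (z + v) - h z - a * v = - ((a - v^-1 * (h (z + v) - h z)) * v).
  by field.
by rewrite normc_opp normcM ler_pM2r// normc_gt0.
Qed.

Lemma cderiv_cont h z a : cderiv h z a -> forall e : R, 0 < e ->
  exists2 d : R, 0 < d & forall w, normc (w - z) < d -> normc (h w - h z) < e.
Proof.
move=> ha e e0; have [d d0 hd] := ha 1 ltr01.
have c0 : 0 < 2 + normc a by rewrite ltr_wpDr// normc_ge0.
exists (Num.min d (e / (2 + normc a))); first by rewrite lt_min d0 divr_gt0.
move=> w; rewrite lt_min => /andP[wd we].
have := hd _ wd; rewrite subrKC mul1r => hw.
have -> : h w - h z = (h w - h z - a * (w - z)) + a * (w - z) by ring.
apply: le_lt_trans (ler_normcD _ _) _; rewrite normcM.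
move: we; rewrite ltr_pdivlMr// => we.
have := normc_ge0 a; have := normc_ge0 (w - z); nra.
Qed.

(** Schwarz reflection: the two conjugations cancel each other's antilinearity. *)
Lemma cderiv_conj h z a : cderiv h z^* a -> cderiv (fun w => (h w^*)^*) z a^*.
Proof.
move=> ha e e0; have [d d0 hd] := ha e e0; exists d => // v vd.
have := hd v^*; rewrite normc_conj => /(_ vd).
rewrite -[X in X <= _]normc_conj !rmorphB !rmorphM /= conjcK.
by rewrite rmorphD.
Qed.

Lemma cderiv_local h k z a (d : R) : 0 < d ->
  (forall w, normc (w - z) < d -> h w = k w) -> cderiv h z a -> cderiv k z a.
Proof.
move=> d0 hk ha e e0; have [d' d'0 hd] := ha e e0.
exists (Num.min d d'); first by rewrite lt_min d0.
move=> v; rewrite lt_min => /andP[vd vd'].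
rewrite -hk; last by rewrite addrAC subrr add0r.
by rewrite -hk; [exact: hd|rewrite subrr ComplexField.Normc.normc0].
Qed.

Lemma Cplus_ball z w : 0 < Re z -> normc (w - z) < Re z -> 0 < Re w.
Proof.
move=> z0 wz; have := le_lt_trans (ler_normRe _) wz.
by rewrite RecD RecN ltr_norml => /andP[]; lra.
Qed.

Lemma eq_analytic h k : (forall z, 0 < Re z -> h z = k z) ->
  analytic_on (@Cplus R) h -> analytic_on (@Cplus R) k.
Proof.
move=> hk ha z z0; have /derivable_cderiv[a hz] := ha z z0.
apply/derivable_cderiv; exists a; apply: cderiv_local hz; first exact: z0.
by move=> w wz; apply: hk; exact: Cplus_ball wz.
Qed.

Lemma extend0E h z : 0 < Re z -> extend0 h z = h z.
Proof. by rewrite /extend0 => ->. Qed.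

Lemma extend0_out h z : ~ Cplus z -> extend0 h z = 0.
Proof. by rewrite /extend0 /Cplus /= => /negP/negbTE ->. Qed.

Lemma analytic_extend0 h :
  analytic_on (@Cplus R) h -> analytic_on (@Cplus R) (extend0 h).
Proof. by apply: eq_analytic => z z0; rewrite extend0E. Qed.

Lemma analytic_cst (U : set C) a : analytic_on U (fun=> a).
Proof. by move=> z _; exact: derivable_cst. Qed.

Lemma analytic_id (U : set C) : analytic_on U id.
Proof. by move=> z _; exact: derivable_id. Qed.

Lemma analyticD (U : set C) h k : analytic_on U h -> analytic_on U k ->
  analytic_on U (fun z => h z + k z).
Proof. by move=> ha ka z Uz; exact: derivableD (ha _ Uz) (ka _ Uz). Qed.

Lemma analyticM (U : set C) h k : analytic_on U h -> analytic_on U k ->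
  analytic_on U (fun z => h z * k z).
Proof. by move=> ha ka z Uz; exact: derivableM (ha _ Uz) (ka _ Uz). Qed.

Lemma analyticX (U : set C) h n : analytic_on U h ->
  analytic_on U (fun z => h z ^+ n).
Proof.
move=> ha; elim: n => [|n IH]; first exact: analytic_cst.
have -> : (fun z => h z ^+ n.+1) = (fun z => h z * h z ^+ n).
  by apply/funext => z; rewrite exprS.
exact: analyticM.
Qed.

Lemma analyticV (U : set C) h : (forall z, U z -> h z != 0) ->
  analytic_on U h -> analytic_on U (fun z => (h z)^-1).
Proof. by move=> h0 ha z Uz; exact: derivableV (h0 _ Uz) (ha _ Uz). Qed.

Lemma analytic_comp (U V : set C) h k : (forall z, U z -> V (k z)) ->
  analytic_on V h -> analytic_on U k -> analytic_on U (fun z => h (k z)).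
Proof.
move=> kUV ha ka z Uz; apply/derivable1_diffP.
apply: (@differentiable_comp _ C^o C^o C^o k h).
  exact/derivable1_diffP/ka.
exact/derivable1_diffP/ha/kUV.
Qed.

Lemma analytic_conj h : analytic_on (@Cplus R) h ->
  analytic_on (@Cplus R) (fun z => (h z^*)^*).
Proof.
move=> ha z z0.
have /derivable_cderiv[a hz] : derivable (h : C^o -> C^o) (z^* : C^o) (1 : C^o).
  by apply: ha; rewrite /Cplus /= RecJ.
by apply/derivable_cderiv; exists a^*; exact: cderiv_conj.
Qed.

End complex_derivative.

(** * Measurability of complex functions *)

Section planar_open_sets.
Variable R : realType.
Local Notation RR := (measurableTypeR R * measurableTypeR R)%type.

(** The sigma-algebra is the product one, so an open set has to be exhibited as a countable union of
    boxes with rational corners. *)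
Lemma box_open_measurable (A : set RR) :
  (forall p, A p -> exists2 e : R, 0 < e &
     forall q : RR, `|q.1 - p.1| < e -> `|q.2 - p.2| < e -> A q) ->
  measurable A.
Proof.
move=> oA.
pose B (u : rat * rat * (rat * rat)) : set RR :=
  `]ratr u.1.1, ratr u.1.2[%classic `*` `]ratr u.2.1, ratr u.2.2[%classic.
have -> : A = \bigcup_(u in [set u | B u `<=` A]) B u.
  apply/seteqP; split=> [p Ap|p [u /= BA]]; last exact: BA.
  have [e e0 he] := oA _ Ap.
  have [a ha] := @rat_in_itvoo R (p.1 - e) p.1 (ltac:(lra)).
  have [b hb] := @rat_in_itvoo R p.1 (p.1 + e) (ltac:(lra)).
  have [c hc] := @rat_in_itvoo R (p.2 - e) p.2 (ltac:(lra)).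
  have [d hd] := @rat_in_itvoo R p.2 (p.2 + e) (ltac:(lra)).
  move: ha hb hc hd; rewrite !in_itv /= => /andP[a1 a2] /andP[b1 b2].
  move=> /andP[c1 c2] /andP[d1 d2].
  exists (a, b, (c, d)); rewrite /= /B /=; last first.
    by split; rewrite /= in_itv /= ?a2 ?b1 ?c2 ?d1.
  move=> q [/=]; rewrite !in_itv /= => /andP[q1 q2] /andP[q3 q4].
  by apply: he; rewrite ltr_norml; apply/andP; split; lra.
rewrite bigcup_mkcond; apply: countable_bigcupT_measurable => //.
by move=> u; case: ifP => // _; apply: measurableX; exact: measurable_itv.
Qed.

End planar_open_sets.

Section complex_measurability.
Variable R : realType.
Local Notation C := R[i].
Local Notation RR := (measurableTypeR R * measurableTypeR R)%type.

Definition cmeas d (T : measurableType d) (F : T -> C) :=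
  measurable_fun [set: T] (fun t => Re (F t)) /\
  measurable_fun [set: T] (fun t => Im (F t)).

Section closure.
Context d (T : measurableType d).
Implicit Types F G : T -> C.

Lemma eq_mfun (f g : T -> R) : f =1 g -> measurable_fun [set: T] f ->
  measurable_fun [set: T] g.
Proof. by move=> /funext ->. Qed.

Lemma eq_cmeas F G : F =1 G -> cmeas F -> cmeas G.
Proof. by move=> /funext ->. Qed.

Lemma cmeas_cst (a : C) : cmeas (fun _ : T => a).
Proof. by split; exact: measurable_cst. Qed.

Lemma cmeasD F G : cmeas F -> cmeas G -> cmeas (fun t => F t + G t).
Proof.
move=> [f1 f2] [g1 g2]; split.
  apply: (eq_mfun (fun t => esym (RecD (F t) (G t)))).
  exact: measurable_funD.
apply: (eq_mfun (fun t => esym (ImcD (F t) (G t)))).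
exact: measurable_funD.
Qed.

Lemma cmeasM F G : cmeas F -> cmeas G -> cmeas (fun t => F t * G t).
Proof.
move=> [f1 f2] [g1 g2]; split.
  apply: (eq_mfun (fun t => esym (RecM (F t) (G t)))).
  by apply: measurable_funB;
    exact: measurable_funM.
apply: (eq_mfun (fun t => esym (ImcM (F t) (G t)))).
by apply: measurable_funD;
  exact: measurable_funM.
Qed.

Lemma cmeasX F n : cmeas F -> cmeas (fun t => F t ^+ n).
Proof.
move=> mF; elim: n => [|n IH]; first exact: cmeas_cst.
apply: (eq_cmeas (fun t => esym (exprS (F t) n))).
exact: cmeasM.
Qed.

Lemma cmeas_conj F : cmeas F -> cmeas (fun t => (F t)^*).
Proof.
move=> [f1 f2]; split.
  by  apply: (eq_mfun (fun t => esym (RecJ (F t)))).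
apply: (eq_mfun (fun t => esym (ImcJ (F t)))).
exact: measurable_funN.
Qed.

Lemma cmeasN F : cmeas F -> cmeas (fun t => - F t).
Proof.
move=> [f1 f2]; split.
  apply: (eq_mfun (fun t => esym (RecN (F t)))).
  exact: measurable_funN.
apply: (eq_mfun (fun t => esym (ImcN (F t)))).
exact: measurable_funN.
Qed.

Lemma cmeasB F G : cmeas F -> cmeas G -> cmeas (fun t => F t - G t).
Proof. by move=> mF mG; exact: cmeasD mF (cmeasN mG). Qed.

Lemma cmeas_Complex (f g : T -> R) : measurable_fun [set: T] f ->
  measurable_fun [set: T] g -> cmeas (fun t => f t +i* g t).
Proof. by []. Qed.

Lemma cmeas_real (f : T -> R) : measurable_fun [set: T] f ->
  cmeas (fun t => (f t)%:C).
Proof. by move=> mf; apply: cmeas_Complex => //; exact: measurable_cst. Qed.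

Lemma measurable_invr (f : T -> R) : measurable_fun [set: T] f ->
  measurable_fun [set: T] (fun t => (f t)^-1).
Proof.
move=> mf; apply: (@measurableT_comp _ _ _ _ _ _ (fun x : R => x^-1)) => //.
(* Inversion is continuous except at 0, where it takes the default value 0. *)
have -> : (fun x : R => x^-1) = (fun x => if x == 0 then 0 else x^-1).
  by apply/funext => x; case: eqVneq => // ->; rewrite invr0.
apply: measurable_fun_if => //.
  by apply: measurable_fun_eqr => //; exact: measurable_cst.
have -> : setT `&` (fun x : R => x == 0) @^-1` [set false] = [set~ (0 : R)].
  by apply/seteqP; split => x /=; [move=> [_ /eqP]|move=> /eqP/negbTE ->].
apply: open_continuous_measurable_fun.
  by apply: closed_openC; exact: closed_eq.
by move=> x; rewrite inE /= => /eqP x0; exact: inv_continuous.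
Qed.

Lemma measurable_normc F : cmeas F ->
  measurable_fun [set: T] (fun t => normc (F t)).
Proof.
move=> [f1 f2].
have -> : (fun t => normc (F t)) =
    (fun t => Num.sqrt (Re (F t) ^+ 2 + Im (F t) ^+ 2)).
  by apply/funext => t; case: (F t).
apply: (@measurableT_comp _ _ _ _ _ _ (@Num.sqrt R)) => //.
  by apply: continuous_measurable_fun; exact: sqrt_continuous.
by apply: measurable_funD; exact: measurable_funX.
Qed.

Lemma cmeasV F : cmeas F -> cmeas (fun t => (F t)^-1).
Proof.
move=> mF; have [f1 f2] := mF.
have mN : measurable_fun [set: T] (fun t => (normc (F t) ^+ 2)^-1).
  by apply/measurable_invr/measurable_funX/measurable_normc.
split.
  apply: (eq_mfun (fun t => esym (RecV (F t)))).
  exact: measurable_funM.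
apply: (eq_mfun (fun t => esym (ImcV (F t)))).
by apply: measurable_funN; exact: measurable_funM.
Qed.

End closure.

(* The first coordinate is the imaginary part, which Cplus_integral integrates
   last. *)
Definition cpt (p : RR) : C := p.2 +i* p.1.

Definition cborel (h : C -> C) := cmeas (fun p : RR => h (cpt p)).

Lemma cmeas_comp d (T : measurableType d) (h : C -> C) (F : T -> C) :
  cborel h -> cmeas F -> cmeas (fun t => h (F t)).
Proof.
move=> [h1 h2] [f1 f2].
have mp : measurable_fun [set: T] (fun t => (Im (F t), Re (F t)) : RR).
  exact: measurable_fun_pair.
have E : h \o F = (fun t => h (cpt (Im (F t), Re (F t)))).
  by apply/funext => t /=; congr h; case: (F t).
rewrite -/(h \o F) E; split.
  exact: (measurableT_comp h1 mp).
exact: (measurableT_comp h2 mp).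
Qed.

Lemma cmeas_cpt : cmeas cpt.
Proof. by split; [exact: measurable_snd|exact: measurable_fst]. Qed.

Lemma cborel_id : cborel id.
Proof. exact: cmeas_cpt. Qed.

(** The function is continuous inside the half-plane but may jump at its boundary. A superlevel set
    is therefore an open part of the half-plane, together with the whole complement if the level
    lies below [u 0] and with nothing otherwise. *)
Lemma analytic_cborel (h : C -> C) : analytic_on (@Cplus R) h ->
  (forall z, ~ Cplus z -> h z = 0) -> cborel h.
Proof.
move=> ha h0.
suff main (u : C -> R) : (forall z w, `|u z - u w| <= normc (z - w)) ->
    measurable_fun [set: RR] (fun p => u (h (cpt p))).
  split; apply: main => z w; rewrite -?RecN -?RecD -?ImcN -?ImcD.
    exact: ler_normRe.
  exact: ler_normIm.
move=> hu.
apply: (measurability _ (RGenOInfty.measurableE R)) => //.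
move=> _ [_ [x ->] <-]; rewrite setTI.
have mD : measurable [set p : RR | 0 < p.2].
  apply: box_open_measurable => p /= p0; exists p.2 => // q _.
  by rewrite ltr_norml => /andP[]; lra.
have -> : (fun p => u (h (cpt p))) @^-1` `]x, +oo[ =
    [set p : RR | 0 < p.2 /\ x < u (h (cpt p))] `|`
    (if x < u 0 then ~` [set p : RR | 0 < p.2] else set0).
  apply/seteqP; split => p /=; rewrite in_itv /= andbT.
    have [p0|p0] := ltP 0 p.2; first by move=> ?; left.
    rewrite h0; last by rewrite /Cplus /=; apply/negP; rewrite -leNgt.
    by move=> ->; right => /=; apply/negP; rewrite -leNgt.
  move=> [[]//|]; case: ifP => //= xu p0.
  by rewrite h0.
apply: measurableU; last by case: ifP => // _; exact: measurableC.
apply: box_open_measurable => p /= [p0 xp].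
have /derivable_cderiv[a /cderiv_cont] := ha (cpt p) p0.
move=> /(_ (u (h (cpt p)) - x)); rewrite subr_gt0 => /(_ xp)[d d0 hd].
exists (Num.min p.2 (d / 2)); first by rewrite lt_min p0 divr_gt0.
move=> q; rewrite !lt_min => /andP[q1 q1'] /andP[q2 q2'].
have q0 : 0 < q.2 by move: q2; rewrite ltr_norml => /andP[]; lra.
split => //.
have := hd (cpt q); have -> : normc (cpt q - cpt p) < d.
  by apply: le_lt_trans (ler_normc_ReIm _) _; rewrite /=; lra.
move=> /(_ isT) /(le_lt_trans (hu _ _)); rewrite ltr_norml => /andP[]; lra.
Qed.

Lemma cborel_comp (h k : C -> C) : cborel h -> cborel k ->
  cborel (fun z => h (k z)).
Proof. by move=> mh mk; exact: cmeas_comp mh mk. Qed.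

Lemma cborel_conj : cborel (@conjc R).
Proof. exact/cmeas_conj/cborel_id. Qed.

End complex_measurability.

(** * Complex integrals and Fubini *)

Section complex_integral.
Context d (T : measurableType d) (R : realType).
Variable mu : {measure set T -> \bar R}.
Local Notation C := R[i].
Implicit Types (D : set T) (F G : T -> C) (g : T -> R) (a : C).

Definition cint D F : C :=
  Rintegral mu D (fun t => Re (F t)) +i* Rintegral mu D (fun t => Im (F t)).

Definition cintegrable D F :=
  mu.-integrable D (fun t => (Re (F t))%:E) /\
  mu.-integrable D (fun t => (Im (F t))%:E).

Lemma eq_cint D F G : (forall t, D t -> F t = G t) -> cint D F = cint D G.
Proof.
by move=> FG; congr Complex; apply: eq_Rintegral => t /set_mem Dt; rewrite FG.
Qed.

Lemma eq_cintegrable D F G : measurable D ->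
  (forall t, D t -> F t = G t) -> cintegrable D F -> cintegrable D G.
Proof.
move=> mD FG [f1 f2]; split; [apply: eq_integrable f1|apply: eq_integrable f2];
  by move=> // t /set_mem Dt; rewrite FG.
Qed.

Lemma cintegrable_le D F g : measurable D -> cmeas F ->
  mu.-integrable D (fun t => (g t)%:E) ->
  (forall t, D t -> normc (F t) <= g t) -> cintegrable D F.
Proof.
move=> mD [f1 f2] ig Fg; split; apply: (le_integrable mD _ _ ig).
- exact/measurable_EFinP/measurable_funTS.
- move=> t Dt /=; rewrite lee_fin (le_trans (ler_normRe _))//.
  by rewrite (le_trans (Fg t Dt))// ler_norm.
- exact/measurable_EFinP/measurable_funTS.
move=> t Dt /=; rewrite lee_fin (le_trans (ler_normIm _))//.
by rewrite (le_trans (Fg t Dt))// ler_norm.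
Qed.

Lemma integrable_ge0 D g : measurable D -> measurable_fun [set: T] g ->
  (forall t, 0 <= g t) -> (\int[mu]_(t in D) (g t)%:E < +oo)%E ->
  mu.-integrable D (fun t => (g t)%:E).
Proof.
move=> mD mg g0 goo; apply/integrableP; split.
  exact/measurable_EFinP/measurable_funTS.
rewrite (eq_integral (fun t => (g t)%:E))// => t _.
by rewrite abse_EFin ger0_norm.
Qed.

Lemma cintegrable_lty D F : measurable D -> cmeas F ->
  (\int[mu]_(t in D) (normc (F t))%:E < +oo)%E -> cintegrable D F.
Proof.
move=> mD mF Foo; apply: (@cintegrable_le D F (fun t => normc (F t))) => //.
apply: integrable_ge0 => // [|t]; first exact: measurable_normc.
exact: normc_ge0.
Qed.

Lemma cintegrableD D F G : measurable D -> cintegrable D F ->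
  cintegrable D G -> cintegrable D (fun t => F t + G t).
Proof.
move=> mD [f1 f2] [g1 g2]; split.
  by apply: eq_integrable (integrableD mD f1 g1) => // t _; rewrite RecD.
by apply: eq_integrable (integrableD mD f2 g2) => // t _; rewrite ImcD.
Qed.

Lemma cintD D F G : measurable D -> cintegrable D F -> cintegrable D G ->
  cint D (fun t => F t + G t) = cint D F + cint D G.
Proof.
move=> mD [f1 f2] [g1 g2]; apply: complex_ext; rewrite ?RecD ?ImcD /= -RintegralD//;
  by apply: eq_Rintegral => t _; rewrite ?RecD ?ImcD.
Qed.

Lemma cintegrableZ D F a : measurable D -> cintegrable D F ->
  cintegrable D (fun t => a * F t).
Proof.
move=> mD [f1 f2]; split.
  apply: eq_integrable (integrableB mD (integrableZl mD (Re a) f1)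
    (integrableZl mD (Im a) f2)) => // t _.
  by rewrite RecM EFinB !EFinM.
apply: eq_integrable (integrableD mD (integrableZl mD (Re a) f2)
    (integrableZl mD (Im a) f1)) => // t _.
by rewrite ImcM EFinD !EFinM.
Qed.

Lemma cintZ D F a : measurable D -> cintegrable D F ->
  cint D (fun t => a * F t) = a * cint D F.
Proof.
move=> mD [f1 f2].
have ZlE (x : R) g : mu.-integrable D (fun t => (g t)%:E) ->
    mu.-integrable D (fun t => (x * g t)%:E).
  by move=> ig; apply: eq_integrable (integrableZl mD x ig) => // t _; rewrite EFinM.
apply: complex_ext; rewrite ?RecM ?ImcM /= -!RintegralZl//.
  rewrite -RintegralB//; [|exact: ZlE|exact: ZlE].
  by apply: eq_Rintegral => t _; rewrite RecM.
rewrite -RintegralD//; [|exact: ZlE|exact: ZlE].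
by apply: eq_Rintegral => t _; rewrite ImcM.
Qed.

Lemma cintegrableN D F : measurable D -> cintegrable D F ->
  cintegrable D (fun t => - F t).
Proof.
move=> mD iF; apply: eq_cintegrable (cintegrableZ (-1) mD iF) => // t _.
by rewrite mulN1r.
Qed.

Lemma cintB D F G : measurable D -> cintegrable D F -> cintegrable D G ->
  cint D (fun t => F t - G t) = cint D F - cint D G.
Proof.
move=> mD iF iG; rewrite cintD//; last exact: cintegrableN.
by rewrite -[in RHS]mulN1r -cintZ//; congr (_ + _); apply: eq_cint => t _;
  rewrite mulN1r.
Qed.

Lemma cint_conj D F : measurable D -> cintegrable D F ->
  cint D (fun t => (F t)^*) = (cint D F)^*.
Proof.
move=> mD [f1 f2]; apply: complex_ext => /=.
  by apply: eq_Rintegral => t _; rewrite RecJ.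
rewrite -mulN1r -RintegralZl//; apply: eq_Rintegral => t _.
by rewrite ImcJ mulN1r.
Qed.

(** Real and imaginary parts are estimated separately, whence the factor 2; every later use
    tolerates a constant. *)
Lemma normc_cint_le D F g : measurable D -> cintegrable D F ->
  mu.-integrable D (fun t => (g t)%:E) ->
  (forall t, D t -> normc (F t) <= g t) ->
  normc (cint D F) <= 2 * Rintegral mu D g.
Proof.
move=> mD [f1 f2] ig Fg; rewrite mulrC mulr_natr mulr2n.
apply: le_trans (ler_normc_ReIm _) _; apply: lerD => /=.
  apply: le_trans (le_normr_Rintegral mD f1) _.
  apply: le_Rintegral => //; first exact: integrable_norm f1.
  by move=> t Dt; exact: le_trans (ler_normRe _) (Fg t Dt).
apply: le_trans (le_normr_Rintegral mD f2) _.
apply: le_Rintegral => //; first exact: integrable_norm f2.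
by move=> t Dt; exact: le_trans (ler_normIm _) (Fg t Dt).
Qed.

Lemma cint_cst D a : measurable D ->
  cint D (fun=> a) = a * (fine (mu D))%:C.
Proof.
by move=> mD; apply: complex_ext; rewrite ?RecM ?ImcM /= !Rintegral_cst// mulr0
  ?subr0 ?add0r.
Qed.

Lemma cint_real D g : measurable D ->
  cint D (fun t => (g t)%:C) = (Rintegral mu D g)%:C.
Proof.
by move=> mD; apply: complex_ext => //=; rewrite Rintegral_cst// mul0r.
Qed.

End complex_integral.

Section complex_fubini.
Context d1 d2 (T1 : measurableType d1) (T2 : measurableType d2) (R : realType).
Variable m1 : {sigma_finite_measure set T1 -> \bar R}.
Variable m2 : {sigma_finite_measure set T2 -> \bar R}.
Variables (D1 : set T1) (D2 : set T2).
Hypotheses (mD1 : measurable D1) (mD2 : measurable D2).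

Lemma integrable_prod (G : T1 * T2 -> R) : measurable_fun [set: T1 * T2] G ->
  (forall p, 0 <= G p) ->
  (\int[m1]_(x in D1) \int[m2]_(y in D2) (G (x, y))%:E < +oo)%E ->
  (m1 \x m2)%E.-integrable setT ((EFin \o G) \_ (D1 `*` D2)).
Proof.
move=> mG G0 Goo; set g := (EFin \o G) \_ _.
have mD : measurable (D1 `*` D2) by exact: measurableX.
have mg : measurable_fun setT g.
  apply/(measurable_restrictT (EFin \o G) mD)/measurable_funTS.
  exact: measurableT_comp.
apply/integrable12ltyP; first exact: mg.
rewrite [ltLHS](_ : _ =
  \int[m1]_(x in D1) \int[m2]_(y in D2) (G (x, y))%:E)%E; first exact: Goo.
rewrite [RHS]integral_mkcond; apply: eq_integral => x _.
rewrite patchE; case: ifPn => [D1x|D1x].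
  rewrite [RHS]integral_mkcond; apply: eq_integral => y _.
  rewrite /g !patchE in_setX /= D1x /=.
  by case: ifP => _; rewrite ?abse0// gee0_abs// lee_fin.
by rewrite integral0_eq// => y _; rewrite /g patchE in_setX /= (negbTE D1x) abse0.
Qed.

Lemma Rintegral_fubini (f G : T1 * T2 -> R) : measurable_fun [set: T1 * T2] f ->
  measurable_fun [set: T1 * T2] G -> (forall p, `|f p| <= G p) ->
  (\int[m1]_(x in D1) \int[m2]_(y in D2) (G (x, y))%:E < +oo)%E ->
  Rintegral m1 D1 (fun x => Rintegral m2 D2 (fun y => f (x, y))) =
  Rintegral m2 D2 (fun y => Rintegral m1 D1 (fun x => f (x, y))).
Proof.
move=> mf mG fG Goo; pose D := D1 `*` D2.
have mD : measurable D by exact: measurableX.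
pose g := (EFin \o f) \_ D.
have gE x y : g (x, y) = ((fun x => ((EFin \o f \o pair x) \_ D2) y) \_ D1) x.
  rewrite /g !patchE /D in_setX /=.
  by case: (x \in D1); case: (y \in D2).
have gEx x : D1 x -> (fun y => g (x, y)) = (fun y => (f (x, y))%:E) \_ D2.
  by move=> D1x; apply/funext => y; rewrite gE !patchE mem_set.
have gEx0 x : ~ D1 x -> (fun y => g (x, y)) = cst 0%E.
  by move=> D1x; apply/funext => y; rewrite gE patchE memNset.
have gEy y : D2 y -> (fun x => g (x, y)) = (fun x => (f (x, y))%:E) \_ D1.
  by move=> D2y; apply/funext => x; rewrite gE !patchE (mem_set D2y).
have gEy0 y : ~ D2 y -> (fun x => g (x, y)) = cst 0%E.
  move=> D2y; apply/funext => x; rewrite gE !patchE (memNset D2y).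
  by case: ifP.
have mg : measurable_fun setT g.
  apply/(measurable_restrictT (EFin \o f) mD)/measurable_funTS.
  exact: measurableT_comp.
have ig : (m1 \x m2)%E.-integrable setT g.
  apply: (le_integrable measurableT mg _ (integrable_prod mG _ Goo)).
    move=> p _; rewrite /g !patchE; case: ifP => // _ /=.
    by rewrite lee_fin (le_trans (fG p))// ler_norm.
  by move=> p; exact: le_trans (fG p).
transitivity (fine (\int[m1 \x m2]_z g z)%E).
  rewrite -integral12_prod_meas1// Rintegral_mkcond; congr fine.
  (* The inner integral may be infinite on a null set, where [fine] replaces it by 0; almost
     everywhere the two agree. *)
  rewrite (_ : _ \_ D1 = fine \o fubini_F m2 g).
    apply: ae_eq_integral => //.
    - apply: measurableT_comp => //; apply: measurableT_comp => //.
      exact: measurable_fubini_F ig.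
    - exact: measurable_fubini_F ig.
    apply: filterS (ae_integrable1 ig) => x igx _.
    by rewrite /= fineK//; exact: integrable_fin_num.
  apply/funext => x; rewrite patchE /= /fubini_F.
  case: ifPn => [/set_mem D1x|].
    by rewrite gEx// /Rintegral integral_mkcond.
  by rewrite notin_setE => D1x; rewrite gEx0// integral0.
rewrite -integral21_prod_meas1// Rintegral_mkcond; congr fine.
rewrite (_ : _ \_ D2 = fine \o fubini_G m1 g).
  apply: ae_eq_integral => //.
  - exact: measurable_fubini_G ig.
  - apply: measurableT_comp => //; apply: measurableT_comp => //.
    exact: measurable_fubini_G ig.
  apply: filterS (ae_integrable2 ig) => y igy _.
  by rewrite /= fineK//; exact: integrable_fin_num.
apply/funext => y; rewrite patchE /= /fubini_G.
case: ifPn => [/set_mem D2y|].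
  by rewrite gEy// /Rintegral integral_mkcond.
by rewrite notin_setE => D2y; rewrite gEy0// integral0.
Qed.

Lemma cint_fubini (F : T1 * T2 -> R[i]) : cmeas F ->
  (\int[m1]_(x in D1) \int[m2]_(y in D2) (normc (F (x, y)))%:E < +oo)%E ->
  cint m1 D1 (fun x => cint m2 D2 (fun y => F (x, y))) =
  cint m2 D2 (fun y => cint m1 D1 (fun x => F (x, y))).
Proof.
move=> mF Foo; have [f1 f2] := mF; have mN := measurable_normc mF.
apply: complex_ext => /=.
  by apply: (Rintegral_fubini f1 mN _ Foo) => p; exact: ler_normRe.
by apply: (Rintegral_fubini f2 mN _ Foo) => p; exact: ler_normIm.
Qed.

End complex_fubini.

(** * Tonelli's theorem on products of domains *)

Section tonelli_on_products.
Context d1 d2 (T1 : measurableType d1) (T2 : measurableType d2) (R : realType).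
Variable m1 : {sigma_finite_measure set T1 -> \bar R}.
Variable m2 : {sigma_finite_measure set T2 -> \bar R}.
Variables (D1 : set T1) (D2 : set T2).
Hypotheses (mD1 : measurable D1) (mD2 : measurable D2).
Variable f : T1 * T2 -> R.
Hypotheses (mf : measurable_fun [set: T1 * T2] f) (f0 : forall p, 0 <= f p).

Let g := (EFin \o f) \_ (D1 `*` D2).

Let mg : measurable_fun setT g.
Proof.
apply/(measurable_restrictT (EFin \o f)); first exact: measurableX.
by apply: measurable_funTS; exact: measurableT_comp.
Qed.

Let g0 p : (0 <= g p)%E.
Proof. by rewrite /g patchE; case: ifP => // _; rewrite lee_fin. Qed.

Let gF : (\int[m1]_x \int[m2]_y g (x, y) =
  \int[m1]_(x in D1) \int[m2]_(y in D2) (f (x, y))%:E)%E.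
Proof.
rewrite [RHS]integral_mkcond; apply: eq_integral => x _.
rewrite patchE; case: ifPn => [D1x|D1x].
  rewrite [RHS]integral_mkcond; apply: eq_integral => y _.
  by rewrite /g !patchE in_setX /= D1x.
by rewrite integral0_eq// => y _; rewrite /g patchE in_setX /= (negbTE D1x).
Qed.

Let gG : (\int[m2]_y \int[m1]_x g (x, y) =
  \int[m2]_(y in D2) \int[m1]_(x in D1) (f (x, y))%:E)%E.
Proof.
rewrite [RHS]integral_mkcond; apply: eq_integral => y _.
rewrite patchE; case: ifPn => [D2y|D2y].
  rewrite [RHS]integral_mkcond; apply: eq_integral => x _.
  by rewrite /g !patchE in_setX /= D2y andbT.
rewrite integral0_eq// => x _.
by rewrite /g patchE in_setX /= (negbTE D2y) andbF.
Qed.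

Lemma measurable_partial_integral :
  measurable_fun D1 (fun x => \int[m2]_(y in D2) (f (x, y))%:E)%E.
Proof.
have := measurable_fun_fubini_tonelli_F g mg g0 => /(_ m2) mF.
apply: (eq_measurable_fun (fun x => \int[m2]_y g (x, y))%E).
  move=> x D1x; rewrite [RHS]integral_mkcond; apply: eq_integral => y _.
  by rewrite /g !patchE in_setX /= D1x.
exact: measurable_funTS.
Qed.

Lemma tonelli_prod1 : (\int[m1 \x m2]_(p in D1 `*` D2) (f p)%:E =
  \int[m1]_(x in D1) \int[m2]_(y in D2) (f (x, y))%:E)%E.
Proof. by rewrite integral_mkcond -gF -fubini_tonelli1. Qed.

Lemma tonelli_prod2 : (\int[m1 \x m2]_(p in D1 `*` D2) (f p)%:E =
  \int[m2]_(y in D2) \int[m1]_(x in D1) (f (x, y))%:E)%E.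
Proof. by rewrite integral_mkcond -gG -fubini_tonelli2. Qed.

Lemma tonelli_swap : (\int[m1]_(x in D1) \int[m2]_(y in D2) (f (x, y))%:E =
  \int[m2]_(y in D2) \int[m1]_(x in D1) (f (x, y))%:E)%E.
Proof. by rewrite -tonelli_prod1 tonelli_prod2. Qed.

End tonelli_on_products.

(** * Changes of variable on the line and the half-line *)

Section real_substitution.
Variable R : realType.
Local Notation leb := (@lebesgue_measure R).
Local Notation TR := (measurableTypeR R).

Section affine.
Variables (c t : R).
Hypothesis c0 : 0 < c.
Let phi (x : TR) : TR := c * x + t.

Let mphi : measurable_fun [set: TR] phi.
Proof.
by apply: measurable_funD => //; exact: measurable_funM.
Qed.

Let push : {measure set TR -> \bar R} :=
  measure_function_pushforward__canonical__measure_function_Measure leb mphi.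
Let nu : {measure set TR -> \bar R} := mscale (NngNum (ltW c0)) push.

(** The pushforward of Lebesgue measure along [phi], rescaled by [c], gives half-open intervals
    their length, so uniqueness identifies it with Lebesgue measure. *)
Let nuE (A : set TR) : measurable A -> leb A = nu A.
Proof.
apply: lebesgue_measure_unique => _ [[a b]] _ <-.
rewrite /nu /= /mscale /= /pushforward.
have -> : phi @^-1` `]a, b] = `](a - t) / c, (b - t) / c]%classic.
  apply/seteqP; split => x /=; rewrite !in_itv /= /phi.
    rewrite ltr_pdivrMr// ler_pdivlMr// => /andP[]; rewrite (mulrC x); lra.
  rewrite ltr_pdivrMr// ler_pdivlMr// => /andP[]; rewrite (mulrC x).
  by move=> ? ?; apply/andP; split; lra.
rewrite !lebesgue_measure_itv /= !lte_fin ltr_pM2r ?invr_gt0// ltrD2r.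
case: ifP => _; last by rewrite mule0.
by rewrite -!EFinB -EFinM; congr EFin; field; rewrite gt_eqF.
Qed.

Lemma ge0_integral_affine (f : R -> R) : measurable_fun [set: R] f ->
  (forall x, 0 <= f x) ->
  (\int[leb]_x (f (c * x + t) * c)%:E = \int[leb]_x (f x)%:E)%E.
Proof.
move=> mf f0.
have mf' : measurable_fun [set: R] (fun x => (f (c * x + t))%:E).
  by apply/measurable_EFinP; exact: (measurableT_comp mf mphi).
transitivity (\int[nu]_x (f x)%:E)%E; last first.
  by apply: eq_measure_integral => A mA _; rewrite -nuE.
rewrite /nu ge0_integral_mscale//; last 2 first.
  exact/measurable_EFinP.
  by move=> x _; rewrite lee_fin.
rewrite ge0_integral_pushforward//; last 2 first.
  exact/measurable_EFinP.
  by move=> x _; rewrite lee_fin.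
rewrite preimage_setT -ge0_integralZl//; last first.
  by move=> x _; rewrite lee_fin.
by apply: eq_integral => x _; rewrite muleC EFinM.
Qed.

End affine.

Lemma ge0_integral_opp (f : R -> R) : measurable_fun [set: R] f ->
  (forall x, 0 <= f x) ->
  (\int[leb]_x (f (- x))%:E = \int[leb]_x (f x)%:E)%E.
Proof.
move=> mf f0.
transitivity (\int[pushforward leb (-%R : TR -> TR)]_x (f x)%:E)%E.
  rewrite ge0_integral_pushforward//.
  exact/measurable_EFinP.
  by move=> x _; rewrite lee_fin.
by apply: eq_measure_integral => A mA _; exact: lebesgue_measureN.
Qed.

Local Notation P := (`]0%R, +oo[%classic : set R).

Lemma ge0_integral_scale (c : R) (f : R -> R) : 0 < c ->
  measurable_fun [set: R] f -> (forall x, 0 <= f x) ->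
  (\int[leb]_(x in P) (f (c * x) * c)%:E = \int[leb]_(x in P) (f x)%:E)%E.
Proof.
move=> c0 mf f0; rewrite integral_mkcond [RHS]integral_mkcond.
pose g x := if 0 < x then f x else 0.
have mg : measurable_fun [set: R] g.
  apply: measurable_fun_ifT => //.
  by apply: measurable_fun_ltr => //; exact: measurable_cst.
have g0 x : 0 <= g x by rewrite /g; case: ifP.
transitivity (\int[leb]_x (g (c * x + 0) * c)%:E)%E.
  apply: eq_integral => x _; rewrite patchE addr0 /g pmulr_rgt0//.
  by rewrite mem_setE in_itv /= andbT; case: ifP => //; rewrite mul0r.
rewrite ge0_integral_affine//; apply: eq_integral => x _.
by rewrite patchE /g mem_setE in_itv /= andbT; case: ifP.
Qed.

(** The shift moves the half-line into itself, so the left side sees only the mass of [f] beyond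
    [t]. *)
Lemma ge0_integral_shift_le (t : R) (f : R -> R) : 0 <= t ->
  measurable_fun [set: R] f -> (forall x, 0 <= f x) ->
  (\int[leb]_(x in P) (f (x + t))%:E <= \int[leb]_(x in P) (f x)%:E)%E.
Proof.
move=> t0 mf f0; rewrite integral_mkcond [leRHS]integral_mkcond.
pose g x := if 0 < x then f x else 0.
have mg : measurable_fun [set: R] g.
  apply: measurable_fun_ifT => //.
  by apply: measurable_fun_ltr => //; exact: measurable_cst.
have g0 x : 0 <= g x by rewrite /g; case: ifP.
have -> : (\int[leb]_x ((fun x => (f x)%:E) \_ P) x =
    \int[leb]_x (g (1 * x + t) * 1)%:E)%E.
  rewrite ge0_integral_affine//; apply: eq_integral => x _.
  by rewrite patchE /g mem_setE in_itv /= andbT; case: ifP.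
apply: ge0_le_integral => //.
- by move=> x _; rewrite patchE; case: ifP => // _; rewrite lee_fin.
- apply/(measurable_restrictT _ (measurable_itv _)); apply: measurable_funTS.
  apply/measurable_EFinP; apply: (measurableT_comp mf).
  exact: measurable_funD.
- apply/measurable_EFinP; apply: measurable_funM => //.
  by apply: (measurableT_comp mg); apply: measurable_funD => //; exact: measurable_funM.
move=> x _; rewrite patchE mem_setE in_itv /= andbT mul1r mulr1.
case: ifP => x0; last by rewrite lee_fin.
by rewrite /g ifT// ltr_wpDr.
Qed.

Lemma ge0_integralZlR d (T : measurableType d)
    (mu : {measure set T -> \bar R}) (D : set T) (k : R) (g : T -> R) :
  measurable D -> measurable_fun [set: T] g -> (forall x, D x -> 0 <= g x) ->
  0 <= k ->
  (\int[mu]_(x in D) (k * g x)%:E = k%:E * \int[mu]_(x in D) (g x)%:E)%E.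
Proof.
move=> mD mg g0 k0; rewrite -ge0_integralZl//.
exact/measurable_EFinP/measurable_funTS.
Qed.

Lemma ge0_integralZle d (T : measurableType d)
    (mu : {measure set T -> \bar R}) (D : set T) (c : \bar R) (g : T -> R) :
  measurable D -> measurable_fun [set: T] g -> (forall x, D x -> 0 <= g x) ->
  (0 <= c)%E ->
  (\int[mu]_(x in D) (c * (g x)%:E) = c * \int[mu]_(x in D) (g x)%:E)%E.
Proof.
move=> mD mg g0 k0; rewrite -ge0_integralZl//.
exact/measurable_EFinP/measurable_funTS.
Qed.

(* Uniqueness of Haar measure: comparing the two ways of integrating
   F(y) G(xy) dx/x dy/y gives I(F) I(G) = I(F o inv) I(G). *)
Lemma integral_inv_haar (f G : R -> R) :
  measurable_fun [set: R] f -> (forall x, 0 <= f x) ->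
  measurable_fun [set: R] G -> (forall x, 0 <= G x) ->
  (forall x, 0 <= G x / x) ->
  let c := (\int[leb]_(u in P) (G u / u)%:E)%E in
  (c * \int[leb]_(x in P) (f x)%:E =
   c * \int[leb]_(x in P) (f x^-1 / x ^+ 2)%:E)%E.
Proof.
move=> mf f0 mG G0 Gu0 c.
have mV (h : R -> R) : measurable_fun [set: R] h ->
  measurable_fun [set: R] (fun x => (h x)^-1) by exact: measurable_invr.
have mP : measurable (P : set TR) by exact: measurable_itv.
have mfV : measurable_fun [set: R] (fun x => f x^-1).
  by apply: (measurableT_comp mf); exact: measurable_invr.
have mGu : measurable_fun [set: R] (fun u => G u / u).
  by apply: measurable_funM => //; exact: measurable_invr.
have Pgt0 x : P x -> 0 < x by rewrite /= in_itv /= andbT.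
have c_ge0 : (0 <= c)%E by apply: integral_ge0 => x _; rewrite lee_fin.
have cE y : 0 < y -> (\int[leb]_(x in P) (G (x * y) / x)%:E = c)%E.
  move=> y0; rewrite /c -(ge0_integral_scale y0 mGu Gu0).
  apply: eq_integral => x /set_mem /Pgt0 x0.
  congr EFin; rewrite (mulrC y); move: (G (x * y)) => a.
  by field; rewrite !gt_eqF.
have mfst : measurable_fun [set: TR * TR] (fun p => p.1 : R) by exact: measurable_fst.
have msnd : measurable_fun [set: TR * TR] (fun p => p.2 : R) by exact: measurable_snd.
pose h (p : TR * TR) : R := f p.2 * (G (p.1 * p.2) / `|p.1|).
have mh : measurable_fun setT h.
  apply: measurable_funM; first exact: measurableT_comp mf msnd.
  apply: measurable_funM.
    by apply: (measurableT_comp mG); exact: measurable_funM mfst msnd.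
  by apply: measurable_invr; exact: measurableT_comp.
have h0 p : 0 <= h p by rewrite /h mulr_ge0// divr_ge0.
have S := @tonelli_swap _ _ TR TR R leb leb P P mP mP h mh h0.
pose h2 (p : TR * TR) : R := f (p.2 / p.1) * G p.2 / p.1 ^+ 2.
have mh2 : measurable_fun setT h2.
  apply: measurable_funM; last by apply: measurable_invr; exact: measurable_funX mfst.
  apply: measurable_funM; last exact: measurableT_comp mG msnd.
  apply: (measurableT_comp mf); apply: measurable_funM msnd _.
  exact: measurable_invr mfst.
have h20 p : 0 <= h2 p by rewrite /h2; apply: divr_ge0; [exact: mulr_ge0|exact: sqr_ge0].
have S2 := @tonelli_swap _ _ TR TR R leb leb P P mP mP h2 mh2 h20.
have mGy y : measurable_fun [set: R] (fun x => G (x * y) / x).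
  apply: measurable_funM; last exact: measurable_invr.
  by apply: (measurableT_comp mG); exact: measurable_funM.
have mfV2 : measurable_fun [set: R] (fun x => f x^-1 / x ^+ 2).
  apply: measurable_funM mfV _; apply: measurable_invr; exact: measurable_funX.
have fV2 x : 0 <= f x^-1 / x ^+ 2 by rewrite divr_ge0 ?sqr_ge0.
transitivity (\int[leb]_(y in P) \int[leb]_(x in P) (h (x, y))%:E)%E.
  rewrite -(ge0_integralZle leb mP mf (fun x _ => f0 x) c_ge0).
  apply: eq_integral => y /set_mem /Pgt0 y0.
  have Gy0 x : P x -> 0 <= G (x * y) / x.
    by move=> Px; apply: divr_ge0 (G0 _) (ltW (Pgt0 _ Px)).
  rewrite -(cE y y0) muleC -(ge0_integralZlR leb mP (mGy y) Gy0 (f0 y)).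
  apply: eq_integral => x /set_mem /Pgt0 x0.
  by rewrite /h /= (gtr0_norm x0).
rewrite -S.
(* Substitution of y / x for y in the inner integral, after which the order is exchanged once
   more. *)
transitivity (\int[leb]_(x in P) \int[leb]_(y in P) (h2 (x, y))%:E)%E.
  apply: eq_integral => x /set_mem /Pgt0 x0.
  have xV0 : 0 < x^-1 by rewrite invr_gt0.
  rewrite -(@ge0_integral_scale _ (fun y => h (x, y)) xV0).
  - apply: eq_integral => y _; rewrite /h /h2 /= (gtr0_norm x0).
    rewrite (mulVKf (lt0r_neq0 x0)) (mulrC x^-1 y); congr EFin.
    by rewrite expr2 invfM !mulrA.
  - rewrite /h /=; apply: measurable_funM mf _; apply: measurable_funM.
      by apply: (measurableT_comp mG); exact: measurable_funM.
    exact: measurable_cst.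
  - by move=> y; exact: h0.
have A0 : (0 <= \int[leb]_(x in P) (f x^-1 / x ^+ 2)%:E)%E.
  by apply: integral_ge0 => x _; rewrite lee_fin.
rewrite S2 muleC -(ge0_integralZle leb mP mGu (fun x _ => Gu0 x) A0).
apply: eq_integral => u /set_mem /Pgt0 u0.
have uV0 : 0 < u^-1 by rewrite invr_gt0.
have mfu : measurable_fun [set: R]
    (fun x => f (u^-1 * x)^-1 / (u^-1 * x) ^+ 2 * u^-1).
  apply: measurable_funM; last exact: measurable_cst.
  by apply: (measurableT_comp mfV2); exact: measurable_funM.
have fu0 x : P x -> 0 <= f (u^-1 * x)^-1 / (u^-1 * x) ^+ 2 * u^-1.
  by move=> _; exact: mulr_ge0 (fV2 _) (ltW uV0).
rewrite muleC -(ge0_integral_scale uV0 mfV2 fV2).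
rewrite -(ge0_integralZlR leb mP mfu fu0 (Gu0 u)).
apply: eq_integral => x /set_mem /Pgt0 x0.
have -> : (u^-1 * x)^-1 = u / x by field; rewrite !gt_eqF.
rewrite /h2 /=; congr EFin; move: (G u) (f (u / x)) => a b.
by field; rewrite !gt_eqF.
Qed.

(** [integral_inv_haar] gives this up to the factor [c]; with the indicator of [1, 2] for [G], that
    factor lies between 1/2 and 1 and can be cancelled. *)
Lemma ge0_integral_inv (f : R -> R) :
  measurable_fun [set: R] f -> (forall x, 0 <= f x) ->
  (\int[leb]_(x in P) (f x^-1 / x ^+ 2)%:E = \int[leb]_(x in P) (f x)%:E)%E.
Proof.
move=> mf f0.
pose G (u : R) := \1_(`[1, 2]%classic) u : R.
have mG : measurable_fun [set: R] G by exact: measurable_indic.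
have G0 u : 0 <= G u by rewrite /G indicE.
have mGu : measurable_fun [set: R] (fun u => G u / u).
  by apply: measurable_funM => //; exact: measurable_invr.
have Gu0 u : 0 <= G u / u.
  rewrite /G indicE mem_setE in_itv /=; case: andP => [[u1 _]|_].
    by rewrite divr_ge0// (le_trans _ u1).
  by rewrite mul0r.
have G1 : (\int[leb]_(u in P) (G u)%:E = 1)%E.
  rewrite integral_indic// setIidl; last first.
    by move=> u /=; rewrite !in_itv /= andbT => /andP[u1 _]; exact: lt_le_trans u1.
  by rewrite /= lebesgue_measure_itv /= lte_fin ltr1n -EFinB; congr EFin; ring.
have mGE : measurable_fun P (fun u => (G u)%:E).
  by apply: measurable_funTS; exact/measurable_EFinP.
pose c := (\int[leb]_(u in P) (G u / u)%:E)%E.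
have c_gt0 : (0 < c)%E.
  apply: (@lt_le_trans _ _ (\int[leb]_(u in P) (2^-1 * G u)%:E)%E).
    under eq_integral do rewrite EFinM.
    by rewrite ge0_integralZl// ?G1 ?mule1 ?lte_fin// => u _; rewrite lee_fin.
  apply: ge0_le_integral => //.
  - by move=> u _; rewrite lee_fin mulr_ge0.
  - by apply: measurable_funTS; apply/measurable_EFinP; exact: measurable_funM.
  - by apply: measurable_funTS; exact/measurable_EFinP.
  move=> u _; rewrite lee_fin /G indicE mem_setE in_itv /=.
  case: andP => [[u1 u2]|_]; last by rewrite mulr0 mul0r.
  by rewrite mul1r mulr1 lef_pV2 ?posrE//; exact: lt_le_trans u1.
have c_lty : (c < +oo)%E.
  apply: (@le_lt_trans _ _ 1%E); last exact: ltry.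
  rewrite -G1; apply: ge0_le_integral => //.
  - by move=> u _; rewrite lee_fin.
  - by apply: measurable_funTS; exact/measurable_EFinP.
  move=> u _; rewrite lee_fin /G indicE mem_setE in_itv /=.
  case: andP => [[u1 u2]|_]; last by rewrite mul0r.
  by rewrite mul1r invf_le1//; exact: lt_le_trans u1.
have cfin : c \is a fin_num by rewrite ge0_fin_numE// ltW.
have key := integral_inv_haar mf f0 mG G0 Gu0; rewrite /= -/c in key.
by apply/le_anti/andP; split; rewrite -(lee_pmul2l cfin c_gt0) key.
Qed.

End real_substitution.

(** * Integration over the half-plane *)

Section planar_measure.
Variable R : realType.
Local Notation leb := (@lebesgue_measure R).
Local Notation TR := (measurableTypeR R).

(** Named so that it can carry a sigma-finite structure, which Fubini needs when the plane is itself
    one factor of a product. *)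
Definition planar_measure : set (TR * TR) -> \bar R := (leb \x leb)%E.

HB.instance Definition _ := Measure.on planar_measure.

Let planar_sigma_finite : sigma_finite setT planar_measure.
Proof.
pose I (n : nat) : set TR := `](- n%:R), n%:R[%classic.
exists (fun n => I n `*` I n).
  apply/seteqP; split=> // -[y x] _.
  exists (Num.bound (`|y| + `|x|)) => //=.
  have := archi_boundP (addr_ge0 (normr_ge0 y) (normr_ge0 x)).
  have := normr_ge0 y; have := normr_ge0 x => x0 y0 h.
  by split; rewrite /I /= in_itv /= -ltr_norml; lra.
move=> n; split; first by apply: measurableX; exact: measurable_itv.
rewrite /planar_measure product_measure1E; [|exact: measurable_itv|exact: measurable_itv].
rewrite /I /= lebesgue_measure_itv /=; case: ifP => _; last by rewrite mule0 ltry.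
by rewrite -EFinB -EFinM ltry.
Qed.

HB.instance Definition _ :=
  @Measure_isSigmaFinite.Build _ _ _ planar_measure planar_sigma_finite.

End planar_measure.

Section half_plane_integral.
Variable R : realType.
Local Notation C := R[i].
Local Notation leb := (@lebesgue_measure R).
Local Notation TR := (measurableTypeR R).
Local Notation P := (`]0%R, +oo[%classic : set R).
Local Notation m2 := (@planar_measure R).

Definition half_plane : set (TR * TR) := setT `*` P.
Local Notation D := half_plane.

Lemma measurable_half_plane : measurable D.
Proof. by apply: measurableX => //; exact: measurable_itv. Qed.

Lemma half_planeP p : D p <-> 0 < Re (cpt p).
Proof. by rewrite /D /= in_itv /= andbT; split=> [[]|]. Qed.

Definition hint (phi : C -> R) : \bar R := (\int[m2]_(p in D) (phi (cpt p))%:E)%E.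

Definition borelfun (phi : C -> R) :=
  measurable_fun [set: TR * TR] (fun p => phi (cpt p)).

Lemma eq_hint phi psi : (forall z, 0 < Re z -> phi z = psi z) ->
  hint phi = hint psi.
Proof.
by move=> e; apply: eq_integral => p /set_mem /half_planeP p0; rewrite e.
Qed.

Lemma hint_ge0 phi : (forall z, 0 < Re z -> 0 <= phi z) -> (0 <= hint phi)%E.
Proof.
by move=> h; apply: integral_ge0 => p /half_planeP p0; rewrite lee_fin h.
Qed.

Lemma le_hint phi psi : borelfun phi -> borelfun psi ->
  (forall z, 0 < Re z -> 0 <= phi z <= psi z) -> (hint phi <= hint psi)%E.
Proof.
move=> mphi mpsi h; apply: ge0_le_integral.
- exact: measurable_half_plane.
- by move=> p /half_planeP /h /andP[]; rewrite lee_fin.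
- exact/measurable_EFinP/measurable_funTS.
- exact/measurable_EFinP/measurable_funTS.
- by move=> p /half_planeP /h /andP[]; rewrite lee_fin.
Qed.

Lemma borelfun_comp d (T : measurableType d) (phi : C -> R) (F : T -> C) :
  borelfun phi -> cmeas F -> measurable_fun [set: T] (fun t => phi (F t)).
Proof.
move=> mphi [f1 f2].
have mp : measurable_fun [set: T] (fun t => (Im (F t), Re (F t)) : TR * TR).
  exact: measurable_fun_pair.
have -> : (fun t => phi (F t)) = (fun t => phi (cpt (Im (F t), Re (F t)))).
  by apply/funext => t /=; congr phi; case: (F t).
exact: (measurableT_comp mphi mp).
Qed.

Section nonnegative.
Variable phi : C -> R.
Hypotheses (mphi : borelfun phi) (phi0 : forall z, 0 <= phi z).

Lemma hint_iter_x : hint phi =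
  (\int[leb]_y \int[leb]_(x in P) (phi (x +i* y))%:E)%E.
Proof.
exact: (@tonelli_prod1 _ _ TR TR R leb leb setT P measurableT (measurable_itv _)
  (fun p => phi (cpt p)) mphi (fun p => phi0 _)).
Qed.

Lemma hint_iter_y : hint phi =
  (\int[leb]_(x in P) \int[leb]_y (phi (x +i* y))%:E)%E.
Proof.
exact: (@tonelli_prod2 _ _ TR TR R leb leb setT P measurableT (measurable_itv _)
  (fun p => phi (cpt p)) mphi (fun p => phi0 _)).
Qed.

Lemma borelfun_row y : measurable_fun [set: TR] (fun x => phi (x +i* y)).
Proof.
apply: borelfun_comp mphi _; apply: cmeas_Complex => //; exact: measurable_cst.
Qed.

Lemma borelfun_col x : measurable_fun [set: TR] (fun y => phi (x +i* y)).
Proof.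
apply: borelfun_comp mphi _; apply: cmeas_Complex => //; exact: measurable_cst.
Qed.

Lemma measurable_row_integral :
  measurable_fun [set: TR] (fun y => \int[leb]_(x in P) (phi (x +i* y))%:E)%E.
Proof.
exact: (@measurable_partial_integral _ _ TR TR R leb setT P measurableT
  (measurable_itv _) (fun p => phi (cpt p)) mphi (fun p => phi0 _)).
Qed.

End nonnegative.

Lemma hint_imag_shift phi (t : R) : borelfun phi -> (forall z, 0 <= phi z) ->
  hint (fun z => phi (z + (0 +i* t))) = hint phi.
Proof.
move=> mphi phi0.
have mphi' : borelfun (fun z => phi (z + (0 +i* t))).
  by apply: borelfun_comp mphi _; apply: cmeasD; [exact: cborel_id|exact: cmeas_cst].
rewrite (hint_iter_y mphi' (fun z => phi0 _)) (hint_iter_y mphi phi0).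
apply: eq_integral => x _.
rewrite -[RHS](ge0_integral_affine t ltr01)//.
  apply: eq_integral => y _; rewrite mulr1 mul1r; congr (phi _)%:E.
  by apply: complex_ext => /=; rewrite ?addr0.
exact: borelfun_col.
Qed.

Lemma hint_conj phi : borelfun phi -> (forall z, 0 <= phi z) ->
  hint (fun z => phi z^*) = hint phi.
Proof.
move=> mphi phi0.
have mphi' : borelfun (fun z => phi z^*).
  by apply: borelfun_comp mphi _; exact: cborel_conj.
rewrite (hint_iter_y mphi' (fun z => phi0 _)) (hint_iter_y mphi phi0).
apply: eq_integral => x _.
rewrite -[RHS]ge0_integral_opp//.
exact: borelfun_col.
Qed.

Lemma hint_real_shift_le phi (t : R) : 0 <= t -> borelfun phi ->
  (forall z, 0 <= phi z) -> (hint (fun z => phi (z + t%:C)%R) <= hint phi)%E.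
Proof.
move=> t0 mphi phi0.
have mphi' : borelfun (fun z => phi (z + t%:C)).
  by apply: borelfun_comp mphi _; apply: cmeasD; [exact: cborel_id|exact: cmeas_cst].
rewrite (hint_iter_x mphi' (fun z => phi0 _)) (hint_iter_x mphi phi0).
apply: ge0_le_integral => //.
- by move=> y _; apply: integral_ge0 => x _; rewrite lee_fin.
- exact: (measurable_row_integral mphi' (fun z => phi0 _)).
- exact: (measurable_row_integral mphi phi0).
move=> y _.
apply: le_trans (@ge0_integral_shift_le R t (fun x => phi (x +i* y)) t0
  (borelfun_row mphi y) (fun x => phi0 _)).
rewrite le_eqVlt; apply/orP; left; apply/eqP.
apply: eq_integral => x _; congr (phi _)%:E.
by apply: complex_ext => //=; rewrite addr0.
Qed.

Lemma hint_scale phi (c : R) : 0 < c -> borelfun phi ->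
  (forall z, 0 <= phi z) ->
  hint (fun z => phi (c%:C * z) * c ^+ 2) = hint phi.
Proof.
move=> c0 mphi phi0.
have mphi1 : borelfun (fun z => phi (c%:C * z) * c ^+ 2).
  apply: measurable_funM; last exact: measurable_cst.
  by apply: borelfun_comp mphi _; apply: cmeasM; [exact: cmeas_cst|exact: cborel_id].
have mphi2 : borelfun (fun z => phi ((c * Re z) +i* Im z) * c).
  apply: measurable_funM; last exact: measurable_cst.
  apply: borelfun_comp mphi _; apply: cmeas_Complex.
    by apply: measurable_funM; [exact: measurable_cst|exact: measurable_snd].
  exact: measurable_fst.
have cge := ltW c0.
have p1 z : 0 <= phi (c%:C * z) * c ^+ 2 by rewrite mulr_ge0// exprn_ge0.
have p2 z : 0 <= phi ((c * Re z) +i* Im z) * c by rewrite mulr_ge0.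
transitivity (hint (fun z => phi ((c * Re z) +i* Im z) * c)).
  rewrite (hint_iter_y mphi1 p1) (hint_iter_y mphi2 p2).
  apply: eq_integral => x _.
  have mc : measurable_fun [set: R] (fun y => phi ((c * x) +i* y) * c).
    by apply: measurable_funM; [exact: borelfun_col|exact: measurable_cst].
  rewrite -[RHS](ge0_integral_affine 0 c0 mc); last by move=> y; rewrite mulr_ge0.
  apply: eq_integral => y _; rewrite -mulrA -expr2; congr (phi _ * _)%:E.
  by apply: complex_ext => /=; rewrite mul0r ?subr0 ?addr0.
rewrite (hint_iter_x mphi2 p2) (hint_iter_x mphi phi0).
apply: eq_integral => y _.
by rewrite -[RHS](ge0_integral_scale c0 (borelfun_row mphi y)).
Qed.

(** Polar coordinates with the slope in place of the angle, z = x (1 + i y). In them z |-> [1 / z^*]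
    fixes y and sends x to 1 / ((1 + y^2) x), so that one-variable substitutions suffice for it. *)
Lemma hint_polar phi : borelfun phi -> (forall z, 0 <= phi z) ->
  hint phi = hint (fun z => phi ((Re z)%:C * (1 +i* Im z)) * `|Re z|).
Proof.
move=> mphi phi0.
have mphi1 : borelfun (fun z => phi ((Re z)%:C * (1 +i* Im z)) * `|Re z|).
  apply: measurable_funM; last by apply: measurableT_comp => //; exact: measurable_snd.
  apply: borelfun_comp mphi _; apply: cmeasM.
    by apply: cmeas_real; exact: measurable_snd.
  by apply: cmeas_Complex; [exact: measurable_cst|exact: measurable_fst].
have p1 z : 0 <= phi ((Re z)%:C * (1 +i* Im z)) * `|Re z| by rewrite mulr_ge0.
rewrite (hint_iter_y mphi phi0) (hint_iter_y mphi1 p1).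
apply: eq_integral => x /set_mem; rewrite /= in_itv /= andbT => x0.
rewrite -(ge0_integral_affine 0 x0 (borelfun_col mphi x))//.
apply: eq_integral => y _; rewrite (gtr0_norm x0); congr (phi _ * _)%:E.
by apply: complex_ext => /=; rewrite ?addr0 !mul0r ?mulr1 ?subr0 ?addr0.
Qed.

Lemma hint_inv phi : borelfun phi -> (forall z, 0 <= phi z) ->
  hint (fun z => phi (1 / z^*) / normc z ^+ 4) = hint phi.
Proof.
move=> mphi phi0.
have mphi1 : borelfun (fun z => phi (1 / z^*) / normc z ^+ 4).
  apply: measurable_funM.
    apply: borelfun_comp mphi _; apply: cmeasM; first exact: cmeas_cst.
    exact/cmeasV/cborel_conj.
  apply: measurable_invr; apply: measurable_funX.
  by apply: measurable_normc; exact: cborel_id.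
have n0 z : 0 <= phi (1 / z^*) / normc z ^+ 4.
  by apply: divr_ge0 => //; apply: exprn_ge0; exact: normc_ge0.
have mpol psi : borelfun psi ->
    borelfun (fun z => psi ((Re z)%:C * (1 +i* Im z)) * `|Re z|).
  move=> mpsi.
  apply: measurable_funM; last by apply: measurableT_comp => //; exact: measurable_snd.
  apply: borelfun_comp mpsi _; apply: cmeasM.
    by apply: cmeas_real; exact: measurable_snd.
  by apply: cmeas_Complex; [exact: measurable_cst|exact: measurable_fst].
have npol psi : (forall z, 0 <= psi z) ->
    forall z : C, 0 <= psi ((Re z)%:C * (1 +i* Im z)) * `|Re z|.
  by move=> psi0 z; exact: mulr_ge0.
rewrite hint_polar// [RHS]hint_polar//.
rewrite (hint_iter_x (mpol _ mphi1) (npol _ n0)).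
rewrite (hint_iter_x (mpol _ mphi) (npol _ phi0)).
apply: eq_integral => y _; have c0 : 0 < 1 + y ^+ 2.
  by apply: ltr_pwDl => //; exact: sqr_ge0.
have mf := borelfun_row (mpol _ mphi) y.
have f0 x : 0 <= phi ((Re (x +i* y))%:C * (1 +i* Im (x +i* y))) * `|Re (x +i* y)|.
  exact: mulr_ge0.
have mg : measurable_fun [set: R] (fun x => phi ((Re (x^-1 +i* y))%:C * (1 +i* Im (x^-1 +i* y))) * `|Re (x^-1 +i* y)| / x ^+ 2).
  apply: measurable_funM; last by apply: measurable_invr; exact: measurable_funX.
  by apply: (measurableT_comp mf); exact: measurable_invr.
have g0 x : 0 <= phi ((Re (x^-1 +i* y))%:C * (1 +i* Im (x^-1 +i* y))) * `|Re (x^-1 +i* y)| / x ^+ 2.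
  exact: divr_ge0 (f0 _) (sqr_ge0 _).
(* On a line of fixed slope the map is an inversion combined with a scaling by [1 + y ^+ 2]. *)
rewrite -[RHS](ge0_integral_inv mf f0) -[RHS](ge0_integral_scale c0 mg g0).
apply: eq_integral => x /set_mem; rewrite /= in_itv /= andbT => x0.
have xc : 0 < ((1 + y ^+ 2) * x)^-1 by rewrite invr_gt0 mulr_gt0.
rewrite (gtr0_norm x0) (gtr0_norm xc) -!mulrA; congr (phi _ * _)%:E.
  have e : x ^+ 2 + (- (x * y)) ^+ 2 = x ^+ 2 * (1 + y ^+ 2) by ring.
  apply: complex_ext => /=;
    rewrite ?mul0r ?mulr0 ?subr0 ?addr0 ?mulr1 ?mul1r e.
    by field; rewrite !gt_eqF.
  by field; rewrite !gt_eqF.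
rewrite /= !mulr1 !mul0r subr0 addr0.
have -> : Num.sqrt (x ^+ 2 + (x * y) ^+ 2) ^+ 4 = (x ^+ 2 * (1 + y ^+ 2)) ^+ 2.
  rewrite (exprM _ 2 2) sqr_sqrtr; first by ring.
  by rewrite addr_ge0 ?sqr_ge0.
by field; rewrite !gt_eqF.
Qed.

End half_plane_integral.

(** * Goursat's theorem on rectangles *)

Section interval_integral.
Variable R : realType.
Local Notation C := R[i].
Local Notation leb := (@lebesgue_measure R).

Definition cintI (a b : R) (F : R -> C) := cint leb `[a, b]%classic F.

Definition ccont_at (F : R -> C) (x : R) := forall e : R, 0 < e ->
  exists2 d : R, 0 < d & forall y, `|y - x| < d -> normc (F y - F x) < e.

Lemma ccont_integrable (a b : R) (F : R -> C) :
  (forall x, a <= x <= b -> ccont_at F x) -> cintegrable leb `[a, b]%classic F.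
Proof.
move=> cF.
have main (u : C -> R) : (forall z w, `|u z - u w| <= normc (z - w)) ->
    leb.-integrable `[a, b]%classic (fun t => (u (F t))%:E).
  move=> hu.
  apply: (@continuous_compact_integrable R (fun t => u (F t))).
    exact: segment_compact.
  apply: continuous_in_subspaceT => x; rewrite inE /= in_itv /= => xab.
  apply/cvgrPdist_lt => e e0; have [d d0 hd] := cF x xab e e0.
  apply/nbhs_ballP; exists d => // y /= xy.
  apply: le_lt_trans (hu _ _) _; rewrite normc_distC; apply: hd.
  by rewrite distrC.
split; apply: main => z w; rewrite -?RecN -?RecD -?ImcN -?ImcD.
  exact: ler_normRe.
exact: ler_normIm.
Qed.

Lemma ccont_split (a m b : R) (F : R -> C) : a <= m -> m <= b ->
  (forall x, a <= x <= b -> ccont_at F x) ->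
  cintI a b F = cintI a m F + cintI m b F.
Proof.
move=> am mb /ccont_integrable[f1 f2].
have main (f : R -> R) : leb.-integrable `[a, b]%classic (fun t => (f t)%:E) ->
    Rintegral leb `[a, b]%classic f =
    Rintegral leb `[a, m]%classic f + Rintegral leb `[m, b]%classic f.
  move=> fi.
  have := @Rintegral_itvB R f (BLeft a) (BRight b) m fi.
  rewrite !bnd_simp => /(_ am mb) /eqP; rewrite subr_eq => /eqP ->.
  rewrite addrC; congr (_ + _); apply: Rintegral_itv_obnd_cbnd.
  apply: integrableS fi; [exact: measurable_itv|exact: measurable_itv|].
  by apply: subset_itvr; rewrite bnd_simp.
by apply: complex_ext; rewrite ?RecD ?ImcD /= main.
Qed.

Lemma fine_lebesgue_itvcc (a b : R) : a <= b ->
  fine (leb `[a, b]%classic) = b - a.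
Proof.
move=> ab; rewrite lebesgue_measure_itv /= lte_fin.
case: ltP => // ba; have -> : a = b by apply/le_anti; rewrite ab.
by rewrite subrr.
Qed.

Lemma cintI_le (a b M : R) (F : R -> C) : a <= b ->
  cintegrable leb `[a, b]%classic F ->
  (forall x, a <= x <= b -> normc (F x) <= M) ->
  normc (cintI a b F) <= 2 * (M * (b - a)).
Proof.
move=> ab iF FM.
have mI : measurable (`[a, b]%classic : set (measurableTypeR R)).
  exact: measurable_itv.
rewrite -(fine_lebesgue_itvcc ab) -(Rintegral_cst leb mI M).
apply: normc_cint_le => //.
  apply/integrableP; split; first exact: measurable_cst.
  rewrite integral_cst//= lebesgue_measure_itv /=.
  by case: ifP => _; rewrite ?mule0 ?ltry// -EFinB -EFinM ltry.
Qed.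

Lemma cintI_cst (a b : R) (z : C) : a <= b ->
  cintI a b (fun=> z) = z * (b - a)%:C.
Proof.
move=> ab; rewrite /cintI cint_cst; last exact: measurable_itv.
by rewrite fine_lebesgue_itvcc.
Qed.

End interval_integral.

Section goursat.
Variable R : realType.
Local Notation C := R[i].
Local Notation leb := (@lebesgue_measure R).
Variable F : R -> R -> C.

(** Complex differentiability in s + i t: that a single complex [A] multiplies the increment encodes
    the Cauchy-Riemann equations. The curried form makes rows and columns functions of one real
    variable. *)
Definition cdiff2 (s t : R) := exists A : C, forall e : R, 0 < e ->
  exists2 d : R, 0 < d & forall s' t', `|s' - s| < d -> `|t' - t| < d ->
    normc (F s' t' - F s t - A * ((s' - s) +i* (t' - t)))
      <= e * (`|s' - s| + `|t' - t|).

(** The contour integral of F dz counterclockwise around the rectangle: dz is i dt on the vertical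
    sides and ds on the horizontal ones. *)
Definition boundary_int (a b c d : R) : C :=
  'i * (cintI c d (F b) - cintI c d (F a)) -
  (cintI a b (F ^~ d) - cintI a b (F ^~ c)).

Lemma cdiff2_cont s t : cdiff2 s t -> forall e : R, 0 < e ->
  exists2 d : R, 0 < d & forall s' t', `|s' - s| < d -> `|t' - t| < d ->
    normc (F s' t' - F s t) < e.
Proof.
move=> [A hA] e e0; have [d d0 hd] := hA 1 ltr01.
have c0 : 0 < 2 * (2 + normc A) by rewrite mulr_gt0// ltr_wpDr// normc_ge0.
exists (Num.min d (e / (2 * (2 + normc A)))); first by rewrite lt_min d0 divr_gt0.
move=> s' t'; rewrite !lt_min => /andP[sd se] /andP[td te].
have := hd _ _ sd td; rewrite mul1r; set v := (s' - s) +i* (t' - t) => hv.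
have -> : F s' t' - F s t = (F s' t' - F s t - A * v) + A * v by ring.
apply: le_lt_trans (ler_normcD _ _) _; rewrite normcM.
have nv : normc v <= `|s' - s| + `|t' - t| := ler_normc_ReIm v.
clearbody v.
move: se te; rewrite !ltr_pdivlMr// => se te.
have := normc_ge0 A; have := normc_ge0 v.
have := normr_ge0 (s' - s); have := normr_ge0 (t' - t).
move: (normc v) (normc A) `|s' - s| `|t' - t| (normc _) hv nv se te.
move=> x y p q z hz xp h1 h2 q0 p0 x0 y0.
have : y * x <= y * (p + q) by rewrite ler_wpM2l.
nra.
Qed.

Definition hol_on (a b c d : R) :=
  forall s t, a <= s <= b -> c <= t <= d -> cdiff2 s t.

Lemma hol_row a b c d s t : hol_on a b c d -> a <= s <= b -> c <= t <= d ->
  ccont_at (F s) t.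
Proof.
move=> h sab tcd e e0; have [r r0 hr] := cdiff2_cont (h s t sab tcd) e0.
by exists r => // y yt; apply: hr => //; rewrite subrr normr0.
Qed.

Lemma hol_col a b c d s t : hol_on a b c d -> a <= s <= b -> c <= t <= d ->
  ccont_at (F ^~ t) s.
Proof.
move=> h sab tcd e e0; have [r r0 hr] := cdiff2_cont (h s t sab tcd) e0.
by exists r => // y yt; apply: hr => //; rewrite subrr normr0.
Qed.

Lemma hol_sub a b c d a' b' c' d' : a <= a' -> b' <= b -> c <= c' -> d' <= d ->
  hol_on a b c d -> hol_on a' b' c' d'.
Proof.
move=> aa bb cc dd h s t /andP[s1 s2] /andP[t1 t2]; apply: h; apply/andP; split; lra.
Qed.

Lemma boundary_split_s a m b c d : a <= m -> m <= b -> c <= d -> hol_on a b c d ->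
  boundary_int a b c d = boundary_int a m c d + boundary_int m b c d.
Proof.
move=> am mb cd h; rewrite /boundary_int.
rewrite (ccont_split am mb); last first.
  by move=> x xab; apply: hol_col h _ _; rewrite ?cd ?lexx.
rewrite (@ccont_split _ a m b (F ^~ c)) //; last first.
  by move=> x xab; apply: hol_col h _ _; rewrite ?cd ?lexx.
ring.
Qed.

Lemma boundary_split_t a b c m d : a <= b -> c <= m -> m <= d -> hol_on a b c d ->
  boundary_int a b c d = boundary_int a b c m + boundary_int a b m d.
Proof.
move=> ab cm md h; rewrite /boundary_int.
rewrite (ccont_split cm md); last first.
  by move=> x xab; apply: hol_row h _ _; rewrite ?ab ?lexx.
rewrite (@ccont_split _ c m d (F a)) //; last first.
  by move=> x xab; apply: hol_row h _ _; rewrite ?ab ?lexx.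
ring.
Qed.

Lemma cintegrable_row a b c d s : hol_on a b c d -> a <= s <= b ->
  cintegrable leb `[c, d]%classic (F s).
Proof. by move=> h sab; apply: ccont_integrable => t; exact: hol_row h sab. Qed.

Lemma cintegrable_col a b c d t : hol_on a b c d -> c <= t <= d ->
  cintegrable leb `[a, b]%classic (F ^~ t).
Proof.
by move=> h tcd; apply: ccont_integrable => s sab; exact: hol_col h sab tcd.
Qed.

(** The affine part of [F] integrates to 0: its increments [u] and [v] across the rectangle satisfy
    i u (d - c) = v (b - a). Only the error is left; one factor 2 comes from subtracting opposite
    sides, the other from [cintI_le]. *)
Lemma boundary_small a b c d (A z0 : C) (s0 t0 e : R) : a <= b -> c <= d ->
  hol_on a b c d ->
  (forall s t, a <= s <= b -> c <= t <= d ->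
    normc (F s t - z0 - A * ((s - s0) +i* (t - t0))) <= e) ->
  normc (boundary_int a b c d) <= 4 * e * ((b - a) + (d - c)).
Proof.
move=> ab cd h hA.
have mI x y : measurable (`[x, y]%classic : set (measurableTypeR R)).
  exact: measurable_itv.
have ia : a <= a <= b by rewrite lexx.
have ib : a <= b <= b by rewrite lexx andbT.
have ic : c <= c <= d by rewrite lexx.
have id' : c <= d <= d by rewrite lexx andbT.
pose E s t := F s t - z0 - A * ((s - s0) +i* (t - t0)).
have hE s t : a <= s <= b -> c <= t <= d -> normc (E s t) <= e.
  by move=> *; exact: hA.
pose u := A * (b - a)%:C; pose v := A * 'i * (d - c)%:C.
have E1 t : F b t - F a t = u + (E b t - E a t).
  have -> : u = A * ((b - s0) +i* (t - t0) - (a - s0) +i* (t - t0)).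
    by congr (_ * _); apply: complex_ext => /=; ring.
  by rewrite /E; ring.
have E2 s : F s d - F s c = v + (E s d - E s c).
  have -> : v = A * ((s - s0) +i* (d - t0) - (s - s0) +i* (c - t0)).
    by rewrite /v -mulrA; congr (_ * _); apply: complex_ext => /=; ring.
  by rewrite /E; ring.
have i1 := cintegrable_row h ib; have i2 := cintegrable_row h ia.
have i3 := cintegrable_col h id'; have i4 := cintegrable_col h ic.
rewrite /boundary_int /cintI -!cintB//.
have cst_int x y (z : C) : cintegrable leb `[x, y]%classic (fun=> z).
  by apply: ccont_integrable => w _ r r0; exists 1 => // *;
    rewrite subrr ComplexField.Normc.normc0.
have subint x y (G : R -> C) (z : C) : cintegrable leb `[x, y]%classic G ->
    cintegrable leb `[x, y]%classic (fun t => - z + G t).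
  by move=> iG; apply: cintegrableD.
have minusint x y (G H : R -> C) : cintegrable leb `[x, y]%classic G ->
    cintegrable leb `[x, y]%classic H ->
    cintegrable leb `[x, y]%classic (fun t => G t - H t).
  by move=> iG iH; apply: cintegrableD => //; exact: cintegrableN.
have j1 := subint _ _ _ u (minusint _ _ _ _ i1 i2).
have j2 := subint _ _ _ v (minusint _ _ _ _ i3 i4).
have -> : cint leb `[c, d]%classic (fun t => F b t - F a t) =
    u * (d - c)%:C + cintI c d (fun t => - u + (F b t - F a t)).
  rewrite -(cintI_cst u cd) -cintD//; apply: eq_cint => t _; ring.
have -> : cint leb `[a, b]%classic (fun s => F s d - F s c) =
    v * (b - a)%:C + cintI a b (fun s => - v + (F s d - F s c)).
  rewrite -(cintI_cst v ab) -cintD//; apply: eq_cint => t _; ring.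
have -> (x y : C) : 'i * (u * (d - c)%:C + x) - (v * (b - a)%:C + y) = 'i * x - y.
  by rewrite /u /v; ring.
have n1 : normc ('i * cintI c d (fun t => - u + (F b t - F a t))) <=
    2 * ((2 * e) * (d - c)).
  rewrite normcM; have -> : normc ('i : C) = 1.
    by rewrite /= expr0n expr1n add0r sqrtr1.
  rewrite mul1r; apply: cintI_le => // t tcd; rewrite E1.
  have -> : - u + (u + (E b t - E a t)) = E b t - E a t by ring.
  apply: le_trans (ler_normcD _ _) _; rewrite normc_opp.
  by have := hE _ _ ib tcd; have := hE _ _ ia tcd; lra.
have n2 : normc (cintI a b (fun s => - v + (F s d - F s c))) <=
    2 * ((2 * e) * (b - a)).
  apply: cintI_le => // s sab; rewrite E2.
  have -> : - v + (v + (E s d - E s c)) = E s d - E s c by ring.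
  apply: le_trans (ler_normcD _ _) _; rewrite normc_opp.
  by have := hE _ _ sab id'; have := hE _ _ sab ic; lra.
apply: le_trans (ler_normcD _ _) _; rewrite normc_opp.
lra.
Qed.

Let rect := ((R * R) * (R * R))%type.
Let bint (Q : rect) := boundary_int Q.1.1 Q.1.2 Q.2.1 Q.2.2.
Let good (Q : rect) := [/\ Q.1.1 <= Q.1.2, Q.2.1 <= Q.2.2 &
  hol_on Q.1.1 Q.1.2 Q.2.1 Q.2.2].
Let step (Q Q' : rect) :=
  [/\ [/\ Q.1.1 <= Q'.1.1, Q'.1.2 <= Q.1.2, Q.2.1 <= Q'.2.1 & Q'.2.2 <= Q.2.2],
      Q'.1.2 - Q'.1.1 = (Q.1.2 - Q.1.1) / 2,
      Q'.2.2 - Q'.2.1 = (Q.2.2 - Q.2.1) / 2 &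
      normc (bint Q) <= 4 * normc (bint Q')].

Lemma goursat_quarter Q : good Q -> exists Q', step Q Q'.
Proof.
case: Q => -[a b] [c d] [/= ab cd h].
pose m := (a + b) / 2; pose n := (c + d) / 2.
have am : a <= m by rewrite /m; lra.
have mb : m <= b by rewrite /m; lra.
have cn : c <= n by rewrite /n; lra.
have nd : n <= d by rewrite /n; lra.
have e1 : m - a = (b - a) / 2 by rewrite /m; lra.
have e2 : b - m = (b - a) / 2 by rewrite /m; lra.
have e3 : n - c = (d - c) / 2 by rewrite /n; lra.
have e4 : d - n = (d - c) / 2 by rewrite /n; lra.
have h1 : hol_on a m c d by apply: hol_sub h.
have h2 : hol_on m b c d by apply: hol_sub h.
have E : bint ((a, b), (c, d)) =
    bint ((a, m), (c, n)) + bint ((a, m), (n, d)) +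
    (bint ((m, b), (c, n)) + bint ((m, b), (n, d))).
  by rewrite /bint /= (boundary_split_s am mb cd h)
    (boundary_split_t am cn nd h1) (boundary_split_t mb cn nd h2).
have T : normc (bint ((a, b), (c, d))) <=
    normc (bint ((a, m), (c, n))) + normc (bint ((a, m), (n, d))) +
    (normc (bint ((m, b), (c, n))) + normc (bint ((m, b), (n, d)))).
  rewrite E; apply: le_trans (ler_normcD _ _) _.
  by apply: lerD; exact: ler_normcD.
have [c1|c1] := lerP (normc (bint ((a, b), (c, d)))) (4 * normc (bint ((a, m), (c, n)))).
  exists ((a, m), (c, n)); split; [by split; rewrite /=|exact: e1|exact: e3|exact: c1].
have [c2|c2] := lerP (normc (bint ((a, b), (c, d)))) (4 * normc (bint ((a, m), (n, d)))).
  exists ((a, m), (n, d)); split; [by split; rewrite /=|exact: e1|exact: e4|exact: c2].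
have [c3|c3] := lerP (normc (bint ((a, b), (c, d)))) (4 * normc (bint ((m, b), (c, n)))).
  exists ((m, b), (c, n)); split; [by split; rewrite /=|exact: e2|exact: e3|exact: c3].
have c4 : normc (bint ((a, b), (c, d))) <= 4 * normc (bint ((m, b), (n, d))).
  move: c1 c2 c3 T; clear.
  move: (normc _) (normc _) (normc _) (normc _) (normc _) => x1 x2 x3 x4 x5.
  lra.
by exists ((m, b), (n, d)); split; [split; rewrite /=|exact: e2|exact: e4|exact: c4].
Qed.

Theorem goursat a b c d : a <= b -> c <= d -> hol_on a b c d ->
  boundary_int a b c d = 0.
Proof.
move=> ab cd h; pose Q0 : rect := ((a, b), (c, d)).
(* [next] is total; on rectangles that are not good its value is arbitrary. *)
have /choice[next nextP] : forall Q, exists Q', good Q -> step Q Q'.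
  move=> Q; have [/goursat_quarter[Q' ?]|nQ] := pselect (good Q); first by exists Q'.
  by exists Q.
pose Q n := iter n next Q0.
have step_good K K' : good K -> step K K' -> good K'.
  move=> [g1 g2 g3] [[s1 s2 s3 s4] s5 s6 _]; split; [lra|lra|].
  exact: hol_sub g3.
have Qgood n : good (Q n).
  elim: n => [|n IH]; first by split.
  exact: step_good IH (nextP _ IH).
have Qstep n : step (Q n) (Q n.+1) by exact: nextP.
have mono n k : [/\ (Q n).1.1 <= (Q (n + k)%N).1.1,
    (Q (n + k)%N).1.2 <= (Q n).1.2, (Q n).2.1 <= (Q (n + k)%N).2.1 &
    (Q (n + k)%N).2.2 <= (Q n).2.2].
  elim: k => [|k [i1 i2 i3 i4]]; first by rewrite addn0.
  rewrite addnS; have [[s1 s2 s3 s4] _ _ _] := Qstep (n + k)%N.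
  by split; [exact: le_trans s1|exact: le_trans i2|exact: le_trans s3|exact: le_trans i4].
have width n : ((Q n).1.2 - (Q n).1.1) + ((Q n).2.2 - (Q n).2.1) =
    ((b - a) + (d - c)) / 2 ^+ n.
  elim: n => [|n IH]; first by rewrite expr0 divr1.
  have [_ s5 s6 _] := Qstep n.
  by rewrite s5 s6 -mulrDl IH exprSr invfM mulrA.
have size n : normc (bint Q0) <= 4 ^+ n * normc (bint (Q n)).
  elim: n => [|n IH]; first by rewrite expr0 mul1r.
  have [_ _ _ s7] := Qstep n; apply: le_trans IH _.
  by rewrite exprSr -mulrA ler_wpM2l// exprn_ge0.
pose p := sup (range (fun n => (Q n).1.1)); pose q := sup (range (fun n => (Q n).2.1)).
have cross1 n k : (Q n).1.1 <= (Q k).1.2.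
  have [/le_trans + _ _ _] := mono n k; apply.
  have [g1 _ _] := Qgood (n + k)%N; apply: le_trans g1 _.
  by rewrite addnC; have [] := mono k n.
have cross2 n k : (Q n).2.1 <= (Q k).2.2.
  have [_ _ /le_trans + _] := mono n k; apply.
  have [_ g2 _] := Qgood (n + k)%N; apply: le_trans g2 _.
  by rewrite addnC; have [] := mono k n.
have pQ n : (Q n).1.1 <= p <= (Q n).1.2.
  apply/andP; split.
    apply: ub_le_sup; last by exists n.
    by exists b => _ [k _ <-]; exact: (cross1 k 0%N).
  by apply: ge_sup; [exists (Q 0%N).1.1; exists 0%N|move=> _ [k _ <-]].
have qQ n : (Q n).2.1 <= q <= (Q n).2.2.
  apply/andP; split.
    apply: ub_le_sup; last by exists n.
    by exists d => _ [k _ <-]; exact: (cross2 k 0%N).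
  by apply: ge_sup; [exists (Q 0%N).2.1; exists 0%N|move=> _ [k _ <-]].
pose w := (b - a) + (d - c).
have w0 : 0 <= w by rewrite /w; lra.
(* The factor 4 ^ n of [size] is cancelled by the two factors w / 2 ^ n of [boundary_small], one
   from the approximation error and one from the half-perimeter. *)
have small e : 0 < e -> normc (bint Q0) <= 4 * e * w ^+ 2.
  move=> e0; have [A hA] := h p q (pQ 0%N) (qQ 0%N).
  have [r r0 hr] := hA e e0.
  pose n := Num.bound (w / r).
  have wn : w / 2 ^+ n < r.
    rewrite ltr_pdivrMr ?exprn_gt0//.
    have h1 : w / r < n%:R by apply: archi_boundP; rewrite divr_ge0// ltW.
    have h2 : (n%:R : R) < 2 ^+ n by rewrite -natrX ltr_nat ltn_expl.
    by rewrite mulrC -ltr_pdivrMr//; exact: lt_trans h2.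
  have [g1 g2 g3] := Qgood n.
  have hs s t : (Q n).1.1 <= s <= (Q n).1.2 -> (Q n).2.1 <= t <= (Q n).2.2 ->
      normc (F s t - F p q - A * ((s - p) +i* (t - q))) <= e * (w / 2 ^+ n).
    move=> /andP[s1 s2] /andP[t1 t2].
    have /andP[p1 p2] := pQ n; have /andP[q1 q2] := qQ n.
    have W := width n; rewrite -/w in W.
    have sp : `|s - p| <= (Q n).1.2 - (Q n).1.1 by rewrite ler_norml; apply/andP; split; lra.
    have tq : `|t - q| <= (Q n).2.2 - (Q n).2.1 by rewrite ler_norml; apply/andP; split; lra.
    apply: le_trans (hr s t _ _) _; [lra|lra|].
    by rewrite ler_pM2l//; lra.
  have := boundary_small g1 g2 g3 hs; rewrite width -/w => B.
  apply: le_trans (size n) _.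
  apply: le_trans (ler_wpM2l _ B) _; first by rewrite exprn_ge0.
  have -> : (4 : R) ^+ n = 2 ^+ n * 2 ^+ n by rewrite -exprMn; congr (_ ^+ n); ring.
  have p0 : (2 : R) ^+ n != 0 by rewrite expf_neq0.
  by rewrite le_eqVlt; apply/orP; left; apply/eqP; field.
apply/eqP; rewrite -normc_eq0 eq_le normc_ge0 andbT.
rewrite leNgt; apply/negP => pos.
have c0 : 0 < 8 * (w ^+ 2 + 1) by rewrite mulr_gt0// ltr_wpDl// sqr_ge0.
have := small (normc (boundary_int a b c d) / (8 * (w ^+ 2 + 1))) (divr_gt0 pos c0).
rewrite /bint /= -/(boundary_int a b c d); set x := normc _ in pos *.
have -> : 4 * (x / (8 * (w ^+ 2 + 1))) * w ^+ 2 = x * (w ^+ 2 / (2 * (w ^+ 2 + 1))).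
  by field; rewrite gt_eqF// ltr_wpDl// sqr_ge0.
have : w ^+ 2 / (2 * (w ^+ 2 + 1)) < 1.
  rewrite ltr_pdivrMr; last by rewrite mulr_gt0// ltr_wpDl// sqr_ge0.
  by have := sqr_ge0 w; lra.
by move=> lt1; rewrite leNgt gtr_pMr// lt1.
Qed.

End goursat.

(** * The complex exponential in real coordinates and the chain rule *)

Section complex_exponential.
Variable R : realType.
Local Notation C := R[i].

Lemma is_derive_eps (f : R -> R) (x df : R) : is_derive x 1 f df ->
  forall e, 0 < e -> exists2 d : R, 0 < d & forall h, `|h| < d ->
    `|f (x + h) - f x - df * h| <= e * `|h|.
Proof.
move=> fd e e0.
have /cvgrPdist_le/(_ e e0) : (fun h => h^-1 *: ((f \o shift x) (h *: 1) - f x))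
    @ 0^' --> df.
  by have [/derivableP dd <-] := fd; case: dd => /[swap] _; apply.
move=> /nbhs_ballP[d /= d0 hd]; exists d => // h hd'.
have [->|h0] := eqVneq h 0.
  by rewrite addr0 subrr mulr0 subrr normr0 mulr0.
have := hd h; rewrite /ball /= sub0r normrN => /(_ hd' h0).
rewrite /GRing.scale /= mulr1 (addrC h).
have -> : f (x + h) - f x - df * h = - ((df - h^-1 * (f (x + h) - f x)) * h).
  by field.
by move=> k; rewrite normrN normrM ler_wpM2r.
Qed.

Definition cexp2 (s t : R) : C := (expR s * cos t) +i* (expR s * sin t).

Lemma cexp2D s t s' t' : cexp2 (s + s') (t + t') = cexp2 s t * cexp2 s' t'.
Proof.
by rewrite /cexp2 expRD cosD sinD; apply: complex_ext => /=; ring.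
Qed.

Lemma normc_cexp2 s t : normc (cexp2 s t) = expR s.
Proof.
apply/eqP; rewrite -(@eqrXn2 _ 2)// ?normc_ge0 ?expR_ge0// normc_sqr /=; apply/eqP.
by rewrite !exprMn -mulrDr cos2Dsin2 mulr1.
Qed.

Lemma cexp2_small e : 0 < e -> exists2 d : R, 0 < d & forall a b,
  `|a| < d -> `|b| < d ->
  normc (cexp2 a b - 1 - (a +i* b)) <= e * (`|a| + `|b|).
Proof.
(* The errors of cos and sin contribute 2 r |b| each, as exp a <= 2, and the term (exp a - 1) b
   contributes r |b|: five in all. *)
move=> e0; pose r := Num.min 1 (e / 5).
have r0 : 0 < r by rewrite lt_min ltr01 divr_gt0.
have re : r <= e / 5 by rewrite ge_min lexx orbT.
have r1 : r <= 1 by rewrite ge_min lexx.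
have [d1 d10 h1] := is_derive_eps (is_derive_expR 0) r0.
have [d2 d20 h2] := is_derive_eps (is_derive_cos 0) r0.
have [d3 d30 h3] := is_derive_eps (is_derive_sin 0) r0.
exists (Num.min (Num.min d1 d2) (Num.min d3 (r / 2))).
  by rewrite !lt_min d10 d20 d30 divr_gt0.
move=> a b; rewrite !lt_min => /andP[/andP[a1 a2] /andP[a3 a4]].
move=> /andP[/andP[b1 b2] /andP[b3 b4]].
have := h1 a a1; rewrite add0r expR0 mul1r => E1.
have := h2 b b2; rewrite add0r cos0 sin0 oppr0 mul0r subr0 => E2.
have := h3 b b3; rewrite add0r cos0 sin0 mul1r subr0 => E3.
apply: le_trans (ler_normc_ReIm _) _; rewrite /=.
have -> : expR a * cos b - 1 - a = expR a * (cos b - 1) + (expR a - 1 - a) by ring.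
have -> : expR a * sin b - 0 - b = expR a * (sin b - b) + (expR a - 1) * b by ring.
have ea : expR a <= 2.
  have := ler_norm (expR a - 1 - a); have := ler_norm a.
  have := normr_ge0 a; nra.
have ea1 : `|expR a - 1| <= r.
  have -> : expR a - 1 = (expR a - 1 - a) + a by ring.
  by apply: le_trans (ler_normD _ _) _; have := normr_ge0 a; nra.
apply: le_trans (lerD (ler_normD _ _) (ler_normD _ _)) _.
rewrite !normrM (ger0_norm (expR_ge0 a)).
have h4 : expR a * `|cos b - 1| <= 2 * (r * `|b|).
  by apply: ler_pM => //; exact: expR_ge0.
have h5 : expR a * `|sin b - b| <= 2 * (r * `|b|).
  by apply: ler_pM => //; exact: expR_ge0.
have h6 : `|expR a - 1| * `|b| <= r * `|b| by rewrite ler_wpM2r.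
have h7 : 5 * r * `|b| <= e * `|b| by rewrite ler_wpM2r//; lra.
have h8 : r * `|a| <= e * `|a| by rewrite ler_wpM2r//; lra.
move: h4 h5 h6 h7 h8 E1; rewrite mulrDr -!mulrA.
move: (expR a * _) (expR a * _) (_ * `|b|) (e * _) (e * _) => *; lra.
Qed.

Lemma cdiff2_cexp2 s t : cdiff2 (fun s t => cexp2 (2 * s) (2 * t)) s t.
Proof.
exists (2%:C * cexp2 (2 * s) (2 * t)) => e e0.
set E0 := cexp2 _ _.
have n0 : 0 < normc E0 by rewrite normc_cexp2 expR_gt0.
have [d d0 hd] := @cexp2_small (e / (2 * normc E0)) (divr_gt0 e0 (mulr_gt0 (ltr0Sn _ 1) n0)).
exists (d / 2); first by rewrite divr_gt0.
move=> s' t' sd td.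
have -> : cexp2 (2 * s') (2 * t') = E0 * cexp2 (2 * (s' - s)) (2 * (t' - t)).
  by rewrite -cexp2D; congr cexp2; ring.
have -> : E0 * cexp2 (2 * (s' - s)) (2 * (t' - t)) - E0 -
    2%:C * E0 * ((s' - s) +i* (t' - t)) =
    E0 * (cexp2 (2 * (s' - s)) (2 * (t' - t)) - 1 -
      ((2 * (s' - s)) +i* (2 * (t' - t)))).
  have -> : (2 * (s' - s)) +i* (2 * (t' - t)) = 2%:C * ((s' - s) +i* (t' - t)) :> C.
    by apply: complex_ext => /=; ring.
  ring.
rewrite normcM.
have n2 x : `|2 * x| = 2 * `|x| :> R by rewrite normrM ger0_norm.
have a1 : `|2 * (s' - s)| < d by rewrite n2; lra.
have a2 : `|2 * (t' - t)| < d by rewrite n2; lra.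
have := hd _ _ a1 a2; rewrite !n2.
move=> /(ler_wpM2l (ltW n0)) /le_trans; apply.
rewrite le_eqVlt; apply/orP; left; apply/eqP.
by field; rewrite gt_eqF.
Qed.

Lemma cdiff2_comp (H : C -> C) (G : R -> R -> C) s t a :
  cderiv H (G s t) a -> cdiff2 G s t -> cdiff2 (fun s t => H (G s t)) s t.
Proof.
move=> hH hG; have hGc := cdiff2_cont hG; move: hG => [B hG].
exists (a * B) => e e0.
(* Half of [e] goes to the error of [H] and half to that of [G]; [m] is a Lipschitz bound for [G] at
   the point, and [k] a positive bound for [normc a]. *)
pose k := 1 + normc a; have k0 : 0 < k by rewrite ltr_pwDl ?normc_ge0.
pose m := 2 + normc B; have m0 : 0 < m by rewrite ltr_pwDl ?normc_ge0.
have [d1 d10 h1] := hH (e / (2 * m)) (divr_gt0 e0 (mulr_gt0 (ltr0Sn _ 1) m0)).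
pose r := Num.min 1 (e / (2 * k)).
have r0 : 0 < r by rewrite lt_min ltr01 divr_gt0// mulr_gt0.
have [d2 d20 h2] := hG r r0.
have [d3 d30 h3] := hGc d1 d10.
exists (Num.min d2 d3); first by rewrite lt_min d20.
move=> s' t'; rewrite !lt_min => /andP[s2 s3] /andP[t2 t3].
have := h2 _ _ s2 t2; have := h3 _ _ s3 t3.
set v := G s' t' - G s t; set D := (s' - s) +i* (t' - t) => vd vB.
have := h1 v vd; rewrite /v subrKC -/v => hv.
set x := `|s' - s| + `|t' - t| in vB *.
have nD : normc D <= x by exact: ler_normc_ReIm.
have x0 : 0 <= x by rewrite addr_ge0.
have rv : r <= 1 by rewrite ge_min lexx.
have rk : r <= e / (2 * k) by rewrite ge_min lexx orbT.
have nv : normc v <= m * x.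
  have -> : v = (v - B * D) + B * D by ring.
  apply: le_trans (ler_normcD _ _) _; rewrite normcM /m.
  have := ler_wpM2l (normc_ge0 B) nD; have := ler_wpM2r x0 rv; nra.
have -> : H (G s' t') - H (G s t) - a * B * D =
    (H (G s' t') - H (G s t) - a * v) + a * (v - B * D) by ring.
apply: le_trans (ler_normcD _ _) _; rewrite normcM.
have b1 : e / (2 * m) * normc v <= e / 2 * x.
  have -> : e / 2 * x = e / (2 * m) * (m * x) by field; rewrite gt_eqF.
  by rewrite ler_wpM2l// divr_ge0 ?ltW// mulr_gt0.
have b2 : normc a * normc (v - B * D) <= e / 2 * x.
  apply: (@le_trans _ _ (k * (e / (2 * k) * x))).
    apply: ler_pM; rewrite ?normc_ge0//; first by rewrite /k lerDr.
    by apply: le_trans vB _; rewrite ler_wpM2r.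
  by rewrite le_eqVlt; apply/orP; left; apply/eqP; field; rewrite gt_eqF.
lra.
Qed.

End complex_exponential.

(** * Hyperbolic rotations and the mean value property *)

Section rotation.
Variable R : realType.
Local Notation C := R[i].
Implicit Types (v z : C) (t : R).

Lemma complexi_neq0 : ('i : C) != 0.
Proof.
by apply/eqP => /(congr1 (@complex.Im _)) /= /eqP; rewrite oner_eq0.
Qed.

Definition cayley v : C := (1 + v) / (1 - v).
Definition cayley_inv z : C := (z - 1) / (z + 1).
(** The hyperbolic rotation about 1, which is a rotation of the disc in the Cayley coordinate. The
    doubled angle gives it a Moebius matrix with entries cos t and - i sin t, and makes [0, pi] one
    full turn. *)
Definition rot t z : C := cayley (cayley_inv z * cexp2 0 (2 * t)).

Lemma disc_neq1 v : normc v < 1 -> 1 - v != 0.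
Proof.
move=> v1; rewrite subr_eq0; apply: contraTneq v1 => <-.
by rewrite ComplexField.Normc.normc1 ltxx.
Qed.

Lemma RecDiv v z : Re (v / z) = Re (v * z^*) / normc z ^+ 2.
Proof. by rewrite !RecM RecV ImcV RecJ ImcJ; lra. Qed.

Lemma Re_cayley v : Re (cayley v) = (1 - normc v ^+ 2) / normc (1 - v) ^+ 2.
Proof.
by rewrite /cayley RecDiv !normc_sqr; case: v => a b /=; congr (_ / _); ring.
Qed.

Lemma cayley_gt0 v : normc v < 1 -> 0 < Re (cayley v).
Proof.
move=> v1; rewrite Re_cayley divr_gt0//.
  by rewrite subr_gt0 expr_lt1// normc_ge0.
by rewrite exprn_gt0// normc_gt0 disc_neq1.
Qed.

Lemma Cplus_add1_neq0 z : 0 < Re z -> z + 1 != 0.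
Proof. by move=> z0; apply: Re_neq0; rewrite RecD /=; lra. Qed.

Lemma normc_cayley_inv z : 0 < Re z -> normc (cayley_inv z) < 1.
Proof.
move=> z0; rewrite /cayley_inv normcM normcV ltr_pdivrMr; last first.
  by rewrite normc_gt0 Cplus_add1_neq0.
rewrite mul1r -(ltr_pXn2r (ltn0Sn 1)) ?nnegrE ?normc_ge0// !normc_sqr.
by case: z z0 => a b /= a0; nra.
Qed.

Lemma rot_gt0 t z : 0 < Re z -> 0 < Re (rot t z).
Proof.
move=> z0; apply: cayley_gt0.
by rewrite normcM normc_cexp2 expR0 mulr1 normc_cayley_inv.
Qed.

(** Once [z + 1] is cleared, numerator and denominator share the factor [cexp2 0 t]; cancelling it
    halves the angle. *)
Lemma rotE t z : 0 < Re z ->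
  rot t z = (z * (cos t)%:C - (sin t) *i) / ((cos t)%:C - z * (sin t) *i).
Proof.
move=> z0; rewrite /rot /cayley /cayley_inv.
have e1 : cexp2 0 (2 * t) = cexp2 0 t * cexp2 0 t.
  by rewrite -cexp2D addr0; congr cexp2; ring.
have e0 : cexp2 0 t != 0 by rewrite -normc_gt0 normc_cexp2 expR_gt0.
have ce : cexp2 0 t = (cos t)%:C + (sin t) *i.
  by apply: complex_ext; rewrite /cexp2 expR0 !mul1r /= ?addr0 ?add0r.
have ci : ((cos t)%:C + (sin t) *i) * ((cos t)%:C - (sin t) *i) = 1.
  apply: complex_ext => /=; last by ring.
  by rewrite -(cos2Dsin2 t); ring.
have z1 := Cplus_add1_neq0 z0.
have d1 : 1 - (z - 1) / (z + 1) * cexp2 0 (2 * t) != 0.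
  by apply: disc_neq1; rewrite normcM normc_cexp2 expR0 mulr1 normc_cayley_inv.
have E : (z + 1) * (1 - (z - 1) / (z + 1) * cexp2 0 (2 * t)) =
    cexp2 0 t * (2%:R * ((cos t)%:C - z * (sin t) *i)).
  have -> : (z + 1) * (1 - (z - 1) / (z + 1) * cexp2 0 (2 * t)) =
    (z + 1) * 1 - (z - 1) * cexp2 0 (2 * t) by field.
  by rewrite -[X in _ * X - _]ci e1 ce; ring.
have N : (z + 1) * (1 + (z - 1) / (z + 1) * cexp2 0 (2 * t)) =
    cexp2 0 t * (2%:R * (z * (cos t)%:C - (sin t) *i)).
  have -> : (z + 1) * (1 + (z - 1) / (z + 1) * cexp2 0 (2 * t)) =
    (z + 1) * 1 + (z - 1) * cexp2 0 (2 * t) by field.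
  by rewrite -[X in _ * X + _]ci e1 ce; ring.
have d2 : (cos t)%:C - z * (sin t) *i != 0.
  apply/eqP => d20; have /eqP := E; rewrite d20 !mulr0 mulf_eq0 (negbTE z1).
  by rewrite (negbTE d1).
have two0 : (2%:R : C) != 0 by rewrite pnatr_eq0.
apply: (mulfI (mulf_neq0 z1 d1)).
transitivity ((z + 1) * (1 + (z - 1) / (z + 1) * cexp2 0 (2 * t))).
  by rewrite -mulrA; congr (_ * _); rewrite mulrC divfK.
by rewrite N E; field.
Qed.

(** Exhibits the rotation as composed of maps whose change of variables is known: imaginary
    translations, an inversion and a dilation. *)
Lemma rot_moebius t z : 0 < Re z -> sin t != 0 ->
  rot t z = 0 +i* (cos t / sin t) +
    ((sin t ^+ 2)^-1)%:C / (z + 0 +i* (cos t / sin t)).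
Proof.
move=> z0 s0; rewrite rotE//.
have iE (x : R) : 0 +i* x = 'i * x%:C by apply: complex_ext => /=; ring.
have i2 : 'i * 'i = -1 :> C by apply: complex_ext => /=; ring.
have i0 := complexi_neq0.
set s := sin t in s0 *; set c := cos t.
have sc0 : (s%:C : C) != 0 by rewrite -normc_gt0 normc_real normr_gt0.
rewrite !iE; set T := 'i * (c / s)%:C.
have cE : c%:C = - ('i * s%:C) * T.
  rewrite /T (_ : - _ * _ = - ('i * 'i) * (s%:C * (c / s)%:C)); last by ring.
  by rewrite i2 opprK mul1r -rmorphM /= mulrC divfK.
have sE : ((s ^+ 2)^-1)%:C = 1 - T * T.
  rewrite /T (_ : 1 - _ = 1 - ('i * 'i) * ((c / s)%:C * (c / s)%:C)); last by ring.
  rewrite i2 mulN1r opprK -rmorphM -[1]/((1 : R)%:C) -rmorphD; congr (_%:C).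
  have -> : (s ^+ 2)^-1 = (c ^+ 2 + s ^+ 2) / s ^+ 2 by rewrite cos2Dsin2 mul1r.
  by field.
have zT : z + T != 0 by apply: Re_neq0; rewrite RecD RecM /=; lra.
have is0 : 'i * s%:C != 0 by rewrite mulf_neq0.
rewrite sE cE; move: ('i * s%:C) is0 => u u0.
rewrite (_ : - u * T - z * u = - u * (z + T)); last by ring.
by field; rewrite u0 zT.
Qed.

Lemma analytic_cayley : analytic_on [set v | normc v < 1] cayley.
Proof.
apply: (@analyticM _ _ (fun v => 1 + v) (fun v => (1 - v)^-1)).
  by apply: (@analyticD _ _ (fun=> 1) id); [exact: analytic_cst|exact: analytic_id].
apply: (@analyticV _ _ (fun v => 1 - v)); first by move=> v; exact: disc_neq1.
rewrite (_ : (fun z => 1 - z) = (fun z => 1 + (-1) * z)); last first.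
  by apply/funext => z; rewrite mulN1r.
apply: (@analyticD _ _ (fun=> 1) (fun v => (-1) * v)); first exact: analytic_cst.
by apply: (@analyticM _ _ (fun=> -1) id); [exact: analytic_cst|exact: analytic_id].
Qed.

(** In the coordinates [v0 * cexp2 (2 * s) (2 * t)] on the disc the integrand has period pi in [t].
    The horizontal sides therefore cancel in [goursat] on [s0, 0] x [0, pi], and the integral over
    [t] is the same at 0 and at [s0]. As [s0] tends to -oo the circle shrinks to the centre, which
    [cayley] sends to 1. *)
Lemma mean_value (Q : C -> C) z : analytic_on (@Cplus R) Q -> 0 < Re z ->
  cintegrable (@lebesgue_measure R) `[0, pi]%classic (fun t => Q (rot t z)) /\
  cintI 0 pi (fun t => Q (rot t z)) = Q 1 * pi%:C.
Proof.
move=> Qa z0; set v0 := cayley_inv z.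
have v1 : normc v0 < 1 := normc_cayley_inv z0.
pose H v := Q (cayley v).
have Ha : analytic_on [set v | normc v < 1] H.
  by apply: analytic_comp Qa analytic_cayley => v /= vlt; exact: cayley_gt0.
pose G (s t : R) := v0 * cexp2 (2 * s) (2 * t).
have G1 s t : s <= 0 -> normc (G s t) < 1.
  move=> s0; rewrite normcM normc_cexp2; apply: le_lt_trans v1.
  rewrite ler_piMr ?normc_ge0// -[leRHS]expR0 ler_expR; lra.
pose F s t := H (G s t).
have Gd s t : cdiff2 G s t.
  apply: (@cdiff2_comp _ (fun v => v0 * v) (fun s t => cexp2 (2 * s) (2 * t)) s t v0).
    move=> e e0; exists 1 => // v _; rewrite -mulrBr addrAC subrr add0r subrr.
    by rewrite ComplexField.Normc.normc0 mulr_ge0 ?normc_ge0// ltW.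
  exact: cdiff2_cexp2.
have Fd s t : s <= 0 -> cdiff2 F s t.
  move=> s0; have /derivable_cderiv[a ha] := Ha _ (G1 s t s0).
  exact: cdiff2_comp ha (Gd s t).
have hol s0 c d : hol_on F s0 0 c d.
  by move=> s t /andP[_ s1] _; exact: Fd.
have Fpi s : F s pi = F s 0.
  rewrite /F /G; congr (H (_ * _)); rewrite /cexp2 mulr0 cos0 sin0.
  by rewrite (_ : 2 * pi = pi *+ 2) ?cos2pi ?sin2pi// mulr2n; ring.
have pi0 := @pi_ge0 R.
have step s0 : s0 <= 0 -> cintI 0 pi (F 0) = cintI 0 pi (F s0).
  move=> s00; have := goursat s00 pi0 (hol s0 0 pi).
  rewrite /boundary_int (_ : F ^~ pi = F ^~ 0); last by apply/funext => s; exact: Fpi.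
  move: (cintI 0 pi (F 0)) (cintI 0 pi (F s0)) (cintI s0 0 _) => x y u.
  by rewrite subrr subr0 => xy; apply/subr0_eq/(mulfI (complexi_neq0)); rewrite xy mulr0.
have -> : (fun t => Q (rot t z)) = F 0.
  by apply/funext => t; rewrite /F /H /G mulr0.
have iF s0 : s0 <= 0 ->
    cintegrable (@lebesgue_measure R) `[0, pi]%classic (F s0).
  by move=> s00; apply: (@cintegrable_row _ _ s0 0 0 pi s0) => //; rewrite lexx.
split; first exact: iF.
apply/eqP; rewrite -subr_eq0 -normc_eq0 eq_le normc_ge0 andbT.
rewrite leNgt; apply/negP => pos; set x := normc _ in pos.
(* With this tolerance [cintI_le], on an interval of length pi, yields x <= x / 2. *)
have e0 : 0 < x / (4 * pi) by rewrite divr_gt0// mulr_gt0// pi_gt0.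
have /derivable_cderiv[a ha] : derivable (H : C^o -> C^o) (0 : C^o) (1 : C^o).
  by apply: Ha; rewrite /mkset ComplexField.Normc.normc0 ltr01.
have [d d0 hd] := cderiv_cont ha e0.
have [s0 s00 sd] : exists2 s0, s0 <= 0 & expR s0 < d.
  exists (Num.min 0 (ln (d / 2))); first by rewrite ge_min lexx.
  apply: (@le_lt_trans _ _ (d / 2)); last by lra.
  rewrite -{2}(@lnK _ (d / 2)) ?posrE ?divr_gt0//.
  by rewrite ler_expR ge_min lexx orbT.
have H0 : H 0 = Q 1 by rewrite /H /cayley addr0 subr0 divr1.
have {}iF := iF s0 s00.
have mI : measurable (`[0%R, pi]%classic : set (measurableTypeR R)).
  exact: measurable_itv.
have iC : cintegrable (@lebesgue_measure R) `[0%R, pi]%classic (fun=> Q 1).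
  by apply: ccont_integrable => w _ r r0; exists 1 => // *;
    rewrite subrr ComplexField.Normc.normc0.
have cst : cintI 0 pi (fun=> Q 1) = Q 1 * pi%:C by rewrite cintI_cst// subr0.
have : x <= 2 * (x / (4 * pi) * (pi - 0)).
  rewrite {1}/x (step _ s00) -cst -cintB//.
  apply: cintI_le => //.
    by apply: cintegrableD => //; exact: cintegrableN.
  move=> t _; rewrite -H0; apply/ltW/hd; rewrite subr0 normcM normc_cexp2.
  apply: le_lt_trans sd.
  apply: (@le_trans _ _ (expR (2 * s0))); last by rewrite ler_expR; lra.
  by rewrite ler_piMl ?expR_ge0// ltW.
rewrite subr0 (_ : 2 * (x / (4 * pi) * pi) = x / 2); last first.
  have E (y q : R) : q != 0 -> 2 * (y / (4 * q) * q) = y / 2 by move=> q0; field.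
  exact: E (lt0r_neq0 (@pi_gt0 R)).
lra.
Qed.

End rotation.

Section iterated_integral.
Context d1 d2 (T1 : measurableType d1) (T2 : measurableType d2) (R : realType).
Variable m1 : {sigma_finite_measure set T1 -> \bar R}.
Variable m2 : {sigma_finite_measure set T2 -> \bar R}.
Variables (D1 : set T1) (D2 : set T2).
Hypotheses (mD1 : measurable D1) (mD2 : measurable D2).

Lemma integral_prod_iter (f : T1 * T2 -> R) :
  (m1 \x m2)%E.-integrable (D1 `*` D2) (fun p => (f p)%:E) ->
  (\int[m1]_(x in D1) \int[m2]_(y in D2) (f (x, y))%:E =
   \int[m1 \x m2]_(p in D1 `*` D2) (f p)%:E)%E.
Proof.
move=> fi; have mD : measurable (D1 `*` D2) by exact: measurableX.
have gi := (integrable_mkcond _ mD).1 fi.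
rewrite [RHS]integral_mkcond -(integral12_prod_meas1 gi) [LHS]integral_mkcond.
apply: eq_integral => x _; rewrite patchE /fubini_F.
case: ifPn => [D1x|D1x].
  rewrite [LHS]integral_mkcond; apply: eq_integral => y _.
  by rewrite !patchE in_setX /= D1x.
by rewrite integral0_eq// => y _; rewrite patchE in_setX /= (negbTE D1x).
Qed.

End iterated_integral.

(** * Changes of variable for complex integrals over the half-plane *)

Section half_plane_complex_integral.
Variable R : realType.
Local Notation C := R[i].
Local Notation leb := (@lebesgue_measure R).
Local Notation m2 := (@planar_measure R).
Local Notation D := (@half_plane R).
Let mD := @measurable_half_plane R.

Definition hcint (F : C -> C) : C := cint m2 D (fun p => F (cpt p)).

Definition habs (F : C -> C) : \bar R := hint (fun z => normc (F z)).

Lemma borelfun_normc (F : C -> C) : cborel F -> borelfun (fun z => normc (F z)).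
Proof. exact: measurable_normc. Qed.

Lemma hcint_integrable (F : C -> C) : cborel F -> (habs F < +oo)%E ->
  cintegrable m2 D (fun p => F (cpt p)).
Proof. by move=> mF Foo; apply: cintegrable_lty. Qed.

Lemma eq_hcint (F G : C -> C) : (forall z, 0 < Re z -> F z = G z) ->
  hcint F = hcint G.
Proof. by move=> e; apply: eq_cint => p /half_planeP; exact: e. Qed.

Lemma eq_habs (F G : C -> C) : (forall z, 0 < Re z -> F z = G z) ->
  habs F = habs G.
Proof. by move=> e; apply: eq_hint => z z0; rewrite e. Qed.

Lemma hcint_iter (F : C -> C) : cborel F -> (habs F < +oo)%E ->
  hcint F = fine (Cplus_integral (fun x y => Re (F (x +i* y))))
    +i* fine (Cplus_integral (fun x y => Im (F (x +i* y)))).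
Proof.
move=> mF Foo; have [i1 i2] := hcint_integrable mF Foo.
apply: complex_ext; congr fine; apply/esym.
  exact: (@integral_prod_iter _ _ _ _ R leb leb setT _ measurableT
    (measurable_itv _) (fun p => Re (F (cpt p)))).
exact: (@integral_prod_iter _ _ _ _ R leb leb setT _ measurableT
    (measurable_itv _) (fun p => Im (F (cpt p)))).
Qed.

(** A change of variables as a property of a map and its Jacobian, closed under composition. Testing
    on nonnegative functions keeps integrability out of it; complex integrands follow through
    positive and negative parts. *)
Definition hsubst (T : C -> C) (J : C -> R) := forall phi : C -> R,
  borelfun phi -> (forall z, 0 <= phi z) ->
  hint (fun z => phi (T z) * J z) = hint phi.

Lemma eq_hsubst T T' J J' : (forall z, 0 < Re z -> T z = T' z) ->
  (forall z, 0 < Re z -> J z = J' z) -> hsubst T J -> hsubst T' J'.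
Proof.
move=> eT eJ h phi mphi phi0; rewrite -(h phi mphi phi0).
by apply: eq_hint => z z0; rewrite eT// eJ.
Qed.

Lemma hsubst_comp T1 J1 T2 J2 : cborel T2 -> borelfun J2 -> (forall z, 0 <= J2 z) ->
  hsubst T1 J1 -> hsubst T2 J2 ->
  hsubst (fun z => T2 (T1 z)) (fun z => J2 (T1 z) * J1 z).
Proof.
move=> mT2 mJ2 J20 h1 h2 phi mphi phi0.
rewrite -(h2 phi mphi phi0) -(h1 (fun z => phi (T2 z) * J2 z)).
- by apply: eq_hint => z _; rewrite mulrA.
- by apply: measurable_funM mJ2; exact: borelfun_comp mphi mT2.
- by move=> z; exact: mulr_ge0.
Qed.

Lemma hcint_subst T J F : cborel T -> borelfun J ->
  (forall z, 0 < Re z -> 0 <= J z) ->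
  hsubst T J -> cborel F ->
  hcint (fun z => F (T z) * (J z)%:C) = hcint F.
Proof.
move=> mT mJ J0 h mF.
have real (f : C -> R) : borelfun f ->
    (\int[m2]_(p in D) (f (T (cpt p)) * J (cpt p))%:E =
     \int[m2]_(p in D) (f (cpt p))%:E)%E.
  move=> mf; rewrite integralE [RHS]integralE.
  congr (_ - _)%E.
    transitivity (hint (fun z => Num.max (f (T z)) 0 * J z)).
      apply: eq_integral => p /set_mem /half_planeP p0.
      by rewrite maxr_pMl ?J0// mul0r EFin_max funeposE.
    rewrite (h (fun z => Num.max (f z) 0)).
    - by apply: eq_integral => p _; rewrite EFin_max funeposE.
    - by apply: measurable_maxr => //; exact: measurable_cst.
    - by move=> z; rewrite le_max lexx orbT.
  transitivity (hint (fun z => Num.max (- f (T z)) 0 * J z)).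
    apply: eq_integral => p /set_mem /half_planeP p0.
    by rewrite maxr_pMl ?J0// mul0r mulNr EFin_max EFinN funenegE.
  rewrite (h (fun z => Num.max (- f z) 0)).
  - by apply: eq_integral => p _; rewrite EFin_max EFinN funenegE.
  - by apply: measurable_maxr => //; exact: measurable_funN.
  - by move=> z; rewrite le_max lexx orbT.
have [F1 F2] := mF.
apply: complex_ext; rewrite /hcint /= /Rintegral; congr fine.
  rewrite -(real (fun z => Re (F z)) F1); apply: eq_integral => p _.
  by rewrite RecM /= mulr0 subr0.
rewrite -(real (fun z => Im (F z)) F2); apply: eq_integral => p _.
by rewrite ImcM /= mulr0 add0r.
Qed.

Lemma habs_subst T J F : (forall z, 0 < Re z -> 0 <= J z) ->
  hsubst T J -> cborel F ->
  habs (fun z => F (T z) * (J z)%:C) = habs F.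
Proof.
move=> J0 h mF; rewrite /habs -(h (fun z => normc (F z))).
- by apply: eq_hint => z z0; rewrite normcM normcR_ge0// J0.
- exact: borelfun_normc.
- by move=> z; exact: normc_ge0.
Qed.

Lemma borelfun_cst (r : R) : @borelfun R (fun=> r).
Proof. exact: measurable_cst. Qed.

Lemma hsubst_imag (t : R) : hsubst (fun z => z + (0 +i* t)) (fun=> 1).
Proof.
move=> phi mphi phi0; rewrite -[RHS](hint_imag_shift t mphi phi0).
by apply: eq_hint => z _; rewrite mulr1.
Qed.

Lemma hsubst_scale (c : R) : 0 < c ->
  hsubst (fun z => c%:C * z) (fun=> c ^+ 2).
Proof. by move=> c0 phi mphi phi0; exact: hint_scale. Qed.

Lemma borel_shift (a : C) : cborel (fun z : C => z + a).
Proof. by apply: cmeasD; [exact: cborel_id|exact: cmeas_cst]. Qed.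

Lemma borel_scale (a : C) : cborel (fun z : C => a * z).
Proof. by apply: cmeasM; [exact: cmeas_cst|exact: cborel_id]. Qed.

Lemma borel_inv : cborel (fun z : C => 1 / z).
Proof. by apply: cmeasM; [exact: cmeas_cst|apply: cmeasV; exact: cborel_id]. Qed.

Lemma borel_invnorm k : borelfun (fun z : C => (normc z ^+ k)^-1).
Proof.
apply: measurable_invr; apply: measurable_funX.
exact: borelfun_normc (@cborel_id R).
Qed.

Lemma invnorm_ge0 k (z : C) : 0 <= (normc z ^+ k)^-1.
Proof. by rewrite invr_ge0 exprn_ge0// normc_ge0. Qed.

Lemma hsubst_inv : hsubst (fun z => 1 / z) (fun z => (normc z ^+ 4)^-1).
Proof.
move=> phi mphi phi0; rewrite -[RHS](hint_inv mphi phi0).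
rewrite -[RHS](@hint_conj _ (fun z => phi (1 / z^*) / normc z ^+ 4)).
- apply: eq_hint => z _; rewrite normc_conj; congr (phi (1 / _) / _).
  by case: z => a b /=; rewrite opprK.
- apply: measurable_funM; last exact: borel_invnorm.
  apply: borelfun_comp mphi _; exact: cmeas_comp borel_inv (@cborel_conj R).
- by move=> z; exact: mulr_ge0 (phi0 _) (invnorm_ge0 _ _).
Qed.

Lemma hsubst_moebius (c t u : R) : 0 < c ->
  hsubst (fun z => c%:C * (1 / (z + (0 +i* t))) + (0 +i* u))
         (fun z => c ^+ 2 * (normc (z + (0 +i* t)) ^+ 4)^-1).
Proof.
move=> c0.
have c20 : 0 <= c ^+ 2 by exact: sqr_ge0.
have h1 := hsubst_comp borel_inv (borel_invnorm 4) (invnorm_ge0 4)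
  (hsubst_imag t) hsubst_inv.
have h2 := hsubst_comp (borel_scale c%:C) (borelfun_cst _) (fun=> c20)
  h1 (hsubst_scale c0).
have h3 := hsubst_comp (borel_shift (0 +i* u)) (borelfun_cst _) (fun=> ler01)
  h2 (hsubst_imag u).
apply: eq_hsubst h3 => // z _.
by rewrite mul1r mulr1.
Qed.

End half_plane_complex_integral.

(** * The weighted Bergman space *)

Section bergman_space.
Variables (R : realType) (l : nat).
Local Notation C := R[i].
Implicit Types (h k u : C -> C) (z w a : C).

(** The absolute value keeps the weight nonnegative off the half-plane too, as the lemmas on
    iterated integrals ask. *)
Definition wt z : R := `|Re z| ^+ l.

(* sqn and hip omit the factor 1/pi of bergman_sqnorm and bergman_ip. *)
Definition sqn h : \bar R := hint (fun z => wt z * normc (h z) ^+ 2).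

Definition hipf h k z : C := (wt z)%:C * (h z * (k z)^*).

Definition hip h k : C := hcint (hipf h k).

Lemma wt_ge0 z : 0 <= wt z.
Proof. by rewrite /wt exprn_ge0. Qed.

Lemma borel_wt : borelfun wt.
Proof.
apply: measurable_funX; apply: measurableT_comp => //; exact: measurable_snd.
Qed.

Lemma cborel_wt : cborel (fun z => (wt z)%:C).
Proof. by apply: cmeas_real; exact: borel_wt. Qed.

Lemma borel_sqn h : cborel h -> borelfun (fun z => wt z * normc (h z) ^+ 2).
Proof.
move=> mh; apply: measurable_funM; first exact: borel_wt.
by apply: measurable_funX; exact: borelfun_normc mh.
Qed.

Lemma sqn_integrand_ge0 h z : 0 <= wt z * normc (h z) ^+ 2.
Proof. exact: mulr_ge0 (wt_ge0 z) (sqr_ge0 _). Qed.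

Lemma sqn_ge0 h : (0 <= sqn h)%E.
Proof. by apply: hint_ge0 => z _; exact: sqn_integrand_ge0. Qed.

Lemma bergman_sqnormE h : cborel h ->
  bergman_sqnorm l h = ((pi^-1)%:E * sqn h)%E.
Proof.
move=> mh; rewrite /bergman_sqnorm; congr (_ * _)%E.
rewrite /sqn (hint_iter_x (borel_sqn mh) (sqn_integrand_ge0 h)).
apply: eq_integral => y _; apply: eq_integral => x /set_mem.
by rewrite /= in_itv /= andbT => x0; rewrite /wt /= gtr0_norm.
Qed.

Lemma pi_mule_lty (x : \bar R) : (0 <= x)%E ->
  ((pi^-1)%:E * x < +oo)%E = (x < +oo)%E.
Proof.
have p0 : 0 < (pi : R)^-1 by rewrite invr_gt0 pi_gt0.
case: x => [x||] //= _; first by rewrite -EFinM !ltry.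
by rewrite gt0_muley// lte_fin.
Qed.

Lemma bergmanP h : bergman l h <-> [/\ analytic_on (@Cplus R) h,
  (forall z, ~ Cplus z -> h z = 0) & (sqn h < +oo)%E].
Proof.
split=> -[h1 h2 h3]; split=> //; have mh := analytic_cborel h1 h2.
  by rewrite bergman_sqnormE// pi_mule_lty ?sqn_ge0 in h3.
by rewrite bergman_sqnormE// pi_mule_lty ?sqn_ge0.
Qed.

Lemma bergman_borel h : bergman l h -> cborel h.
Proof. by case=> h1 h2 _; exact: analytic_cborel. Qed.

Lemma bergman_sqn_lty h : bergman l h -> (sqn h < +oo)%E.
Proof. by move=> /bergmanP[]. Qed.

Lemma bergman_sqn_fin h : bergman l h -> sqn h \is a fin_num.
Proof. by move=> bh; rewrite ge0_fin_numE ?sqn_ge0// bergman_sqn_lty. Qed.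

Definition nsq h : R := fine (sqn h).

Lemma nsq_ge0 h : 0 <= nsq h.
Proof. by rewrite fine_ge0// sqn_ge0. Qed.

Lemma nsqE h : bergman l h -> sqn h = (nsq h)%:E.
Proof. by move=> bh; rewrite fineK// bergman_sqn_fin. Qed.

Lemma bergman_normE h : bergman l h ->
  bergman_norm l h = Num.sqrt (pi^-1 * nsq h).
Proof.
move=> bh; rewrite /bergman_norm (bergman_sqnormE (bergman_borel bh)) nsqE//.
Qed.

Lemma bergman_comb a h k : bergman l h -> bergman l k ->
  bergman l (fun z => a * h z + k z).
Proof.
move=> bh bk; have mh := bergman_borel bh; have mk := bergman_borel bk.
move: (bh) (bk) => /bergmanP[h1 h2 h3] /bergmanP[k1 k2 k3].
have mhk : cborel (fun z => a * h z + k z).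
  by apply: cmeasD mk; apply: cmeasM mh; exact: cmeas_cst.
apply/bergmanP; split.
- by apply: analyticD k1; apply: analyticM h1; exact: analytic_cst.
- by move=> z z0; rewrite h2// k2// mulr0 addr0.
pose c := 2 * normc a ^+ 2.
have c0 : 0 <= c by rewrite /c mulr_ge0// exprn_ge0// normc_ge0.
have mD := @measurable_half_plane R.
pose f z := c * (wt z * normc (h z) ^+ 2) + 2 * (wt z * normc (k z) ^+ 2).
have mf1 : borelfun (fun z => c * (wt z * normc (h z) ^+ 2)).
  by apply: measurable_funM; [exact: measurable_cst|exact: borel_sqn].
have mf2 : borelfun (fun z => 2 * (wt z * normc (k z) ^+ 2)).
  by apply: measurable_funM; [exact: measurable_cst|exact: borel_sqn].
apply: (@le_lt_trans _ _ (hint f)).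
  apply: le_hint; [exact: borel_sqn|exact: measurable_funD|].
  move=> z _; rewrite (sqn_integrand_ge0 (fun z => a * h z + k z)) /f /c /=.
  have w0 := wt_ge0 z.
  have T := ler_normcD (a * h z) (k z); rewrite normcM in T.
  have n0 := normc_ge0 (a * h z + k z).
  have sq2 : normc (a * h z + k z) ^+ 2 <=
      2 * normc a ^+ 2 * normc (h z) ^+ 2 + 2 * normc (k z) ^+ 2.
    have : normc (a * h z + k z) ^+ 2 <= (normc a * normc (h z) + normc (k z)) ^+ 2.
      by rewrite ler_pXn2r// nnegrE// addr_ge0 ?mulr_ge0 ?normc_ge0.
    have := sqr_ge0 (normc a * normc (h z) - normc (k z)); nra.
  by have := ler_wpM2l w0 sq2; lra.
have -> : hint f = (c%:E * sqn h + 2%:E * sqn k)%E.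
  rewrite /hint /f; under eq_integral do rewrite EFinD.
  rewrite ge0_integralD//; first last.
  - exact/measurable_EFinP/measurable_funTS.
  - by move=> p _; rewrite lee_fin mulr_ge0 ?sqn_integrand_ge0.
  - exact/measurable_EFinP/measurable_funTS.
  - by move=> p _; rewrite lee_fin mulr_ge0 ?sqn_integrand_ge0.
  congr (_ + _)%E.
    exact: (ge0_integralZlR (@planar_measure R) mD (borel_sqn mh)
      (fun p _ => sqn_integrand_ge0 h _) c0).
  exact: (ge0_integralZlR (@planar_measure R) mD (borel_sqn mk)
    (fun p _ => sqn_integrand_ge0 k _) (ler0n _ 2)).
by rewrite (nsqE bh) (nsqE bk) -!EFinM -EFinD ltry.
Qed.

Lemma bergman0 : @bergman R l (fun=> 0).
Proof.
apply/bergmanP; split=> //.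
rewrite /sqn (_ : hint _ = 0%E); first exact: ltry.
apply: integral0_eq => p _.
by rewrite ComplexField.Normc.normc0 expr0n mulr0.
Qed.

Lemma bergmanZ a h : bergman l h -> bergman l (fun z => a * h z).
Proof.
move=> bh; rewrite (_ : (fun z => a * h z) = (fun z => a * h z + (fun=> 0) z)).
  exact: bergman_comb bh bergman0.
by apply/funext => z; rewrite addr0.
Qed.

Lemma bergmanB h k : bergman l h -> bergman l k ->
  bergman l (fun z => h z - k z).
Proof.
move=> bh bk; rewrite (_ : (fun z => h z - k z) = (fun z => -1 * k z + h z)).
  exact: bergman_comb.
by apply/funext => z; rewrite mulN1r addrC.
Qed.

Lemma borel_hip h k : cborel h -> cborel k ->
  cborel (hipf h k).
Proof.
move=> mh mk; apply: cmeasM; first exact: cborel_wt.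
by apply: cmeasM mh _; exact: cmeas_conj.
Qed.

Lemma normc_hip h k z :
  normc (hipf h k z) = wt z * (normc (h z) * normc (k z)).
Proof. by rewrite /hipf !normcM normc_conj normcR_ge0// wt_ge0. Qed.

(** The weighted inequality 2 a b <= t a^2 + b^2 / t, integrated. Optimising over [t] in
    [sqrt_bound] turns it into Cauchy-Schwarz. *)
Lemma habs_hip h k (t : R) : bergman l h -> bergman l k -> 0 < t ->
  (2%:E * habs (hipf h k) <=
   (t * nsq h + t^-1 * nsq k)%:E)%E.
Proof.
move=> bh bk t0; have mh := bergman_borel bh; have mk := bergman_borel bk.
have mD := @measurable_half_plane R.
have tge := ltW t0; have tV : 0 <= t^-1 by rewrite invr_ge0.
have mf1 : borelfun (fun z => t * (wt z * normc (h z) ^+ 2)).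
  by apply: measurable_funM; [exact: measurable_cst|exact: borel_sqn].
have mf2 : borelfun (fun z => t^-1 * (wt z * normc (k z) ^+ 2)).
  by apply: measurable_funM; [exact: measurable_cst|exact: borel_sqn].
have mg := borelfun_normc (borel_hip mh mk).
rewrite /habs /hint -ge0_integralZlR//; last by move=> p _; exact: normc_ge0.
rewrite EFinD !EFinM -(nsqE bh) -(nsqE bk) /sqn /hint.
rewrite -(ge0_integralZlR (@planar_measure R) mD (borel_sqn mh)
  (fun p _ => sqn_integrand_ge0 h _) tge).
rewrite -(ge0_integralZlR (@planar_measure R) mD (borel_sqn mk)
  (fun p _ => sqn_integrand_ge0 k _) tV).
rewrite -ge0_integralD//; first last.
- exact/measurable_EFinP/measurable_funTS.
- by move=> p _; rewrite lee_fin mulr_ge0 ?sqn_integrand_ge0.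
- exact/measurable_EFinP/measurable_funTS.
- by move=> p _; rewrite lee_fin mulr_ge0 ?sqn_integrand_ge0.
apply: (@le_hint _ (fun z => 2 * normc (hipf h k z))
  (fun z => t * (wt z * normc (h z) ^+ 2) + t^-1 * (wt z * normc (k z) ^+ 2))).
- by apply: measurable_funM; [exact: measurable_cst|exact: mg].
- exact: measurable_funD mf1 mf2.
move=> z _; rewrite mulr_ge0 ?normc_ge0// normc_hip.
have -> : t * (wt z * normc (h z) ^+ 2) + t^-1 * (wt z * normc (k z) ^+ 2) =
    2 * (wt z * (normc (h z) * normc (k z))) +
    wt z * t^-1 * (t * normc (h z) - normc (k z)) ^+ 2.
  by field; rewrite gt_eqF.
by rewrite lerDl mulr_ge0 ?sqr_ge0// mulr_ge0// wt_ge0.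
Qed.

Lemma habs_hip_lty h k : bergman l h -> bergman l k ->
  (habs (hipf h k) < +oo)%E.
Proof.
move=> bh bk; have := habs_hip bh bk ltr01.
have : (0 <= habs (hipf h k))%E.
  by apply: hint_ge0 => z _; exact: normc_ge0.
case: (habs _) => [x||]// _; first by rewrite ltry.
by rewrite gt0_muley ?lte_fin.
Qed.

Lemma hip_integrable h k : bergman l h -> bergman l k ->
  cintegrable (@planar_measure R) (@half_plane R)
    (fun p => hipf h k (cpt p)).
Proof.
move=> bh bk; apply: (@hcint_integrable _ (hipf h k)).
  exact: borel_hip (bergman_borel bh) (bergman_borel bk).
exact: habs_hip_lty.
Qed.

Lemma bergman_ipE h k : bergman l h -> bergman l k ->
  bergman_ip l h k = (pi^-1)%:C * hip h k.
Proof.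
move=> bh bk; rewrite /bergman_ip; congr (_ * _).
rewrite /hip hcint_iter; [|exact: borel_hip (bergman_borel bh) (bergman_borel bk)|
  exact: habs_hip_lty].
have E (x y : R) : 0 < x ->
    (x ^+ l)%:C * (h (x +i* y) * (k (x +i* y))^*) = hipf h k (x +i* y).
  by move=> x0; rewrite /hipf /wt (gtr0_norm (x0 : 0 < Re (x +i* y))).
have posP (x : R) : x \in (`]0%R, +oo[%classic : set R) -> 0 < x.
  by rewrite inE /= in_itv /= andbT.
rewrite /Cplus_integral; apply: (congr2 (@Complex R)); apply: (congr1 fine);
  apply: eq_integral => y _; apply: eq_integral => x /posP x0;
  apply: (congr1 EFin); exact: congr1 (E x y x0).
Qed.

Lemma hip_le h k (t : R) : bergman l h -> bergman l k -> 0 < t ->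
  normc (hip h k) <= t * nsq h + t^-1 * nsq k.
Proof.
move=> bh bk t0; have mg := borel_hip (bergman_borel bh) (bergman_borel bk).
have mD := @measurable_half_plane R.
have B := habs_hip bh bk t0; have F := habs_hip_lty bh bk.
pose g z := normc (hipf h k z).
have ig : (@planar_measure R).-integrable (@half_plane R) (fun p => (g (cpt p))%:E).
  apply: integrable_ge0 => //; first exact: borelfun_normc mg.
  by move=> p; exact: normc_ge0.
have /le_trans := normc_cint_le mD (hip_integrable bh bk) ig (fun p _ => lexx _).
apply; rewrite -lee_fin; apply: le_trans B.
rewrite EFinM lee_pmul2l//.
by rewrite /Rintegral fineK// integrable_fin_num.
Qed.

(** The optimal [t] is sqrt (y / x). If [x] or [y] is 0 the infimum may not be attained, and a
    sufficiently extreme [t] contradicts a positive [a]. *)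
Lemma sqrt_bound (x y a : R) : 0 <= x -> 0 <= y ->
  (forall t, 0 < t -> a <= t * x + t^-1 * y) ->
  a <= 2 * Num.sqrt (x * y).
Proof.
move=> x0 y0 H.
have sx := sqr_sqrtr x0; have sy := sqr_sqrtr y0.
rewrite sqrtrM//; move: (sqrtr_ge0 x) (sqrtr_ge0 y) sx sy.
move: (Num.sqrt x) (Num.sqrt y) => p q p0 q0 sx sy.
have [p_gt0|] := ltP 0 p; last first.
  move=> p_le0; have pE : p = 0 by lra.
  rewrite pE mul0r mulr0 leNgt; apply/negP => a0.
  have := H ((y + 1) / a) (divr_gt0 (ltr_wpDl y0 ltr01) a0).
  rewrite -sx pE expr0n mulr0 add0r invf_div.
  have : a / (y + 1) * y < a.
    rewrite mulrAC ltr_pdivrMr; last lra.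
    by rewrite ltr_pM2l//; lra.
  lra.
have [q_gt0|] := ltP 0 q; last first.
  move=> q_le0; have qE : q = 0 by lra.
  rewrite qE !mulr0 leNgt; apply/negP => a0.
  have := H (a / (x + 1)) (divr_gt0 a0 (ltr_wpDl x0 ltr01)).
  rewrite -sy qE expr0n mulr0 addr0.
  have : a / (x + 1) * x < a.
    rewrite mulrAC ltr_pdivrMr; last lra.
    by rewrite ltr_pM2l//; lra.
  lra.
apply: le_trans (H (q / p) (divr_gt0 q_gt0 p_gt0)) _.
rewrite -sx -sy le_eqVlt; apply/orP; left; apply/eqP; field.
by rewrite !gt_eqF.
Qed.

Lemma hip_cs h k : bergman l h -> bergman l k ->
  normc (hip h k) <= 2 * Num.sqrt (nsq h * nsq k).
Proof.
move=> bh bk; apply: sqrt_bound; [exact: nsq_ge0|exact: nsq_ge0|].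
by move=> t t0; exact: hip_le.
Qed.

Lemma hip_conj h k : bergman l h -> bergman l k -> hip k h = (hip h k)^*.
Proof.
move=> bh bk; rewrite /hip /hcint -cint_conj; last 2 first.
- exact: measurable_half_plane.
- exact: hip_integrable.
apply: eq_cint => p _; rewrite /hipf.
move: (wt _) (h _) (k _) => x a b; case: a => a1 a2; case: b => b1 b2.
by apply: complex_ext => /=; ring.
Qed.

Lemma hip_comb a h k u : bergman l h -> bergman l k -> bergman l u ->
  hip (fun z => a * h z + k z) u = a * hip h u + hip k u.
Proof.
move=> bh bk bu; have mD := @measurable_half_plane R.
rewrite /hip /hcint -cintZ; [|exact: mD|exact: hip_integrable].
rewrite -cintD; [|exact: mD|apply: cintegrableZ mD _; exact: hip_integrable|
  exact: hip_integrable].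
by apply: eq_cint => p _; rewrite /hipf; ring.
Qed.

Lemma eq_hip h k h' k' : (forall z, 0 < Re z -> h z = h' z) ->
  (forall z, 0 < Re z -> k z = k' z) -> hip h k = hip h' k'.
Proof.
move=> e1 e2; apply: (@eq_hcint _ (hipf h k) (hipf h' k')) => z z0.
by rewrite /hipf e1// e2.
Qed.

End bergman_space.

(** * Hyperbolic rotations as changes of variable *)

Section rotation_invariance.
Variable R : realType.
Local Notation C := R[i].
Local Notation TR := (measurableTypeR R).

Lemma cmeas_rot : cmeas (fun p : TR * (TR * TR) => rot p.1 (cpt p.2)).
Proof.
have m2 : cmeas (fun p : TR * (TR * TR) => cpt p.2).
  apply: (@cmeas_comp R _ _ id); first exact: cborel_id.
  split; first exact: (measurableT_comp measurable_snd measurable_snd).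
  exact: (measurableT_comp measurable_fst measurable_snd).
have m1 : measurable_fun [set: TR * (TR * TR)] (fun p => 2 * p.1 : R).
  by apply: measurable_funM; [exact: measurable_cst|exact: measurable_fst].
have mc : measurable_fun [set: R] (@cos R).
  by apply: continuous_measurable_fun; exact: continuous_cos.
have ms : measurable_fun [set: R] (@sin R).
  by apply: continuous_measurable_fun; exact: continuous_sin.
have me : cmeas (fun p : TR * (TR * TR) => cexp2 0 (2 * p.1)).
  apply: cmeas_Complex; apply: measurable_funM; try exact: measurable_cst.
    exact: (measurableT_comp mc m1).
  exact: (measurableT_comp ms m1).
have mv : cmeas (fun p : TR * (TR * TR) => cayley_inv (cpt p.2) * cexp2 0 (2 * p.1)).
  apply: cmeasM me; apply: cmeasM; first by apply: cmeasB; [exact: m2|exact: cmeas_cst].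
  by apply: cmeasV; apply: cmeasD; [exact: m2|exact: cmeas_cst].
apply: cmeasM; first by apply: cmeasD; [exact: cmeas_cst|exact: mv].
by apply: cmeasV; apply: cmeasB; [exact: cmeas_cst|exact: mv].
Qed.

Lemma borel_rot (t : R) : cborel (rot t).
Proof.
have [r1 r2] := cmeas_rot.
have mp : measurable_fun [set: TR * TR] (fun p => (t : TR, p)).
  by apply: measurable_fun_pair; [exact: measurable_cst|exact: measurable_id].
by split; [exact: (measurableT_comp r1 mp)|exact: (measurableT_comp r2 mp)].
Qed.

(** The Jacobian |T'(z)|^2 of T = [rot t]: a hyperbolic isometry satisfies |T'(z)| = Re (T z) / Re
    z. *)
Definition rotJ (t : R) (z : C) : R := (Re (rot t z) / Re z) ^+ 2.

Lemma rotJ_ge0 t z : 0 <= rotJ t z.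
Proof. exact: sqr_ge0. Qed.

Lemma borel_rotJ t : borelfun (rotJ t).
Proof.
apply: measurable_funX; apply: measurable_funM; first by have [] := borel_rot t.
by apply: measurable_invr; exact: measurable_snd.
Qed.

Lemma Re_scaled_inv (c : R) (w : C) : Re (c%:C / w) = c * Re w / normc w ^+ 2.
Proof. by rewrite RecM RecV /= mul0r subr0 mulrA. Qed.

Lemma hsubst_rot t : hsubst (rot t) (rotJ t).
Proof.
(* [rot_moebius] divides by sin t; where sin t = 0 the rotation is the identity. *)
have [s0|s0] := eqVneq (sin t) 0.
  have c1 : cos t ^+ 2 = 1 by rewrite -(cos2Dsin2 t) s0 expr0n addr0.
  have c0 : (cos t)%:C != 0 :> C.
    rewrite -normc_gt0 normc_real normr_gt0; apply: contra_eq_neq c1 => ->.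
    by rewrite expr0n eq_sym oner_neq0.
  have rE z : 0 < Re z -> rot t z = z.
    move=> z0; rewrite rotE// s0 (_ : 0 *i = 0 :> C)// mulr0 !subr0.
    by rewrite mulfK.
  apply: (@eq_hsubst _ id _ (fun=> 1)) => [z z0|z z0|phi _ _].
  - by rewrite rE.
  - by rewrite /rotJ rE// divff ?gt_eqF// expr1n.
  - by apply: eq_hint => z _; rewrite mulr1.
set tau := cos t / sin t.
have c0 : 0 < (sin t ^+ 2)^-1 by rewrite invr_gt0 lt_def sqr_ge0 andbT expf_neq0.
apply: eq_hsubst (hsubst_moebius tau tau c0) => z z0.
  by rewrite rot_moebius// div1r addrC.
have zt : 0 < Re (z + (0 +i* tau)) by rewrite RecD /= addr0.
have nz : normc (z + (0 +i* tau)) != 0 by rewrite gt_eqF// normc_gt0 Re_neq0.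
rewrite /rotJ rot_moebius// -/tau RecD Re_scaled_inv /= add0r RecD /= addr0.
field; rewrite nz gt_eqF//=.
Qed.

End rotation_invariance.

Section weighted_composition.
Variables (R : realType) (l : nat).
Local Notation C := R[i].

(** Once [T] has a Jacobian, boundedness of a weighted composition is a pointwise comparison of
    weights. *)
Lemma bergman_wcomp (m T : C -> C) (J : C -> R) (K : R) h :
  analytic_on (@Cplus R) m -> analytic_on (@Cplus R) T ->
  (forall z, 0 < Re z -> 0 < Re (T z)) -> cborel T -> borelfun J ->
  (forall z, 0 < Re z -> 0 <= J z) -> hsubst T J -> 0 <= K ->
  (forall z, 0 < Re z -> wt l z * normc (m z) ^+ 2 <= K * (wt l (T z) * J z)) ->
  bergman l h ->
  bergman l (extend0 (fun z => m z * h (T z))) /\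
  nsq l (extend0 (fun z => m z * h (T z))) <= K * nsq l h.
Proof.
move=> ma Ta T0 mT mJ J0 hTJ K0 ineq bh.
have mh := bergman_borel bh; have [h1 h2 _] := bh.
set W := extend0 _.
have Wa : analytic_on (@Cplus R) W.
  apply: analytic_extend0; apply: analyticM ma _; exact: analytic_comp h1 Ta.
have mW := analytic_cborel Wa (@extend0_out _ _).
have le : (sqn l W <= K%:E * sqn l h)%E.
  have E : (K%:E * sqn l h)%E =
      (\int[@planar_measure R]_(p in @half_plane R)
        (K * (wt l (T (cpt p)) * normc (h (T (cpt p))) ^+ 2 * J (cpt p)))%:E)%E.
    rewrite ge0_integralZlR//.
    - congr (_ * _)%E.
      exact/esym/(hTJ _ (borel_sqn l mh) (sqn_integrand_ge0 l h)).
    - exact: measurable_half_plane.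
    - apply: measurable_funM mJ; exact: (borelfun_comp (borel_sqn l mh) mT).
    - move=> p /half_planeP p0; apply: mulr_ge0 (J0 _ p0).
      exact: sqn_integrand_ge0.
  rewrite E; apply: (@le_hint _ _
    (fun z => K * (wt l (T z) * normc (h (T z)) ^+ 2 * J z))).
  - exact: borel_sqn.
  - apply: measurable_funM; first exact: measurable_cst.
    apply: measurable_funM mJ; exact: (borelfun_comp (borel_sqn l mh) mT).
  move=> z z0; rewrite sqn_integrand_ge0 /W extend0E// normcM exprMn [leLHS]mulrA /=.
  have -> : K * (wt l (T z) * normc (h (T z)) ^+ 2 * J z) =
    K * (wt l (T z) * J z) * normc (h (T z)) ^+ 2 by ring.
  by rewrite ler_wpM2r ?ineq// sqr_ge0.
have bW : bergman l W.
  apply/bergmanP; split => //; first exact: extend0_out.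
  by apply: le_lt_trans le _; rewrite (nsqE bh) -EFinM ltry.
by split=> //; rewrite -lee_fin EFinM -nsqE// -nsqE.
Qed.

End weighted_composition.

(** * Reproducing kernels *)

Section kernel.
Variables (R : realType) (l : nat).
Local Notation C := R[i].
Local Notation n := (l + 2)%N.
Local Notation leb := (@lebesgue_measure R).
Local Notation TR := (measurableTypeR R).
Local Notation P := (`]0%R, +oo[%classic : set R).

(** Left unnormalised: it reproduces values up to the constant [rep_cst]. *)
Definition kernel (w : C) : C -> C := extend0 (fun z => ((z + w^*) ^+ n)^-1).

Lemma kernel_neq0 (w z : C) : 0 < Re w -> 0 < Re z -> z + w^* != 0.
Proof. by move=> w0 z0; apply: Re_neq0; rewrite RecD RecJ; lra. Qed.

Lemma analytic_shift (U : set C) (a : C) : analytic_on U (fun z => z + a).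
Proof.
by apply: (@analyticD _ _ id (fun=> a)); [exact: analytic_id|exact: analytic_cst].
Qed.

Lemma analytic_kernel w : 0 < Re w -> analytic_on (@Cplus R) (kernel w).
Proof.
move=> w0; apply: analytic_extend0; apply: (@analyticV _ _ (fun z => (z + w^*) ^+ n)).
  by move=> z z0; rewrite expf_neq0// kernel_neq0.
by apply: (@analyticX _ _ (fun z => z + w^*)); exact: analytic_shift.
Qed.

Lemma borel_kernel w : 0 < Re w -> cborel (kernel w).
Proof.
by move=> w0; apply: analytic_cborel (analytic_kernel w0) _; exact: extend0_out.
Qed.

Lemma kernel1E (z : C) : 0 < Re z -> kernel 1 z = ((z + 1) ^+ n)^-1.
Proof.
move=> z0; rewrite /kernel extend0E//; congr ((z + _) ^+ n)^-1.
by apply: complex_ext => //=; rewrite oppr0.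
Qed.

Lemma integral_cauchy_density_lty :
  (\int[leb]_y ((1 + y ^+ 2)^-1)%:E < +oo)%E.
Proof.
have c0 y : 0 <= (1 + y ^+ 2 : R)^-1 by rewrite invr_ge0 addr_ge0 ?sqr_ge0.
rewrite (@ge0_symfun_integralT R (fun y => (1 + y ^+ 2)^-1)) //.
- rewrite -set_itvcy.
  have -> : (\int[leb]_(x in `[0%R, +oo[) ((1 + x ^+ 2)^-1)%:E = (pi / 2)%:E)%E.
    exact: integral0y_oneDsqr.
  by rewrite -EFinM ltry.
- exact: continuous_oneDsqrV.
- by move=> y /=; rewrite sqrrN.
Qed.

(** With q = |z + 1|^2, the power q ^ l absorbs the weight since Re z <= q, and the remaining q ^ 2
    dominates (1 + x^2)(1 + y^2). The integrand is thus below a product of two Cauchy densities. *)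
Lemma bergman_kernel1 : bergman l (kernel 1).
Proof.
have one0 : 0 < Re (1 : C) by exact: ltr01.
apply/bergmanP; split; [exact: analytic_kernel|exact: extend0_out|].
pose psi (z : C) : R := (1 + Re z ^+ 2)^-1 * (1 + Im z ^+ 2)^-1.
have p0 (y : R) : 0 < 1 + y ^+ 2 by rewrite ltr_pwDl// sqr_ge0.
have pV (y : R) : 0 <= (1 + y ^+ 2)^-1 by rewrite invr_ge0 ltW.
have mV : measurable_fun [set: R] (fun y : R => (1 + y ^+ 2)^-1).
  by apply: continuous_measurable_fun; exact: continuous_oneDsqrV.
have mpsi : borelfun psi.
  apply: measurable_funM; first exact: (measurableT_comp mV measurable_snd).
  exact: (measurableT_comp mV measurable_fst).
apply: (@le_lt_trans _ _ (hint psi)).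
  apply: le_hint => //; first exact: borel_sqn (borel_kernel one0).
  move=> z z0; rewrite sqn_integrand_ge0 /= kernel1E//.
  rewrite normcV normcX exprVn -exprM mulnC exprM normc_sqr.
  rewrite /psi /wt gtr0_norm// RecD ImcD /= addr0.
  move: (Re z) (Im z) z0 => x y x0.
  set q := (x + 1) ^+ 2 + y ^+ 2.
  have q1 : 1 <= q by rewrite /q; have := sqr_ge0 y; nra.
  have qx : 1 + x ^+ 2 <= q by rewrite /q; have := sqr_ge0 y; nra.
  have qy : 1 + y ^+ 2 <= q by rewrite /q; nra.
  have q0 : 0 < q by lra.
  have xq : x ^+ l <= q ^+ l.
    by apply: lerXn2r; rewrite ?nnegrE ?ltW// /q; have := sqr_ge0 y; nra.
  rewrite exprD invfM mulrA.
  apply: (@le_trans _ _ ((q ^+ 2)^-1)).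
    rewrite -[leRHS]mul1r ler_wpM2r ?invr_ge0 ?sqr_ge0//.
    by rewrite ler_pdivrMr ?exprn_gt0// mul1r.
  rewrite -invfM lef_pV2 ?posrE ?mulr_gt0 ?exprn_gt0//.
  by rewrite expr2; exact: ler_pM (ltW (p0 x)) (ltW (p0 y)) qx qy.
rewrite hint_iter_y//; last by move=> z; rewrite mulr_ge0.
set c := (\int[leb]_y ((1 + y ^+ 2)^-1)%:E)%E.
have cE : c = (fine c)%:E.
  rewrite fineK// ge0_fin_numE ?integral_cauchy_density_lty//.
  by apply: integral_ge0 => y _; rewrite lee_fin; exact: pV.
have c_ge0 : 0 <= fine c by rewrite fine_ge0//; apply: integral_ge0 => y _; rewrite lee_fin; exact: pV.
have -> : (\int[leb]_(x in P) \int[leb]_y (psi (x +i* y))%:E =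
    \int[leb]_(x in P) (fine c * (1 + x ^+ 2)^-1)%:E)%E.
  apply: eq_integral => x _.
  rewrite (ge0_integralZlR leb measurableT mV (fun y _ => pV y) (pV x)) -/c cE.
  by rewrite -EFinM mulrC.
have mP : measurable (P : set TR) by exact: measurable_itv.
rewrite (ge0_integralZlR leb mP mV (fun y _ => pV y) c_ge0).
have : (\int[leb]_(x in P) ((1 + x ^+ 2)^-1)%:E <= c)%E.
  apply: ge0_subset_integral => //; first exact/measurable_EFinP.
  by move=> x _; rewrite lee_fin; exact: pV.
rewrite cE; have : (0 <= \int[leb]_(x in P) ((1 + x ^+ 2)^-1)%:E)%E.
  by apply: integral_ge0 => y _; rewrite lee_fin; exact: pV.
by case: (integral _ _ _) => [x||]//= _ _; rewrite -EFinM ltry.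
Qed.

Lemma nsq_kernel1_gt0 : 0 < nsq l (kernel 1).
Proof.
have b1 := bergman_kernel1; have mb := bergman_borel b1.
pose B : set (TR * TR) := `[0, 1]%classic `*` `[1, 2]%classic.
have mB : measurable B by apply: measurableX; exact: measurable_itv.
have mD := @measurable_half_plane R.
have BD : B `<=` @half_plane R.
  move=> -[y x] [/= _]; rewrite !in_itv /= => /andP[x1 _]; split => //=.
  by rewrite in_itv /= andbT (lt_le_trans _ x1).
(* On [B], which has area 1, |z + 1|^2 is at most 3^2 + 1 = 10 and the weight is at least 1. *)
pose e : R := (10 ^+ n)^-1.
have e0 : 0 < e by rewrite invr_gt0 exprn_gt0.
rewrite -lte_fin -nsqE//; apply: (@lt_le_trans _ _ e%:E); first by rewrite lte_fin.
have -> : e%:E = (\int[@planar_measure R]_(p in @half_plane R) (e * \1_B p)%:E)%E.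
  rewrite (ge0_integralZlR (@planar_measure R) mD) ?integral_indic//; last exact: ltW.
  rewrite setIidl// [X in (_ * X)%E](_ : _ = 1%E) ?mule1//.
  rewrite /= /planar_measure /B product_measure1E; [|exact: measurable_itv|exact: measurable_itv].
  rewrite /= !lebesgue_measure_itv /= !lte_fin ltr01 ltr1n -!EFinB -!EFinM.
  by congr EFin; ring.
apply: ge0_le_integral => //.
- by move=> p _; rewrite lee_fin mulr_ge0// ltW.
- apply: measurable_funTS; apply/measurable_EFinP; apply: measurable_funM => //.
- by apply: measurable_funTS; apply/measurable_EFinP; exact: borel_sqn.
move=> [y x] /half_planeP /= x0; rewrite lee_fin indicE.
case: (boolP ((y, x) \in B)) => [|_]; last first.
  by rewrite mulr0; exact: sqn_integrand_ge0.
rewrite inE /B /= !in_itv /= => -[/andP[y0 y1] /andP[x1 x2]].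
rewrite mulr1 kernel1E// normcV normcX exprVn -exprM mulnC exprM normc_sqr.
rewrite /wt /= gtr0_norm// addr0.
rewrite -[leLHS]mul1r; apply: ler_pM => //; first exact: ltW.
  by rewrite exprn_ege1.
have q0 : 0 < (x + 1) ^+ 2 + y ^+ 2 by have := sqr_ge0 y; nra.
rewrite /e lef_pV2 ?posrE ?exprn_gt0//.
by apply: lerXn2r; rewrite ?nnegrE//; [lra|nra].
Qed.

End kernel.

(** * The reproducing formula at the point 1 *)

Section reproducing.
Variables (R : realType) (l : nat).
Local Notation C := R[i].
Local Notation n := (l + 2)%N.
Local Notation leb := (@lebesgue_measure R).
Local Notation TR := (measurableTypeR R).
Local Notation kernel := (@kernel R l).
Local Notation hip := (hip l).
Local Notation nsq := (nsq l).

(** The density |k_1|^2 of the weighted measure. The integrand of the inner product of h with k_1 is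
    nu Q, where Q z = h z (z + 1)^n is analytic, so the mean value property applies to Q. *)
Let nu (z : C) : R := wt l z * (normc (z + 1) ^+ n ^+ 2)^-1.

Let Re_ratio (z : C) : 0 < Re z ->
  Re z / normc (z + 1) ^+ 2 = (1 - normc (cayley_inv z) ^+ 2) / 4.
Proof.
move=> z0; have z1 := Cplus_add1_neq0 z0.
rewrite normcM normcV exprMn exprVn.
have : normc (z + 1) ^+ 2 != 0 by rewrite expf_neq0// normc_eq0.
rewrite !normc_sqr !RecD !ImcD /=; move: (Re z) (Im z) => x y.
by rewrite subr0 addr0 => d0; field.
Qed.

Let nu_ratio (z : C) : 0 < Re z ->
  nu z * Re z ^+ 2 = (Re z / normc (z + 1) ^+ 2) ^+ n.
Proof.
move=> z0; rewrite /nu /wt gtr0_norm// expr_div_n -exprM mulnC exprM.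
by rewrite mulrAC -exprD.
Qed.

(** By [nu_ratio] and [Re_ratio], [nu z * Re z ^+ 2] depends only on |cayley_inv z|, which rotations
    preserve; [rotJ] is the ratio of the squared real parts. *)
Let nu_rot (t : R) (z : C) : 0 < Re z -> nu (rot t z) * rotJ t z = nu z.
Proof.
move=> z0; have r0 := rot_gt0 t z0.
rewrite /rotJ expr_div_n mulrA nu_ratio// Re_ratio//.
have -> : normc (cayley_inv (rot t z)) = normc (cayley_inv z).
  set v := cayley_inv z * cexp2 0 (2 * t).
  have v1 : normc v < 1 by rewrite normcM normc_cexp2 expR0 mulr1 normc_cayley_inv.
  have -> : cayley_inv (rot t z) = v.
    have d1 := disc_neq1 v1; rewrite /rot -/v /cayley /cayley_inv.
    have two0 : (2%:R : C) != 0 by rewrite pnatr_eq0.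
    have -> : (1 + v) / (1 - v) - 1 = 2%:R * v / (1 - v) by field.
    have -> : (1 + v) / (1 - v) + 1 = 2%:R / (1 - v) by field.
    by field; rewrite d1.
  by rewrite normcM normc_cexp2 expR0 mulr1.
by rewrite -Re_ratio// -nu_ratio// mulfK// expf_neq0// gt_eqF.
Qed.

Let nu_ge0 z : 0 <= nu z.
Proof. by rewrite mulr_ge0 ?wt_ge0// invr_ge0 sqr_ge0. Qed.

Let borel_nu : borelfun nu.
Proof.
apply: measurable_funM; first exact: borel_wt.
apply: measurable_invr; do 2 apply: measurable_funX.
exact: borelfun_normc (borel_shift 1).
Qed.

Let hint_nu : hint nu = (nsq (kernel 1))%:E.
Proof.
rewrite -nsqE; last exact: bergman_kernel1.
apply: eq_hint => z z0; rewrite kernel1E// /nu.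
by rewrite normcV normcX exprVn.
Qed.

(** Invariance makes the integral of nu (Q o rot t) independent of [t]. Integrating over [t] in
    [0, pi] and exchanging the integrals replaces Q by pi Q(1), with Q(1) = 2^n h(1), while the
    integral of nu is the squared norm of the kernel. *)
Lemma reproducing1 h : bergman l h ->
  hip h (kernel 1) = (2 ^+ n * nsq (kernel 1))%:C * h 1.
Proof.
move=> bh; have [ha h0 _] := bh; have mh := bergman_borel bh.
have bk := @bergman_kernel1 R l.
pose Q (z : C) := h z * (z + 1) ^+ n.
have mQ : cborel Q by apply: cmeasM mh _; apply: cmeasX; exact: borel_shift.
have Qa : analytic_on (@Cplus R) Q.
  have sa : analytic_on (@Cplus R) (fun z : C => (z + 1) ^+ n).
    by apply: (@analyticX _ _ (fun z => z + 1)); exact: analytic_shift.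
  rewrite /Q; exact: (@analyticM _ _ h (fun z => (z + 1) ^+ n) ha sa).
pose F (z : C) := (nu z)%:C * Q z.
have mnu : cborel (fun z => (nu z)%:C) by apply: cmeas_real; exact: borel_nu.
have mF : cborel F by exact: cmeasM mnu mQ.
have FE z : 0 < Re z -> hipf l h (kernel 1) z = F z.
  move=> z0; rewrite /hipf kernel1E// /F /nu /Q rmorphM -!mulrA; congr (_ * _).
  rewrite mulrCA; congr (_ * _).
  have d0 : (z + 1) ^+ n != 0 by rewrite expf_neq0// Cplus_add1_neq0.
  rewrite -normcX; move: ((z + 1) ^+ n) d0 => u u0.
  rewrite [X in _ = X * _](_ : _ = (u * u^*)^-1); last by rewrite mulc_conj fmorphV.
  have uc : u^* != 0 by rewrite -normc_gt0 normc_conj normc_gt0.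
  have -> : (u^-1)^* = (u^*)^-1 by rewrite fmorphV.
  by field; rewrite u0 uc.
have eF : hip h (kernel 1) = hcint F by exact: eq_hcint.
have Foo : (habs F < +oo)%E.
  by rewrite -(eq_habs FE); exact: habs_hip_lty.
have rotF t z : 0 < Re z ->
    F (rot t z) * (rotJ t z)%:C = (nu z)%:C * Q (rot t z).
  move=> z0; rewrite /F -(nu_rot t z0) (rmorphM (real_complex R) (nu _) (rotJ _ _)).
  exact: mulrAC.
pose G (p : TR * (TR * TR)) := (nu (cpt p.2))%:C * Q (rot p.1 (cpt p.2)).
have mG : cmeas G.
  apply: cmeasM; last exact: (cmeas_comp mQ (@cmeas_rot R)).
  apply: (cmeas_comp mnu); have [c1 c2] := @cmeas_cpt R.
  split; first exact: (measurableT_comp c1 measurable_snd).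
  exact: (measurableT_comp c2 measurable_snd).
have rotI t : hcint (fun z => (nu z)%:C * Q (rot t z)) = hcint F.
  rewrite -(eq_hcint (rotF t)); apply: hcint_subst mF.
  - exact: borel_rot.
  - exact: borel_rotJ.
  - by move=> z _; exact: rotJ_ge0.
  - exact: hsubst_rot.
have rotA t : habs (fun z => (nu z)%:C * Q (rot t z)) = habs F.
  rewrite -(eq_habs (rotF t)); apply: habs_subst mF.
    by move=> z _; exact: rotJ_ge0.
  exact: hsubst_rot.
have mI : measurable (`[0%R, pi]%classic : set TR) by exact: measurable_itv.
have mD := @measurable_half_plane R.
have aF : habs F = (fine (habs F))%:E.
  by rewrite fineK// ge0_fin_numE// hint_ge0// => z _; exact: normc_ge0.
have Goo : (\int[leb]_(t in `[0%R, pi]%classic)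
    \int[@planar_measure R]_(p in @half_plane R) (normc (G (t, p)))%:E < +oo)%E.
  have -> : (\int[leb]_(t in `[0%R, pi]%classic)
      \int[@planar_measure R]_(p in @half_plane R) (normc (G (t, p)))%:E =
      \int[leb]_(t in `[0%R, pi]%classic) (fine (habs F))%:E)%E.
    by apply: eq_integral => t _; rewrite -aF -(rotA t).
  rewrite integral_cst// [X in (_ * X)%E](_ : _ = pi%:E) -?EFinM ?ltry//.
  have := @lebesgue_measure_itv R `[0%R, pi]; rewrite /= lte_fin pi_gt0 -EFinB subr0.
  exact.
have := cint_fubini mI mD mG Goo.
have -> : cint leb `[0%R, pi]%classic (fun t =>
    cint (@planar_measure R) (@half_plane R) (fun p => G (t, p))) =
    hcint F * pi%:C.
  rewrite (eq_cint _ (G := fun=> hcint F)); last by move=> t _; exact: rotI.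
  by rewrite cint_cst// fine_lebesgue_itvcc ?pi_ge0// subr0.
have -> : cint (@planar_measure R) (@half_plane R) (fun p =>
    cint leb `[0%R, pi]%classic (fun t => G (t, p))) =
    hcint (fun z => Q 1 * pi%:C * (nu z)%:C).
  apply: eq_cint => p /half_planeP p0.
  have [iQ vQ] := mean_value Qa p0.
  transitivity ((nu (cpt p))%:C * cintI 0 pi (fun t => Q (rot t (cpt p)))).
    have E := cintZ ((nu (cpt p))%:C) mI iQ; rewrite /cintI; exact: E.
  by rewrite vQ mulrC.
have -> : hcint (fun z => Q 1 * pi%:C * (nu z)%:C) =
    Q 1 * pi%:C * (nsq (kernel 1))%:C.
  have inu : cintegrable (@planar_measure R) (@half_plane R) (fun p => (nu (cpt p))%:C).
    apply: cintegrable_lty => //.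
    rewrite (_ : integral _ _ _ = hint nu); first by rewrite hint_nu ltry.
    by apply: eq_integral => p _; rewrite normcR_ge0// nu_ge0.
  transitivity (Q 1 * pi%:C *
      cint (@planar_measure R) (@half_plane R) (fun p => (nu (cpt p))%:C)).
    have E := cintZ (Q 1 * pi%:C) mD inu; rewrite /hcint; exact: E.
  rewrite (@cint_real _ _ _ _ _ (fun p => nu (cpt p)))//.
  by congr (_ * (_)%:C); rewrite -[RHS]/(fine (nsq (kernel 1))%:E) -hint_nu.
rewrite eF; have pi0 : (pi%:C : C) != 0 by rewrite -normc_gt0 normcR_ge0 ?pi_gt0// pi_ge0.
rewrite -mulrA mulrCA mulrC => /(mulfI pi0) ->.
rewrite /Q (rmorphM (real_complex R) (2 ^+ n) (nsq (kernel 1))) /=.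
rewrite rmorphXn /= (_ : 2%:C = 1 + 1 :> C); last by apply: complex_ext => /=; ring.
by ring.
Qed.

End reproducing.

(** * Affine maps and the reproducing formula at every point *)

Section affine.
Variables (R : realType) (l : nat).
Local Notation C := R[i].
Local Notation n := (l + 2)%N.
Local Notation kernel := (@kernel R l).
Local Notation hip := (hip l).
Local Notation nsq := (nsq l).

Lemma hip0l (k : C -> C) : hip (fun=> 0) k = 0.
Proof.
have mD := @measurable_half_plane R.
rewrite /hip (_ : hcint _ = hcint (fun=> 0)).
  by rewrite /hcint cint_cst// mul0r.
by apply: (@eq_hcint _ (hipf l (fun=> 0) k) (fun=> 0)) => z _; rewrite /hipf mul0r mulr0.
Qed.

Lemma hipZl (a : C) h k : bergman l h -> bergman l k ->
  hip (fun z => a * h z) k = a * hip h k.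
Proof.
move=> bh bk; rewrite -[RHS]addr0 -(hip0l k) -(hip_comb a bh (bergman0 _ _) bk).
by apply: (@eq_hip R l) => // z _; rewrite addr0.
Qed.

Lemma hipZr (a : C) h k : bergman l h -> bergman l k ->
  hip h (fun z => a * k z) = a^* * hip h k.
Proof.
move=> bh bk; rewrite (hip_conj (bergmanZ a bk) bh) hipZl//.
by rewrite (hip_conj bk bh) rmorphM.
Qed.

Lemma hip_subst (T : C -> C) (J : C -> R) (h k H K : C -> C) :
  cborel T -> borelfun J -> (forall z, 0 < Re z -> 0 <= J z) -> hsubst T J ->
  cborel h -> cborel k ->
  (forall z, 0 < Re z ->
    (wt l (T z) * J z)%:C * (h (T z) * (k (T z))^*) = hipf l H K z) ->
  hip h k = hip H K.
Proof.
move=> mT mJ J0 hT mh mk E.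
rewrite /hip -(hcint_subst mT mJ J0 hT (borel_hip l mh mk)).
apply: eq_hcint => z z0; rewrite -E// /hipf rmorphM -!mulrA; congr (_ * _).
by rewrite mulrA mulrC.
Qed.

Definition aff (c t : R) (z : C) : C := c%:C * z + (0 +i* t).

Lemma Re_aff c t z : Re (aff c t z) = c * Re z.
Proof. by rewrite RecD RecM /=; ring. Qed.

Lemma aff_gt0 c t z : 0 < c -> 0 < Re z -> 0 < Re (aff c t z).
Proof. by move=> c0 z0; rewrite Re_aff mulr_gt0. Qed.

Lemma wt_aff c t z : 0 < c -> wt l (aff c t z) = c ^+ l * wt l z.
Proof. by move=> c0; rewrite /wt Re_aff normrM exprMn gtr0_norm. Qed.

Lemma hsubst_aff c t : 0 < c -> hsubst (aff c t) (fun=> c ^+ 2).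
Proof.
move=> c0; apply: (@eq_hsubst _ _ _ (fun=> 1 * c ^+ 2) (fun=> c ^+ 2)
  (fun z _ => erefl (aff c t z))).
  by move=> z _; rewrite mul1r.
exact: (hsubst_comp (borel_shift _) (borelfun_cst _) (fun _ => ler01)
  (hsubst_scale c0) (hsubst_imag t)).
Qed.

Lemma borel_aff c t : cborel (aff c t).
Proof. by apply: cmeasD; [exact: borel_scale|exact: cmeas_cst]. Qed.

Lemma analytic_scale (U : set C) (a : C) : analytic_on U (fun z => a * z).
Proof.
by apply: (@analyticM _ _ (fun=> a) id); [exact: analytic_cst|exact: analytic_id].
Qed.

Lemma bergman_aff c t (m : C) h : 0 < c -> bergman l h ->
  bergman l (extend0 (fun z => m * h (aff c t z))) /\
  nsq (extend0 (fun z => m * h (aff c t z))) <=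
    normc m ^+ 2 * (c ^+ n)^-1 * nsq h.
Proof.
move=> c0 bh.
apply: (@bergman_wcomp R l (fun=> m) (aff c t) (fun=> c ^+ 2)) => //.
- by move=> z; exact: aff_gt0.
- exact: borel_aff.
- exact: borelfun_cst.
- by move=> *; exact: sqr_ge0.
- exact: hsubst_aff.
- by rewrite mulr_ge0 ?sqr_ge0// invr_ge0 exprn_ge0// ltW.
move=> z z0; rewrite wt_aff// le_eqVlt; apply/orP; left; apply/eqP.
by rewrite exprD; field; rewrite !gt_eqF// exprn_gt0.
Qed.

Lemma hip_aff c t h k : 0 < c -> bergman l h -> bergman l k ->
  hip h k = (c ^+ n)%:C *
    hip (extend0 (fun z => 1 * h (aff c t z))) (extend0 (fun z => 1 * k (aff c t z))).
Proof.
move=> c0 bh bk.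
have [bH _] := bergman_aff t 1 c0 bh; have [bK _] := bergman_aff t 1 c0 bk.
rewrite -(hipZl _ bH bK).
apply: (hip_subst (borel_aff c t) (borelfun_cst (c ^+ 2)) _ (hsubst_aff t c0)
  (bergman_borel bh) (bergman_borel bk)).
  by move=> *; exact: sqr_ge0.
move=> z z0; rewrite /hipf !extend0E// wt_aff// !mul1r exprD !rmorphM.
by ring.
Qed.

Lemma kernelE (w z : C) : 0 < Re z -> kernel w z = ((z + w^*) ^+ n)^-1.
Proof. by move=> z0; rewrite /kernel extend0E. Qed.

Lemma kernel_aff (w : C) : 0 < Re w ->
  kernel w = extend0 (fun z => ((Re w ^+ n)^-1)%:C *
    kernel 1 (aff (Re w)^-1 (- (Im w / Re w)) z)).
Proof.
move=> w0; apply/funext => z; rewrite /extend0; case: ifP => z0; last first.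
  by rewrite /kernel /extend0 z0.
have aV : 0 < (Re w)^-1 by rewrite invr_gt0.
rewrite kernelE// kernel1E ?aff_gt0// fmorphV rmorphXn -invfM -exprMn.
rewrite /aff; move: w0 => /gt_eqF w0.
by congr (_ ^+ n)^-1; apply: complex_ext;
  rewrite !(RecD, ImcD, RecM, ImcM, RecJ, ImcJ) /=; field; rewrite w0.
Qed.

Lemma bergman_kernel w : 0 < Re w -> bergman l (kernel w) /\
  nsq (kernel w) <= (Re w ^+ n)^-1 * nsq (kernel 1).
Proof.
move=> w0; have aV : 0 < (Re w)^-1 by rewrite invr_gt0.
have [b1 b2] := bergman_aff (- (Im w / Re w)) ((Re w ^+ n)^-1)%:C aV (bergman_kernel1 R l).
rewrite -kernel_aff// in b1 b2; split=> //; apply: le_trans b2 _.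
have wn : 0 < Re w ^+ n by rewrite exprn_gt0.
rewrite ler_wpM2r ?nsq_ge0// normcR_ge0; last by rewrite invr_ge0 ltW.
rewrite [(Re w)^-1 ^+ n]exprVn invrK expr2.
by rewrite mulfVK // gt_eqF.
Qed.

Definition rep_cst : R := 2 ^+ n * nsq (kernel 1).

Lemma rep_cst_gt0 : 0 < rep_cst.
Proof. by rewrite mulr_gt0 ?exprn_gt0// nsq_kernel1_gt0. Qed.

(** The affine map z |-> Re w z + i Im w takes 1 to [w], and composing the kernel at [w] with it
    gives a multiple of the kernel at 1. *)
Lemma reproducing h w : bergman l h -> 0 < Re w ->
  hip h (kernel w) = rep_cst%:C * h w.
Proof.
move=> bh w0; have [bk _] := bergman_kernel w0.
have [bH _] := bergman_aff (Im w) 1 w0 bh.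
rewrite (hip_aff (Im w) w0 bh bk).
have -> : extend0 (fun z => 1 * kernel w (aff (Re w) (Im w) z)) =
    (fun z => ((Re w ^+ n)^-1)%:C * kernel 1 z).
  apply/funext => z; rewrite /extend0; case: ifP => z0; last first.
    by rewrite /kernel /extend0 z0 mulr0.
  rewrite mul1r kernelE ?aff_gt0// kernel1E// fmorphV rmorphXn -invfM -exprMn.
  rewrite /aff; congr (_ ^+ n)^-1; apply: complex_ext;
    rewrite !(RecD, ImcD, RecM, ImcM, RecJ, ImcJ) /=; ring.
have bZ := bergmanZ ((Re w ^+ n)^-1)%:C (bergman_kernel1 R l).
have b1 := bergman_kernel1 R l.
set H := extend0 _ in bH *.
rewrite (hipZr _ bH b1) reproducing1// /H extend0E; last exact: ltr01.
have e : (Re w ^+ n)%:C * ((Re w ^- n)%:C)^* = 1.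
  rewrite conjc_real; apply: complex_ext => /=; last by ring.
  by field; rewrite expf_neq0// gt_eqF.
rewrite [LHS]mulrA -[RHS]mul1r; congr (_ * _); first exact: e.
rewrite mul1r; congr (_ * h _).
by rewrite /aff; apply: complex_ext; rewrite !(RecD, ImcD, RecM, ImcM) /=; ring.
Qed.

End affine.

(** * Bounded operators with explicit adjoints *)

Section adjoint_pairs.
Variables (R : realType) (l : nat).
Local Notation C := R[i].
Local Notation n := (l + 2)%N.
Local Notation kernel := (@kernel R l).
Local Notation hip := (hip l).
Local Notation nsq := (nsq l).
Local Notation bergman := (@bergman R l).
Local Notation rep_cst := (rep_cst R l).
Implicit Types (A B : (C -> C) -> (C -> C)) (h k : C -> C).

(** Point evaluation at [w] is controlled by the norm of the kernel at [w], which decreases with Re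
    w. This supplies the bound that the Poisson formula asks for on a half-plane shifted to the
    right. *)
Lemma bergman_bounded h (x0 : R) : bergman h -> 0 < x0 ->
  exists M, forall w, x0 <= Re w -> normc (h w) <= M.
Proof.
move=> bh x00; have r0 : 0 < rep_cst by exact: rep_cst_gt0.
exists (2 * Num.sqrt (nsq h * ((x0 ^+ n)^-1 * nsq (kernel 1))) / rep_cst) => w xw.
have w0 : 0 < Re w by exact: lt_le_trans xw.
have [bk bk2] := bergman_kernel l w0.
rewrite ler_pdivlMr// mulrC -{1}(@normcR_ge0 R rep_cst) ?(ltW r0)// -normcM -(reproducing bh w0).
apply: le_trans (hip_cs bh bk) _.
rewrite ler_wpM2l// ler_sqrt; last by rewrite !mulr_ge0 ?nsq_ge0// invr_ge0 exprn_ge0// ltW.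
rewrite ler_wpM2l ?nsq_ge0//; apply: le_trans bk2 _.
rewrite ler_wpM2r ?nsq_ge0// lef_pV2 ?posrE ?exprn_gt0//.
by apply: lerXn2r; rewrite ?nnegrE// ltW.
Qed.

(** Operators on the whole space, with the adjoint kept in closed form: pairs compose, and the
    second member can be compared with a conjugate by C_star. *)
Definition adjpair A B := [/\
  exists2 K, 0 <= K & forall h, bergman h -> bergman (A h) /\ nsq (A h) <= K * nsq h,
  forall k, bergman k -> bergman (B k)
  & forall h k, bergman h -> bergman k -> hip (A h) k = hip h (B k)].

Lemma adjpair_comp A A' B B' : adjpair A A' -> adjpair B B' ->
  adjpair (fun h => A (B h)) (fun k => B' (A' k)).
Proof.
move=> [[K K0 hK] hA' hA] [[L L0 hL] hB' hB]; split.
- exists (K * L) => [|h bh]; first exact: mulr_ge0.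
  have [b1 b2] := hL h bh; have [b3 b4] := hK _ b1; split; first exact: b3.
  by apply: le_trans b4 _; rewrite -mulrA ler_wpM2l.
- by move=> k bk; apply/hB'/hA'.
- move=> h k bh bk; have [b1 _] := hL h bh.
  by rewrite (hA _ _ b1 bk) (hB _ _ bh (hA' _ bk)).
Qed.

Lemma eq_adjpair A A' B B' : (forall h, bergman h -> A h = A' h) ->
  (forall h, bergman h -> B h = B' h) -> adjpair A B -> adjpair A' B'.
Proof.
move=> eA eB [[K K0 hK] hB hAB]; split.
- exists K => [|h bh]; first exact: K0.
  by rewrite -(eA _ bh); exact: hK.
- by move=> k bk; rewrite -(eB _ bk); exact: hB.
- by move=> h k bh bk; rewrite -(eA _ bh) -(eB _ bk); exact: hAB.
Qed.

Lemma nsqZ (a : C) h : bergman h -> nsq (fun z => a * h z) = normc a ^+ 2 * nsq h.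
Proof.
move=> bh; apply/eqP; rewrite -eqe EFinM -(nsqE bh) -(nsqE (bergmanZ a bh)).
apply/eqP; rewrite /sqn /hint -(ge0_integralZlR (@planar_measure R)).
- by apply: eq_integral => p _; rewrite normcM exprMn mulrCA.
- exact: measurable_half_plane.
- exact: borel_sqn (bergman_borel bh).
- by move=> p _; exact: sqn_integrand_ge0.
- exact: sqr_ge0.
Qed.

Lemma adjpair_scalar (a : C) :
  adjpair (fun h z => a * h z) (fun k z => a^* * k z).
Proof.
split.
- exists (normc a ^+ 2) => [|h bh]; first exact: sqr_ge0.
  by split; [exact: bergmanZ|rewrite nsqZ].
- by move=> k bk; exact: bergmanZ.
- by move=> h k bh bk; rewrite (hipZl _ bh bk) (hipZr _ bh bk) conjcK.
Qed.

Definition shiftop (a : C) h := extend0 (fun z => h (z + a)).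

Definition scaleop (c : R) h := extend0 (fun z => h (c%:C * z)).

Definition invop h := extend0 (fun z => (z ^+ n)^-1 * h (1 / z)).

Lemma scaleopE c h : 0 < c -> scaleop c h = extend0 (fun z => 1 * h (aff c 0 z)).
Proof.
move=> c0; apply/funext => z; rewrite /scaleop /extend0; case: ifP => // _.
by rewrite mul1r /aff (_ : 0 +i* 0 = 0) ?addr0.
Qed.

Lemma shiftopE (t : R) h : shiftop (0 +i* t) h = extend0 (fun z => 1 * h (aff 1 t z)).
Proof.
apply/funext => z; rewrite /shiftop /extend0; case: ifP => // _.
by rewrite mul1r /aff mul1r.
Qed.

Lemma adjpair_scale (c : R) : 0 < c ->
  adjpair (scaleop c) (fun k z => ((c ^+ n)^-1)%:C * scaleop c^-1 k z).
Proof.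
move=> c0; have cV : 0 < c^-1 by rewrite invr_gt0.
have bS d h : 0 < d -> bergman h -> bergman (scaleop d h) /\
    nsq (scaleop d h) <= (d ^+ n)^-1 * nsq h.
  move=> d0 bh; rewrite (scaleopE _ d0); have [b1 b2] := bergman_aff 0 1 d0 bh.
  split; first exact: b1.
  by rewrite ComplexField.Normc.normc1 expr1n mul1r in b2.
split.
- exists ((c ^+ n)^-1) => [|h bh]; last exact: bS.
  by rewrite invr_ge0 exprn_ge0// ltW.
- by move=> k bk; apply: bergmanZ; have [] := bS _ _ cV bk.
move=> h k bh bk; have [bk1 _] := bS _ _ cV bk; have [bh1 _] := bS _ _ c0 bh.
rewrite (hipZr _ bh bk1) (hip_aff 0 c0 bh bk1) mulrA -!scaleopE//.
have -> : scaleop c (scaleop c^-1 k) = k.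
  apply/funext => z; rewrite /scaleop /extend0; case: ifP => z0; last first.
    by have [_ -> //] := bk; rewrite /Cplus /= z0.
  rewrite RecM /= mul0r subr0 mulr_gt0//.
  congr k; apply: complex_ext; rewrite !(RecM, ImcM) /=; field; exact: lt0r_neq0.
rewrite (_ : _ * (c ^+ n)%:C = 1) ?mul1r// conjc_real.
apply: complex_ext => /=; last by ring.
by field; rewrite expf_neq0// gt_eqF.
Qed.

Lemma bergman_imag (t : R) h : bergman h -> bergman (shiftop (0 +i* t) h) /\
  nsq (shiftop (0 +i* t) h) <= nsq h.
Proof.
move=> bh; rewrite shiftopE; have [b1 b2] := bergman_aff t 1 ltr01 bh.
split; first exact: b1.
by rewrite ComplexField.Normc.normc1 !expr1n invr1 !mul1r in b2.
Qed.

Lemma adjpair_imag (t : R) : adjpair (shiftop (0 +i* t)) (shiftop (0 +i* (- t))).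
Proof.
split.
- exists 1 => [|h bh]; first exact: ler01.
  rewrite mul1r; exact: bergman_imag.
- by move=> k bk; have [] := bergman_imag (- t) bk.
move=> h k bh bk; have [bk1 _] := bergman_imag (- t) bk.
rewrite (hip_aff t ltr01 bh bk1) -!shiftopE expr1n mul1r; congr (hip _ _).
apply/funext => z; rewrite /shiftop /extend0; case: ifP => z0; last first.
  by have [_ -> //] := bk; rewrite /Cplus /= z0.
rewrite RecD /= addr0 z0; congr k.
by apply: complex_ext; rewrite !(RecD, ImcD) /=; ring.
Qed.

Lemma Re_inv (z : C) : Re (1 / z) = Re z / normc z ^+ 2.
Proof. by rewrite mul1r RecV. Qed.

Lemma inv_gt0 (z : C) : 0 < Re z -> 0 < Re (1 / z).
Proof. by move=> z0; rewrite mul1r ReV_gt0. Qed.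

Lemma wt_inv (z : C) : 0 < Re z ->
  wt l (1 / z) * (normc z ^+ 4)^-1 = wt l z * (normc z ^+ n ^+ 2)^-1.
Proof.
move=> z0; rewrite /wt !gtr0_norm ?inv_gt0// Re_inv expr_div_n -mulrA; congr (_ * _).
by rewrite -!exprM -invfM -exprD mulnDl mulnC.
Qed.

Lemma analytic_inv : analytic_on (@Cplus R) (fun z => 1 / z).
Proof.
apply: (@analyticM _ _ (fun=> 1) (fun z => z^-1)); first exact: analytic_cst.
by apply: (@analyticV _ _ id) => [z|]; [exact: Re_neq0|exact: analytic_id].
Qed.

Lemma bergman_invop h : bergman h -> bergman (invop h) /\ nsq (invop h) <= 1 * nsq h.
Proof.
move=> bh.
apply: (@bergman_wcomp R l (fun z => (z ^+ n)^-1) (fun z => 1 / z)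
  (fun z => (normc z ^+ 4)^-1)) => //.
- apply: (@analyticV _ _ (fun z => z ^+ n)) => [z z0|]; first by rewrite expf_neq0// Re_neq0.
  by apply: (@analyticX _ _ id); exact: analytic_id.
- exact: analytic_inv.
- exact: inv_gt0.
- exact: borel_inv.
- exact: borel_invnorm.
- by move=> z _; exact: invnorm_ge0.
- exact: hsubst_inv.
by move=> z z0; rewrite mul1r wt_inv// normcV normcX exprVn.
Qed.

Lemma adjpair_inv : adjpair invop invop.
Proof.
split.
- by exists 1 => [|h]; [exact: ler01|exact: bergman_invop].
- by move=> k bk; have [] := bergman_invop bk.
move=> h k bh bk; have [bh1 _] := bergman_invop bh.
apply: (hip_subst (@borel_inv R) (borel_invnorm 4) _ (@hsubst_inv R)
  (bergman_borel bh1) (bergman_borel bk)).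
  by move=> z _; exact: invnorm_ge0.
move=> z z0; rewrite wt_inv// /invop /hipf !extend0E ?inv_gt0//.
have zn0 := Re_neq0 z0.
rewrite (_ : 1 / (1 / z) = z); last by rewrite !mul1r invrK.
rewrite mul1r exprVn invrK rmorphM -[LHS]mulrA; congr (_ * _).
rewrite -normcX; have : z ^+ n != 0 by rewrite expf_neq0.
move: (z ^+ n) (h z) (k z^-1) => u x y u0.
have uc : u^* != 0 by rewrite -normc_gt0 normc_conj normc_gt0.
rewrite [X in X * _](_ : _ = (u * u^*)^-1); last by rewrite mulc_conj fmorphV.
have -> : (u^-1 * y)^* = (u^*)^-1 * y^* by rewrite rmorphM fmorphV.
by field; rewrite u0 uc.
Qed.

End adjoint_pairs.

(** * Poisson averages and real translations *)

Section poisson.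
Variable R : realType.
Local Notation C := R[i].
Local Notation leb := (@lebesgue_measure R).
Local Notation TR := (measurableTypeR R).
Local Notation I := (`[0%R, pi]%classic : set TR).

Lemma Rintegral_limit (f_ : nat -> R -> R) (f : R -> R) (M v : R) :
  (forall m, measurable_fun [set: TR] (f_ m)) -> measurable_fun [set: TR] f ->
  (forall m t, `|f_ m t| <= M) ->
  (forall t, I t -> t != pi / 2 -> f_ ^~ t @ \oo --> f t) ->
  (forall m, Rintegral leb I (f_ m) = v) ->
  leb.-integrable I (fun t => (f t)%:E) /\ Rintegral leb I f = v.
Proof.
move=> mf_ mf fM ff fv; have mI : measurable I by exact: measurable_itv.
have iM : leb.-integrable I (fun _ => M%:E).
  apply: (@integrable_ge0 _ _ _ leb I (fun=> M)) => //.
    by move=> _; exact: le_trans (normr_ge0 _) (fM 0 0).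
  rewrite integral_cst// [X in (_ * X)%E](_ : _ = pi%:E) -?EFinM ?ltry//.
  have := @lebesgue_measure_itv R `[0%R, pi]; rewrite /= lte_fin pi_gt0 -EFinB subr0.
  exact.
have mE g : measurable_fun [set: TR] g -> measurable_fun I (fun t => (g t : R)%:E).
  by move=> mg; apply/measurable_EFinP/measurable_funTS.
have [|||i1 _ lim] := @dominated_convergence _ _ R leb I mI
  (fun m t => (f_ m t)%:E) (fun t => (f t)%:E) (fun=> M%:E)
  (fun m => mE _ (mf_ m)) (mE _ mf).
(* The single point pi / 2, where tan t is singular, is a null set. *)
- exists [set pi / 2]; split; [exact: measurable_set1|exact: lebesgue_measure_set1|].
  move=> t /= nt; apply: contrapT => /eqP tpi; apply: nt => It.
  by apply: cvg_EFin; [exact: nearW|exact: ff].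
- exact: iM.
- by apply: aeW => t m _; rewrite lee_fin.
split=> //; rewrite /Rintegral.
have E m : (\int[leb]_(t in I) (f_ m t)%:E = v%:E)%E.
  rewrite -(fv m) /Rintegral fineK//; apply: integrable_fin_num => //.
  apply: le_integrable iM => //; first exact: mE.
  by move=> t _ /=; rewrite lee_fin (le_trans (fM m t))// ler_norm.
have <- : v%:E = (\int[leb]_(t in I) (f t)%:E)%E; last by [].
apply: (@cvg_unique _ (@ereal_hausdorff R) _ _ _ _ _ lim).
rewrite (_ : [sequence _]_m = fun=> v%:E); first exact: cvg_cst.
by apply/funext => m; exact: E.
Qed.

(* The mean value property at rot t eps, which tends to - i tan t as eps -> 0. *)
Lemma poisson (F : C -> C) (M : R) : cborel F -> analytic_on (@Cplus R) F ->
  (forall x, exists a, cderiv F (0 +i* x) a) ->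
  (forall w, 0 <= Re w -> normc (F w) <= M) ->
  cintegrable leb I (fun t => F (0 +i* (- (sin t / cos t)))) /\
  cintI 0 pi (fun t => F (0 +i* (- (sin t / cos t)))) = F 1 * pi%:C.
Proof.
move=> mF aF dF FM.
pose eps m : R := m.+1%:R^-1.
have eps0 m : 0 < eps m by rewrite invr_gt0 ltr0n.
pose f_ m t := F (rot t (eps m)%:C).
pose f t := F (0 +i* (- (sin t / cos t))).
have mf_ m : cmeas (f_ m : TR -> C).
  have mp : measurable_fun [set: TR] (fun t : TR => (t, (0%R : TR, eps m : TR))).
    by apply: measurable_fun_pair; [exact: measurable_id|exact: measurable_cst].
  have [r1 r2] := @cmeas_rot R; apply: (@cmeas_comp R _ _ F) => //.
  by split; [exact: (measurableT_comp r1 mp)|exact: (measurableT_comp r2 mp)].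
have mt : measurable_fun [set: TR] (fun t => - (sin t / cos t) : R).
  apply: measurable_funN; apply: measurable_funM.
    by apply: continuous_measurable_fun; exact: continuous_sin.
  apply: measurable_invr.
  by apply: continuous_measurable_fun; exact: continuous_cos.
have mf : cmeas (f : TR -> C).
  by apply: (@cmeas_comp R _ _ F) => //; apply: cmeas_Complex mt; exact: measurable_cst.
have f_M m t : normc (f_ m t) <= M.
  by apply: FM; apply: ltW; apply: rot_gt0 => /=; exact: eps0.
have f_v m : cintI 0 pi (f_ m) = F 1 * pi%:C.
  by have [] := @mean_value _ F (eps m)%:C aF (eps0 m).
have lim t : I t -> t != pi / 2 -> forall e, 0 < e ->
    \forall m \near \oo, normc (f t - f_ m t) < e.
  rewrite /= in_itv /= => It tp e e0.
  have c0 : cos t != 0.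
    apply: contra tp => /eqP c0; apply/eqP; apply: cos_inj => //.
      by rewrite in_itv /=; have := @pi_gt0 R; lra.
    by rewrite cos_pihalf.
  have [a ha] := dF (- (sin t / cos t)); have [d d0 hd] := cderiv_cont ha e0.
  have c20 : 0 < cos t ^+ 2 by rewrite exprn_even_gt0.
  near=> m.
  rewrite normc_distC; apply: hd.
  (* The distance to the limit is eps / |cos t (cos t - i eps sin t)|, hence at most eps / (cos
     t)^2. *)
  have dif : rot t (eps m)%:C - (0 +i* (- (sin t / cos t))) =
      (eps m)%:C / ((cos t)%:C * ((cos t)%:C - (eps m)%:C * (sin t) *i)).
    have cc0 : (cos t)%:C != 0 :> C by rewrite -normc_gt0 normc_real normr_gt0.
    have dd0 : (cos t)%:C - (eps m)%:C * (sin t) *i != 0.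
      apply: contra c0 => /eqP /(congr1 (@complex.Re _)) /=.
      by rewrite !mul0r mulr0 subr0 subr0 => ->.
    rewrite rotE; last exact: eps0.
    apply: (mulIf dd0); apply: (mulfI cc0).
    rewrite mulrBl divfK// mulrBr.
    have -> : (cos t)%:C * ((eps m)%:C / ((cos t)%:C * ((cos t)%:C - (eps m)%:C * (sin t) *i)) *
      ((cos t)%:C - (eps m)%:C * (sin t) *i)) = (eps m)%:C.
      by field; rewrite cc0 dd0.
    apply: complex_ext; rewrite !(RecD, ImcD, RecN, ImcN, RecM, ImcM) /=.
      rewrite -[RHS]mulr1 -(cos2Dsin2 t); move: (cos t) c0 => x x0; field.
      exact: x0.
    by move: (cos t) c0 => x x0; field.
  rewrite dif normcM normcV normcM normcR_ge0; last exact: ltW.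
  have h1 : `|cos t| <= normc ((cos t)%:C - (eps m)%:C * (sin t) *i).
    apply: le_trans (ler_normRe _); rewrite /= !mul0r mulr0 !subr0//.
  rewrite normc_real; apply: (@le_lt_trans _ _ (eps m / cos t ^+ 2)).
    rewrite ler_wpM2l//; first exact: ltW.
    rewrite lef_pV2 ?posrE//.
      by rewrite -[leLHS]real_normK ?num_real// expr2 ler_wpM2l.
    by rewrite mulr_gt0 ?normr_gt0// (lt_le_trans _ h1)// normr_gt0.
  rewrite ltr_pdivrMr//; near: m.
  by apply: (near_infty_natSinv_lt (PosNum (mulr_gt0 d0 c20))).
have lim1 (p : C -> R) : (forall z, `|p z| <= normc z) -> (forall z w, p (z - w) = p z - p w) ->
    forall t, I t -> t != pi / 2 -> (fun m => p (f_ m t)) @ \oo --> p (f t).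
  move=> pn pB t It tp; apply/cvgrPdist_lt => e e0.
  near do rewrite -pB.
  have := lim t It tp e e0; apply: filterS => m; exact: le_lt_trans.
have ReB (z w : C) : Re (z - w) = Re z - Re w by rewrite RecD RecN.
have ImB (z w : C) : Im (z - w) = Im z - Im w by rewrite ImcD ImcN.
have [iR vR] := @Rintegral_limit (fun m t => Re (f_ m t)) (fun t => Re (f t)) M
  (Re (F 1 * pi%:C)) (fun m => (mf_ m).1) mf.1
  (fun m t => le_trans (ler_normRe _) (f_M m t))
  (lim1 (@complex.Re R) (@ler_normRe R) ReB)
  (fun m => congr1 (@complex.Re R) (f_v m)).
have [iI vI] := @Rintegral_limit (fun m t => Im (f_ m t)) (fun t => Im (f t)) M
  (Im (F 1 * pi%:C)) (fun m => (mf_ m).2) mf.2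
  (fun m t => le_trans (ler_normIm _) (f_M m t))
  (lim1 (@complex.Im R) (@ler_normIm R) ImB)
  (fun m => congr1 (@complex.Im R) (f_v m)).
by split; [split|apply: complex_ext].
Unshelve. all: by end_near. Qed.

End poisson.

(** * Adjoints of translations *)

Section real_shift.
Variables (R : realType) (l : nat).
Local Notation C := R[i].
Local Notation leb := (@lebesgue_measure R).
Local Notation TR := (measurableTypeR R).
Local Notation I := (`[0%R, pi]%classic : set TR).
Local Notation hip := (hip l).
Local Notation nsq := (nsq l).
Local Notation bergman := (@bergman R l).
Implicit Types (h k : C -> C).

(** Both arguments are families, so that the same exchange of integrals serves for averaging either
    one. *)
Lemma hip_average (u v : R -> C -> C) (M : R) :
  cmeas (fun p : TR * (TR * TR) => u p.1 (cpt p.2)) ->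
  cmeas (fun p : TR * (TR * TR) => v p.1 (cpt p.2)) ->
  (forall t, bergman (u t) /\ nsq (u t) <= M) ->
  (forall t, bergman (v t) /\ nsq (v t) <= M) ->
  cint leb I (fun t => hip (u t) (v t)) =
  hcint (fun z => cint leb I (fun t => hipf l (u t) (v t) z)).
Proof.
move=> mu mv bu bv.
have mI : measurable I by exact: measurable_itv.
have mD := @measurable_half_plane R.
pose G (p : TR * (TR * TR)) := hipf l (u p.1) (v p.1) (cpt p.2).
have mw : cmeas (fun p : TR * (TR * TR) => (wt l (cpt p.2))%:C).
  apply: (cmeas_comp (@cborel_wt R l)); have [c1 c2] := @cmeas_cpt R.
  split; first exact: (measurableT_comp c1 measurable_snd).
  exact: (measurableT_comp c2 measurable_snd).
have mG : cmeas G by apply: cmeasM mw _; apply: cmeasM mu _; exact: cmeas_conj.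
have M0 : 0 <= M by have [_] := bu 0; apply: le_trans; exact: nsq_ge0.
have aM t : (habs (hipf l (u t) (v t)) <= M%:E)%E.
  have [bu1 bu2] := bu t; have [bv1 bv2] := bv t.
  have := habs_hip bu1 bv1 ltr01; rewrite mul1r invr1 mul1r.
  have := habs_hip_lty bu1 bv1.
  have : (0 <= habs (hipf l (u t) (v t)))%E by apply: hint_ge0 => z _; exact: normc_ge0.
  case: (habs _) => [x||]// _ _; rewrite -EFinM !lee_fin; lra.
have Goo : (\int[leb]_(t in I)
    \int[@planar_measure R]_(p in @half_plane R) (normc (G (t, p)))%:E < +oo)%E.
  apply: (@le_lt_trans _ _ (\int[leb]_(t in I) M%:E)%E).
    apply: ge0_le_integral => //.
    - by move=> t _; apply: integral_ge0 => p _; rewrite lee_fin normc_ge0.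
    - apply: measurable_funTS.
      apply: (@measurable_partial_integral _ _ TR _ R (@planar_measure R) setT
        (@half_plane R) measurableT mD (fun p => normc (G p))) => //.
        exact: measurable_normc.
      by move=> p; exact: normc_ge0.
    - by move=> t _; exact: aM.
  rewrite integral_cst// [X in (_ * X)%E](_ : _ = pi%:E) -?EFinM ?ltry//.
  have := @lebesgue_measure_itv R `[0%R, pi]; rewrite /= lte_fin pi_gt0 -EFinB subr0.
  exact.
exact: (cint_fubini mI mD mG Goo).
Qed.

(** For [t] uniform on [0, pi] this height is Cauchy distributed with scale [c]: it is the Poisson
    kernel in trigonometric form. *)
Let tau (c t : R) := c * - (sin t / cos t).

Let measurable_tau c : measurable_fun [set: TR] (tau c).
Proof.
apply: measurable_funM; first exact: measurable_cst.
apply: measurable_funN; apply: measurable_funM.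
  by apply: continuous_measurable_fun; exact: continuous_sin.
apply: measurable_invr.
by apply: continuous_measurable_fun; exact: continuous_cos.
Qed.

Let poisson_aux h z (c : R) : bergman h -> 0 < Re z -> 0 < c ->
  let F w := h (z + c%:C * w) in
  [/\ cborel F, forall w, 0 <= Re w -> exists a, cderiv F w a
    & exists M, forall w, 0 <= Re w -> normc (F w) <= M].
Proof.
move=> bh z0 c0 F; have [ha _ _] := bh.
pose U : set C := [set w | 0 < Re (z + c%:C * w)].
have wU w : 0 <= Re w -> U w.
  by move=> w0; rewrite /U /= RecD RecM /= mul0r subr0 ltr_pwDl// mulr_ge0// ltW.
have aF : analytic_on U F.
  apply: (@analytic_comp _ U (@Cplus R) h (fun w => z + c%:C * w) _ ha); first by move=> w.
  apply: (@analyticD _ _ (fun=> z) (fun w => c%:C * w)); first exact: analytic_cst.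
  exact: analytic_scale.
split.
- apply: (cborel_comp (bergman_borel bh)).
  by apply: cmeasD; [exact: cmeas_cst|exact: borel_scale].
- by move=> w w0; apply/derivable_cderiv/aF/wU.
have [M hM] := bergman_bounded bh z0; exists M => w w0; apply: hM.
by rewrite RecD RecM /= mul0r subr0 lerDl mulr_ge0// ltW.
Qed.

Lemma poisson_shift h z (c : R) : bergman h -> 0 < Re z -> 0 < c ->
  cintegrable leb I (fun t => h (z + (0 +i* tau c t))) /\
  cint leb I (fun t => h (z + (0 +i* tau c t))) = h (z + c%:C) * pi%:C.
Proof.
move=> bh z0 c0; have [mF dF [M FM]] := poisson_aux bh z0 c0.
have aF : analytic_on (@Cplus R) (fun w => h (z + c%:C * w)).
  by move=> w w0; apply/derivable_cderiv/dF/ltW.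
have [|i1 i2] := @poisson R _ M mF aF _ FM; first by move=> x; apply: dF.
have E : (fun t => h (z + c%:C * (0 +i* - (sin t / cos t)))) =
    (fun t => h (z + (0 +i* tau c t))).
  by apply/funext => t; congr (h (_ + _)); apply: complex_ext; rewrite /tau /=; ring.
by rewrite E mulr1 in i1 i2; split.
Qed.

(** [poisson] for the reflected function. Reflection reverses the height, and the opposite translate
    is the one that the adjoint of an imaginary translation produces. *)
Lemma poisson_shift_conj h z (c : R) : bergman h -> 0 < Re z -> 0 < c ->
  cintegrable leb I (fun t => (h (z + (0 +i* - tau c t)))^*) /\
  cint leb I (fun t => (h (z + (0 +i* - tau c t)))^*) = (h (z + c%:C))^* * pi%:C.
Proof.
move=> bh z0 c0; have [mF dF [M FM]] := poisson_aux bh z0 c0.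
pose F (w : C) := (h (z + c%:C * w^*))^*.
have mF' : cborel F by apply: cmeas_conj; exact: (cborel_comp mF (@cborel_conj R)).
have dF' w : 0 <= Re w -> exists a, cderiv F w a.
  rewrite -RecJ => w0; have [a ha] := dF _ w0.
  by exists a^*; exact: (@cderiv_conj R (fun w => h (z + c%:C * w))).
have aF : analytic_on (@Cplus R) F.
  by move=> w w0; apply/derivable_cderiv/dF'/ltW.
have FM' w : 0 <= Re w -> normc (F w) <= M.
  by rewrite -RecJ => w0; rewrite normc_conj; exact: FM.
have [|i1 i2] := @poisson R F M mF' aF _ FM'; first by move=> x; apply: dF'.
have E : (fun t => F (0 +i* - (sin t / cos t))) =
    (fun t => (h (z + (0 +i* - tau c t)))^*).
  apply/funext => t; rewrite /F; congr ((h (_ + _))^*).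
  by apply: complex_ext; rewrite /tau /=; ring.
rewrite E in i1 i2; split=> //; rewrite -/(cintI 0 pi _) i2 /F.
by congr ((h (_ + _))^* * _); apply: complex_ext => /=; ring.
Qed.

Lemma shiftop_imagE (t : R) h : bergman h ->
  shiftop (0 +i* t) h = (fun z => h (z + (0 +i* t))).
Proof.
move=> [_ h0 _]; apply/funext => z; rewrite /shiftop /extend0; case: ifP => z0 //.
by rewrite h0// /Cplus /= RecD /= addr0 z0.
Qed.

Lemma bergman_realshift (c : R) h : 0 <= c -> bergman h ->
  bergman (shiftop c%:C h) /\ nsq (shiftop c%:C h) <= nsq h.
Proof.
move=> c0 bh; have [ha h0 _] := bh; have mh := bergman_borel bh.
have shift0 z : 0 < Re z -> 0 < Re (z + c%:C) by move=> z0; rewrite RecD /= ltr_pwDl.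
have Wa : analytic_on (@Cplus R) (shiftop c%:C h).
  apply: analytic_extend0.
  apply: (@analytic_comp _ (@Cplus R) (@Cplus R) h (fun z => z + c%:C) shift0 ha).
  exact: analytic_shift.
have mW := analytic_cborel Wa (@extend0_out _ _).
have le : (sqn l (shiftop c%:C h) <= sqn l h)%E.
  apply: le_trans (hint_real_shift_le c0 (borel_sqn l mh) (sqn_integrand_ge0 l h)).
  apply: le_hint => //.
  - exact: borel_sqn.
  - exact: (borelfun_comp (borel_sqn l mh) (borel_shift _)).
  move=> z z0; rewrite sqn_integrand_ge0 /shiftop extend0E//= ler_wpM2r ?sqr_ge0//.
  rewrite /wt !gtr0_norm ?shift0//; apply: lerXn2r.
  - by rewrite nnegrE ltW.
  - by rewrite nnegrE ltW// shift0.
  by rewrite RecD /= lerDl.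
have bW : bergman (shiftop c%:C h).
  apply/bergmanP; split; [exact: Wa|exact: extend0_out|].
  exact: le_lt_trans le (bergman_sqn_lty bh).
by split; [exact: bW|rewrite -lee_fin -(nsqE bW) -(nsqE bh)].
Qed.

(** Multiplied by pi, either side is an integral over [t] of inner products with an imaginary
    translate, by [tau c t] in the first argument or by [- tau c t] in the second; these agree for
    each [t]. *)
Lemma adjpair_realshift (c : R) : 0 < c -> adjpair l (shiftop c%:C) (shiftop c%:C).
Proof.
move=> c0; split.
- exists 1 => [|h bh]; first exact: ler01.
  by rewrite mul1r; exact: bergman_realshift (ltW c0) bh.
- by move=> k bk; have [] := bergman_realshift (ltW c0) bk.
move=> h k bh bk; have [bTh _] := bergman_realshift (ltW c0) bh.
have [bTk _] := bergman_realshift (ltW c0) bk.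
pose u t z := h (z + (0 +i* tau c t)); pose v t z := k (z + (0 +i* - tau c t)).
have uE t : u t = shiftop (0 +i* tau c t) h by rewrite shiftop_imagE.
have vE t : v t = shiftop (0 +i* - tau c t) k by rewrite shiftop_imagE.
have mc : cmeas (fun p : TR * (TR * TR) => cpt p.2).
  have [c1 c2] := @cmeas_cpt R.
  split; first exact: (measurableT_comp c1 measurable_snd).
  exact: (measurableT_comp c2 measurable_snd).
have mtau := measurableT_comp (measurable_tau c) (@measurable_fst _ _ TR (TR * TR)%type).
have mu : cmeas (fun p : TR * (TR * TR) => u p.1 (cpt p.2)).
  apply: (cmeas_comp (bergman_borel bh)); apply: cmeasD mc _.
  by apply: cmeas_Complex; [exact: measurable_cst|exact: mtau].
have mv : cmeas (fun p : TR * (TR * TR) => v p.1 (cpt p.2)).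
  apply: (cmeas_comp (bergman_borel bk)); apply: cmeasD mc _.
  by apply: cmeas_Complex; [exact: measurable_cst|exact: measurable_funN].
pose M := nsq h + nsq k; have h0 := nsq_ge0 l h; have k0 := nsq_ge0 l k.
have bu t : bergman (u t) /\ nsq (u t) <= M.
  by rewrite uE; have [b1 b2] := bergman_imag (tau c t) bh; split; [exact: b1|rewrite /M; lra].
have bv t : bergman (v t) /\ nsq (v t) <= M.
  by rewrite vE; have [b1 b2] := bergman_imag (- tau c t) bk; split; [exact: b1|rewrite /M; lra].
have bh' : bergman h /\ nsq h <= M by split; [exact: bh|rewrite /M; lra].
have bk' : bergman k /\ nsq k <= M by split; [exact: bk|rewrite /M; lra].
have mh' : cmeas (fun p : TR * (TR * TR) => h (cpt p.2)) by exact: (cmeas_comp (bergman_borel bh)).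
have mk' : cmeas (fun p : TR * (TR * TR) => k (cpt p.2)) by exact: (cmeas_comp (bergman_borel bk)).
have A := @hip_average u (fun=> k) M mu mk' bu (fun=> bk').
have B := @hip_average (fun=> h) v M mh' mv (fun=> bh') bv.
have mI : measurable I by exact: measurable_itv.
have pi0 : (pi%:C : C) != 0 by rewrite -normc_gt0 normcR_ge0 ?pi_gt0// pi_ge0.
have hcZ x y : bergman x -> bergman y ->
    hcint (fun z => pi%:C * hipf l x y z) = pi%:C * hip x y.
  move=> bx bY; have E := cintZ (pi%:C) (@measurable_half_plane R) (hip_integrable bx bY).
  by rewrite /hip /hcint; exact: E.
apply: (mulfI pi0); rewrite -(hcZ _ _ bTh bk) -(hcZ _ _ bh bTk).
have <- : cint leb I (fun t => hip (u t) k) = hcint (fun z => pi%:C * hipf l (shiftop c%:C h) k z).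
  rewrite A; apply: eq_hcint => z z0.
  have [i1 i2] := poisson_shift bh z0 c0.
  have E := cintZ ((wt l z)%:C * (k z)^*) mI i1.
  transitivity (cint leb I (fun t => (wt l z)%:C * (k z)^* * h (z + (0 +i* tau c t)))).
    by apply: eq_cint => t _; rewrite /hipf /u -mulrA; congr (_ * _); exact: mulrC.
  rewrite E i2 /hipf /shiftop extend0E//.
  by move: (wt l z)%:C (h _) (k z)^* (pi%:C) => a b d e; ring.
have <- : cint leb I (fun t => hip h (v t)) = hcint (fun z => pi%:C * hipf l h (shiftop c%:C k) z).
  rewrite B; apply: eq_hcint => z z0.
  have [i1 i2] := poisson_shift_conj bk z0 c0.
  have E := cintZ ((wt l z)%:C * h z) mI i1.
  transitivity (cint leb I (fun t => (wt l z)%:C * h z * (k (z + (0 +i* - tau c t)))^*)).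
    by apply: eq_cint => t _; rewrite /hipf /v mulrA.
  rewrite E i2 /hipf /shiftop extend0E//.
  by move: (wt l z)%:C (h _) (k _)^* (pi%:C) => a b d e; ring.
apply: eq_cint => t _; rewrite uE vE; have [_ _ adj] := adjpair_imag l (tau c t).
exact: adj.
Qed.

Lemma adjpair_shift (a : C) : 0 <= Re a -> adjpair l (shiftop a) (shiftop a^*).
Proof.
rewrite le_eqVlt => /orP[/eqP a0|a0].
  have -> : a = 0 +i* Im a by apply: complex_ext.
  have -> : (0 +i* Im a)^* = 0 +i* - Im a by [].
  exact: adjpair_imag.
have comp (b : R) h : bergman h ->
    shiftop (Re a)%:C (shiftop (0 +i* b) h) = shiftop (Re a +i* b) h.
  move=> bh; apply/funext => z; rewrite shiftop_imagE// /shiftop /extend0.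
  by case: ifP => // _; congr (h _); apply: complex_ext; rewrite !(RecD, ImcD) /=; ring.
have comp' (b : R) h : bergman h ->
    shiftop (0 +i* b) (shiftop (Re a)%:C h) = shiftop (Re a +i* b) h.
  move=> bh; apply/funext => z; rewrite /shiftop /extend0; case: ifP => // z0.
  rewrite RecD /= addr0 z0.
  by congr (h _); apply: complex_ext; rewrite !(RecD, ImcD) /=; ring.
apply: eq_adjpair (adjpair_comp (adjpair_realshift a0) (adjpair_imag l (Im a))) => h bh.
  by rewrite comp// -ReImE.
by rewrite (comp' _ _ bh); congr (shiftop _ h); apply: complex_ext; rewrite ?RecJ ?ImcJ.
Qed.

End real_shift.

(** * The conjugation *)

Section conjugation.
Variables (R : realType) (l : nat).
Local Notation C := R[i].
Local Notation n := (l + 2)%N.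
Local Notation bergman := (@bergman R l).
Local Notation Cs := (@Cstar R l).
Implicit Types (h k : C -> C).

Definition conjop h (z : C) : C := (h z^*)^*.

Lemma wt_conj (z : C) : wt l z^* = wt l z.
Proof. by rewrite /wt RecJ. Qed.

Lemma bergman_conjop h : bergman h -> bergman (conjop h).
Proof.
move=> bh; have [ha h0 _] := bh; have mh := bergman_borel bh.
apply/bergmanP; split; first exact: analytic_conj.
  move=> z z0; rewrite /conjop h0 ?conjc0//.
  by rewrite /Cplus /= RecJ.
have -> : sqn l (conjop h) = sqn l h; last exact: bergman_sqn_lty bh.
rewrite /sqn -[RHS](hint_conj (borel_sqn l mh) (sqn_integrand_ge0 l h)).
by apply: eq_hint => z _; rewrite wt_conj /conjop normc_conj.
Qed.

Lemma CstarE h : Cs h = invop l (conjop h).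
Proof.
apply/funext => z; rewrite /Cstar /invop /extend0; case: ifP => // _.
rewrite [X in X * _ = _]mul1r; congr (_ * _); congr (h _)^*.
by rewrite !mul1r fmorphV.
Qed.

Lemma bergman_Cstar h : bergman h -> bergman (Cs h).
Proof.
by move=> bh; rewrite CstarE; have [] := bergman_invop (bergman_conjop bh).
Qed.

Lemma Cstarv h z : 0 < Re z -> Cs h z = (z ^+ n)^-1 * (h (1 / z^*))^*.
Proof. by move=> z0; rewrite /Cstar extend0E// div1r. Qed.

Lemma invconjK (z : C) : 1 / (1 / z^*)^* = z.
Proof.
have -> : (1 / z^*)^* = 1 / z by rewrite !mul1r fmorphV /= conjcK.
by rewrite !mul1r invrK.
Qed.

Lemma CstarK h : (forall z, ~ Cplus z -> h z = 0) -> Cs (Cs h) = h.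
Proof.
move=> h0; apply/funext => z; have [z0|z0] := boolP (0 < Re z); last first.
  by rewrite [LHS]extend0_out ?h0//; exact/negP.
rewrite Cstarv// Cstarv ?ReVJ_gt0// invconjK.
rewrite rmorphM /= conjcK mulrA; have zn0 := Re_neq0 z0.
rewrite div1r exprVn invrK rmorphXn /= conjcK mulVf ?mul1r//.
by rewrite expf_neq0.
Qed.

Lemma bergmanCK h : bergman h -> Cs (Cs h) = h.
Proof. by case=> _ h0 _; exact: CstarK. Qed.

Definition wop (f g : C -> C) h := extend0 (fun z => f z * h (g z)).

(** The conjugate of a weighted composition by C_star is again one, so comparing it with an adjoint
    reduces to comparing symbols. *)
Lemma Cstar_wop (f g : C -> C) k z : 0 < Re z -> 0 < Re (g (1 / z^*)) ->
  Cs (wop f g (Cs k)) z =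
  (f (1 / z^*))^* * ((z * (g (1 / z^*))^*) ^+ n)^-1 * k (1 / (g (1 / z^*))^*).
Proof.
move=> z0 g0; rewrite Cstarv// /wop extend0E ?ReVJ_gt0// Cstarv//.
rewrite !rmorphM /= conjcK fmorphV rmorphXn /= exprMn invfM.
by move: (k _) (f _)^* => x y; ring.
Qed.

End conjugation.

(** * Sufficiency *)

Section moebius_operators.
Variables (R : realType) (l : nat).
Local Notation C := R[i].
Local Notation n := (l + 2)%N.
Implicit Types (h k : C -> C).

Lemma extend0_eq (F G : C -> C) : (forall z, 0 < Re z -> F z = G z) ->
  extend0 F = extend0 G.
Proof. by move=> e; apply/funext => z; rewrite /extend0; case: ifP => // /e. Qed.

Lemma eq_extend0 (F G : C -> C) : (forall z, 0 < Re z -> F z = G z) ->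
  (forall z, ~ Cplus z -> F z = 0) -> F = extend0 G.
Proof.
move=> e e0; apply/funext => z; rewrite /extend0; case: ifP => [/e//|z0].
by apply: e0; rewrite /Cplus /= z0.
Qed.

Lemma mulr_out (a : C) F : (forall z : C, ~ Cplus z -> F z = 0) ->
  forall z, ~ Cplus z -> a * F z = 0.
Proof. by move=> F0 z /F0 ->; rewrite mulr0. Qed.

(** The symbols of case (iii) in matrix form (see [mob_value]). Conjugation by C_star, like the
    adjoint, exchanges [delta] and [kappa] and conjugates all parameters. *)
Definition mobop (delta kappa r : C) : (C -> C) -> C -> C :=
  wop (fun z => r / (z + kappa) ^+ n) (fun z => (delta * z + 1) / (z + kappa)).

Lemma shift_neq0 (z a : C) : 0 < Re z -> 0 <= Re a -> z + a != 0.
Proof. by move=> z0 a0; apply: Re_neq0; rewrite RecD ltr_pwDl. Qed.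

Lemma shift_gt0 (z a : C) : 0 < Re z -> 0 <= Re a -> 0 < Re (z + a).
Proof. by move=> z0 a0; rewrite RecD ltr_pwDl. Qed.

Lemma scale_gt0 (c : R) (z : C) : 0 < c -> 0 < Re z -> 0 < Re (c%:C * z).
Proof. by move=> c0 z0; rewrite RecM /= mul0r subr0 mulr_gt0. Qed.

Lemma shiftopv (a : C) h z : 0 < Re z -> shiftop a h z = h (z + a).
Proof. by move=> z0; rewrite /shiftop extend0E. Qed.

Lemma scaleopv (c : R) h z : 0 < Re z -> scaleop c h z = h (c%:C * z).
Proof. by move=> z0; rewrite /scaleop extend0E. Qed.

Lemma invopv h z : 0 < Re z -> invop l h z = (z ^+ n)^-1 * h (1 / z).
Proof. by move=> z0; rewrite /invop extend0E. Qed.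

(** Here g z = delta + c / (z + kappa) with [c] positive: translation by [kappa], inversion,
    dilation by [c], translation by [delta]. *)
Lemma adjpair_mob_real (delta kappa r : C) (c : R) : 0 < c ->
  1 - delta * kappa = c%:C -> 0 <= Re delta -> 0 <= Re kappa ->
  adjpair l (mobop delta kappa r) (mobop kappa^* delta^* r^*).
Proof.
move=> c0 cE d0 k0.
have cE' : 1 - delta^* * kappa^* = c%:C.
  by rewrite -rmorphM -(rmorph1 (@conjc R)) -rmorphB /= cE conjc_real.
have k0' : 0 <= Re kappa^* by rewrite RecJ.
have d0' : 0 <= Re delta^* by rewrite RecJ.
have cC : c%:C != 0 :> C by rewrite -normc_gt0 normc_real normr_gt0 gt_eqF.
apply: eq_adjpair (adjpair_comp (adjpair_scalar l r)
  (adjpair_comp (adjpair_shift l k0) (adjpair_comp (adjpair_inv R l)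
  (adjpair_comp (adjpair_scale l c0) (adjpair_shift l d0))))) => h bh /=.
- apply: eq_extend0 => [z z0|]; last by apply: mulr_out; exact: extend0_out.
  have zk := shift_gt0 z0 k0; have zk0 := shift_neq0 z0 k0.
  have zi := inv_gt0 zk; have zc := scale_gt0 c0 zi.
  rewrite shiftopv// invopv// scaleopv// shiftopv// mulrA; congr (_ * h _).
  by rewrite -cE; field.
- have E z : 0 < Re z -> shiftop delta^* (fun z => ((c ^+ n)^-1)%:C *
     scaleop c^-1 (invop l (shiftop kappa^* (fun w => r^* * h w))) z) z =
     r^* / (z + delta^*) ^+ n * h ((kappa^* * z + 1) / (z + delta^*)).
    move=> z0.
    have zd := shift_gt0 z0 d0'; have zd0 := shift_neq0 z0 d0'.
    have cV : 0 < c^-1 by rewrite invr_gt0.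
    have zc := scale_gt0 cV zd; have zi := inv_gt0 zc.
    rewrite shiftopv// scaleopv// invopv// shiftopv// exprMn invfM !mulrA.
    rewrite [X in _ = X * _](mulrC r^*); congr (_ * h _).
      congr (_ * _); rewrite -[RHS]mul1r; congr (_ * _).
      rewrite -rmorphXn -fmorphV -rmorphM exprVn /= invrK mulVf//.
      by rewrite expf_neq0// gt_eqF.
    rewrite fmorphV /= invfM invrK mul1r.
    by rewrite -cE'; field.
  apply: eq_extend0 => [z|z z0]; first exact: E.
  exact: extend0_out.
Qed.

End moebius_operators.

Section moebius_factorization.
Variables (R : realType) (l : nat).
Local Notation C := R[i].
Local Notation n := (l + 2)%N.
Local Notation kernel := (@kernel R l).
Local Notation nsq := (nsq l).
Local Notation rep_cst := (rep_cst R l).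
Local Notation mobop := (@mobop R l).
Implicit Types (h k : C -> C).

(* g z = i b + 1 / (1/p + c / (z + kappa - c p)). *)
Lemma adjpair_mob_factor (delta kappa r p : C) (b c : R) : 0 < c -> 0 < Re p ->
  delta = (0 +i* b) + p -> delta * kappa - 1 = c%:C * p ^+ 2 ->
  0 <= Re (kappa - c%:C * p) ->
  adjpair l (mobop delta kappa r) (mobop kappa^* delta^* r^*).
Proof.
move=> c0 p0 dE cE k1; pose m := 1 / p; pose ib : C := 0 +i* b.
have m0 : 0 <= Re m by apply/ltW/inv_gt0.
have ib0 : 0 <= Re ib by [].
have pn0 := Re_neq0 p0.
have m0' : 0 <= Re m^* by rewrite RecJ.
have ib0' : 0 <= Re ib^* by [].
have k1' : 0 <= Re (kappa - c%:C * p)^* by rewrite RecJ.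
have cC : c%:C != 0 :> C by rewrite -normc_gt0 normc_real normr_gt0 gt_eqF.
have cV : 0 < c^-1 by rewrite invr_gt0.
apply: eq_adjpair (adjpair_comp (adjpair_scalar l (r * m ^+ n))
  (adjpair_comp (adjpair_shift l k1) (adjpair_comp (adjpair_inv R l)
  (adjpair_comp (adjpair_scale l c0) (adjpair_comp (adjpair_shift l m0)
  (adjpair_comp (adjpair_inv R l) (adjpair_shift l ib0))))))) => h bh /=.
- apply: eq_extend0 => [z z0|]; last by apply: mulr_out; exact: extend0_out.
  have zk := shift_gt0 z0 k1; have zi := inv_gt0 zk; have zc := scale_gt0 c0 zi.
  have zm := shift_gt0 zc m0; have zj := inv_gt0 zm.
  rewrite shiftopv// invopv// scaleopv// shiftopv// invopv// shiftopv//.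
  have e1 : delta * z + 1 = delta * (z + kappa) - c%:C * p ^+ 2 by rewrite -cE; ring.
  have zk0 := Re_neq0 zk.
  have zK : z + kappa != 0.
    apply: Re_neq0; have -> : z + kappa = z + (kappa - c%:C * p) + c%:C * p by ring.
    by rewrite RecD; apply: addr_gt0 => //; apply: scale_gt0.
  have d0 : c%:C * (1 / (z + (kappa - c%:C * p))) + m =
      (z + kappa) / ((z + (kappa - c%:C * p)) * p).
    by rewrite /m; field; rewrite zk0 pn0.
  rewrite d0 [LHS]mulrA [LHS]mulrA; congr (_ * h _).
    rewrite -!mulrA; congr (_ * _); rewrite -!exprVn -!exprMn; congr (_ ^+ n).
    by rewrite /m; field; rewrite zK zk0 pn0.
  rewrite e1 dE /ib; move: (0 +i* b : C) => s.
  by field; rewrite zK zk0 pn0.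
have pn0' : p^* != 0 by rewrite -normc_gt0 normc_conj normc_gt0.
have qE : m^* = 1 / p^* by rewrite /m !div1r fmorphV.
have KE : (kappa - c%:C * p)^* = kappa^* - c%:C * p^*.
  by apply: complex_ext; rewrite !(RecD, ImcD, RecN, ImcN, RecJ, ImcJ, RecM, ImcM) /=; ring.
have DE : delta^* = ib^* + p^* by rewrite dE rmorphD.
have CE : delta^* * kappa^* - 1 = c%:C * p^* ^+ 2.
  rewrite -rmorphM -(rmorph1 (@conjc R)) -rmorphB cE rmorphM rmorphXn.
  by congr (_ * _); exact: conjc_real.
have rE : (r * m ^+ n)^* = r^* * m^* ^+ n by rewrite rmorphM rmorphXn.
apply: eq_extend0 => [z z0|z z0]; last exact: extend0_out.
have zb := shift_gt0 z0 ib0'; have zi := inv_gt0 zb; have zm := shift_gt0 zi m0'.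
have zc := scale_gt0 cV zm; have zj := inv_gt0 zc.
rewrite shiftopv// invopv// shiftopv// scaleopv// invopv// shiftopv//.
rewrite rE KE; rewrite qE in zm zc *.
have e1 : kappa^* * z + 1 = kappa^* * (z + delta^*) - c%:C * p^* ^+ 2 by rewrite -CE; ring.
have zb0 := Re_neq0 zb.
have zD : z + delta^* != 0.
  by rewrite DE addrA; apply: Re_neq0; rewrite RecD RecJ addr_gt0.
have d0 : 1 / (z + ib^*) + 1 / p^* = (z + delta^*) / ((z + ib^*) * p^*).
  by rewrite DE; field; rewrite zb0 pn0'.
rewrite d0 exprMn invfM !mulrA; congr (_ * h _).
  rewrite (_ : ((c ^+ n)^-1)%:C = ((c^-1)%:C ^+ n)); last first.
    by rewrite -exprVn rmorphXn.
  have cV0 : ((c^-1)%:C ^+ n : C) != 0.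
    by rewrite expf_neq0// -normc_gt0 normc_real normr_gt0 gt_eqF.
  rewrite -(mulrA _ (_ ^+ n) (_ ^+ n)^-1) mulfV// mulr1.
  have [Y YE] : exists Y, Y = (z + delta^*) / ((z + ib^*) * p^*) by eexists.
  have [P PE] : exists P, P = 1 / p^* by eexists.
  rewrite -YE -PE.
  transitivity (r^* * ((z + ib^*)^-1 * Y^-1 * P) ^+ n).
    rewrite !exprMn !exprVn -/ib; move: ((z + ib^*) ^+ n) (Y ^+ n) (P ^+ n) => x y u.
    rewrite [RHS]mulrC [LHS]mulrAC; reflexivity.
  rewrite -[(_ ^+ n)^-1 in RHS]exprVn; congr (_ * _ ^+ n); rewrite YE PE.
  by field; rewrite zD zb0 pn0'.
rewrite e1 DE fmorphV /= -[0 +i* - b]/(ib^*); rewrite DE in zD.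
move: (ib^*) zb0 zD => s zb0 zD.
by field; rewrite zD zb0 pn0' cC.
Qed.

(** Evaluation at [alpha] is, up to a constant, the inner product with the kernel at [alpha], and (1
    + alpha z)^-n is a multiple of the kernel at [1 / alpha^*]. Taking the adjoint exchanges these
    two kernels. *)
Lemma adjpair_rank1 (alpha beta : C) : 0 < Re alpha ->
  adjpair l (fun h => extend0 (fun z => beta / (1 + alpha * z) ^+ n * h alpha))
    (fun k => extend0 (fun z =>
       beta^* / (alpha^* * (z + alpha^*)) ^+ n * k (1 / alpha^*))).
Proof.
move=> a0; have an0 := Re_neq0 a0; have a1 := ReVJ_gt0 a0.
have [bk1 _] := bergman_kernel l a1; have [bk2 _] := bergman_kernel l a0.
have a'0 : alpha^* != 0 by rewrite -normc_gt0 normc_conj normc_gt0.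
have E1 h : extend0 (fun z => beta / (1 + alpha * z) ^+ n * h alpha) =
    (fun z => (beta / alpha ^+ n * h alpha) * kernel (1 / alpha^*) z).
  apply/esym/eq_extend0 => [z z0|]; last by apply: mulr_out; exact: extend0_out.
  have az : z + 1 / alpha != 0 by apply: Re_neq0; rewrite RecD addr_gt0 ?inv_gt0.
  rewrite kernelE// (_ : (1 / alpha^*)^* = 1 / alpha); last by rewrite !div1r fmorphV /= conjcK.
  rewrite [LHS]mulrAC; congr (_ * _); rewrite -mulrA; congr (_ * _).
  rewrite -invfM -exprMn; congr (_ ^+ n)^-1; by field.
have E2 k : extend0 (fun z => beta^* / (alpha^* * (z + alpha^*)) ^+ n * k (1 / alpha^*)) =
    (fun z => (beta^* / alpha^* ^+ n * k (1 / alpha^*)) * kernel alpha z).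
  apply/esym/eq_extend0 => [z z0|]; last by apply: mulr_out; exact: extend0_out.
  rewrite kernelE// exprMn [LHS]mulrAC; congr (_ * _); rewrite -mulrA; congr (_ * _).
  by rewrite -invfM.
have r0 := rep_cst_gt0 R l.
split.
- exists (normc (beta / alpha ^+ n) ^+ 2 * nsq (kernel (1 / alpha^*)) *
    (4 * nsq (kernel alpha) / rep_cst ^+ 2)) => [|h bh].
    apply: mulr_ge0; first exact: mulr_ge0 (sqr_ge0 _) (nsq_ge0 _ _).
    exact: divr_ge0 (mulr_ge0 (ler0n _ _) (nsq_ge0 _ _)) (sqr_ge0 _).
  rewrite E1; split; first exact: bergmanZ.
  rewrite (nsqZ _ bk1) normcM exprMn.
  have : normc (h alpha) ^+ 2 <= 4 * nsq (kernel alpha) / rep_cst ^+ 2 * nsq h.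
    have := hip_cs bh bk2; rewrite (reproducing bh a0) normcM normcR_ge0 ?(ltW r0)//.
    move: (nsq_ge0 l h) (nsq_ge0 l (kernel alpha)) (normc_ge0 (h alpha)) (r0).
    move: (nsq h) (nsq (kernel alpha)) (normc (h alpha)) rep_cst => a b x c a0' b0' x0 c0.
    rewrite -ler_pdivlMl// => le.
    apply: (@le_trans _ _ ((c^-1 * (2 * Num.sqrt (a * b))) ^+ 2)).
      by rewrite lerXn2r ?nnegrE//; exact: le_trans le.
    rewrite !exprMn sqr_sqrtr ?mulr_ge0//.
    rewrite le_eqVlt; apply/orP; left; apply/eqP; field; exact: lt0r_neq0.
  move=> le; rewrite mulrAC -[leRHS]mulrA; apply: ler_wpM2l le.
  exact: mulr_ge0 (sqr_ge0 _) (nsq_ge0 _ _).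
- by move=> k bk; rewrite E2; exact: bergmanZ.
move=> h k bh bk; rewrite E1 E2 (hipZl _ bk1 bk) (hipZr _ bh bk2).
rewrite (reproducing bh a0) (hip_conj bk bk1) (reproducing bk a1).
have cj (x : R) (y : C) : (x%:C * y)^* = x%:C * y^*.
  by apply: complex_ext; rewrite !(RecJ, ImcJ, RecM, ImcM) /=; ring.
have E3 (y : C) : (beta^* / alpha^* ^+ n * y)^* = beta / alpha ^+ n * y^*.
  by rewrite rmorphM rmorphM fmorphV rmorphXn /= !conjcK.
rewrite cj E3.
move: (beta / alpha ^+ n) (k _)^* (h _) (_%:C) => u x y v.
by rewrite -mulrA -[RHS]mulrA; congr (_ * _); rewrite mulrC -mulrA mulrCA.
Qed.

End moebius_factorization.

(** * The three families of symbols *)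

Section symbols.
Variables (R : realType) (l : nat).
Local Notation C := R[i].
Local Notation n := (l + 2)%N.
Local Notation Cs := (@Cstar R l).
Local Notation mobop := (@mobop R l).
Implicit Types (h k f g : C -> C).

Lemma conjc_neq0 (z : C) : z != 0 -> z^* != 0.
Proof. by move=> z0; rewrite -normc_gt0 normc_conj normc_gt0. Qed.

(** A condition on the symbols alone: [wop f g] is total, so no domain enters. *)
Definition csym f g := adjpair l (wop f g) (fun k => Cs (wop f g (Cs k))).

Lemma eq_wop f f' g g' h : (forall z, 0 < Re z -> f z = f' z /\ g z = g' z) ->
  wop f g h = wop f' g' h.
Proof. by move=> e; apply: extend0_eq => z /e[-> ->]. Qed.

Lemma csym_rank1 f g (alpha beta : C) : 0 < Re alpha ->
  (forall w, Cplus w -> g w = alpha /\ f w = beta / (1 + alpha * w) ^+ n) ->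
  csym f g.
Proof.
move=> a0 fg; apply: eq_adjpair (adjpair_rank1 l beta a0) => h bh.
  by apply: extend0_eq => z z0; have [-> ->] := fg z z0.
apply/esym/eq_extend0 => [z z0|]; last exact: extend0_out.
have w0 := ReVJ_gt0 z0; have [gE fE] := fg _ w0.
have gp : 0 < Re (g (1 / z^*)) by rewrite gE.
rewrite (@Cstar_wop R l f g h z z0 gp) gE fE.
have zn0 := Re_neq0 z0; have az : z + alpha^* != 0 by exact: kernel_neq0.
have an0 := conjc_neq0 (Re_neq0 a0).
suff -> : (beta / (1 + alpha * (1 / z^*)) ^+ n)^* * ((z * alpha^*) ^+ n)^-1 =
  beta^* / (alpha^* * (z + alpha^*)) ^+ n by [].
have -> : (beta / (1 + alpha * (1 / z^*)) ^+ n)^* = beta^* / (1 + alpha^* * (1 / z)) ^+ n.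
  rewrite rmorphM fmorphV rmorphXn rmorphD rmorphM rmorph1 /=; congr (_ / (_ + _ * _) ^+ n).
  by rewrite !div1r fmorphV /= conjcK.
rewrite -!mulrA; congr (_ * _); rewrite -invfM -exprMn; congr (_ ^+ n)^-1.
by field.
Qed.

Lemma csym_scale f g (lambda : R) (theta : C) : 0 < lambda ->
  (forall w, Cplus w -> g w = lambda%:C * w /\ f w = theta) -> csym f g.
Proof.
move=> l0 fg.
apply: eq_adjpair (adjpair_comp (adjpair_scalar l theta) (adjpair_scale l l0)) => h bh.
  apply: eq_extend0 => [z z0|]; last by apply: mulr_out; exact: extend0_out.
  by have [-> ->] := fg z z0; rewrite scaleopv.
have lC : lambda%:C != 0 :> C by rewrite -normc_gt0 normc_real normr_gt0 gt_eqF.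
apply/esym; transitivity (extend0 (fun z => (theta^* * ((lambda ^+ n)^-1)%:C) * h ((lambda^-1)%:C * z))).
  apply: eq_extend0 => [z z0|]; last exact: extend0_out.
  have w0 := ReVJ_gt0 z0; have [gE fE] := fg _ w0; have zn0 := Re_neq0 z0.
  have E : (lambda%:C * (1 / z^*))^* = lambda%:C / z.
    rewrite rmorphM !div1r fmorphV /= conjcK; congr (_ / _).
    by apply: complex_ext => //=; rewrite oppr0.
  have gp : 0 < Re (g (1 / z^*)) by rewrite gE scale_gt0.
  rewrite (@Cstar_wop R l f g h z z0 gp) gE fE E.
  rewrite (_ : 1 / (lambda%:C / z) = (lambda^-1)%:C * z); last first.
    by rewrite fmorphV /= div1r invfM invrK mulrC.
  congr (_ * _).
  by rewrite mulrCA mulfV// mulr1 fmorphV rmorphXn.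
apply/esym; apply: eq_extend0 => [z z0|]; last by apply: mulr_out; exact: extend0_out.
by rewrite scaleopv// mulrCA mulrA.
Qed.

Lemma Cstar_mob (delta kappa r : C) k : 0 <= Re kappa ->
  (forall z, 0 < Re z -> 0 < Re ((delta * z + 1) / (z + kappa))) ->
  Cs (mobop delta kappa r (Cs k)) = mobop kappa^* delta^* r^* k.
Proof.
move=> k0 g0; apply: eq_extend0 => [z z0|]; last exact: extend0_out.
have w0 := ReVJ_gt0 z0; rewrite (@Cstar_wop R l _ _ k z z0 (g0 _ w0)).
have zn0 := Re_neq0 z0.
have aJ : (1 / z^*)^* = 1 / z by rewrite !div1r fmorphV /= conjcK.
have wk := conjc_neq0 (shift_neq0 w0 k0).
have dw : delta * (1 / z^*) + 1 != 0.
  by have := Re_neq0 (g0 _ w0); rewrite mulf_eq0 negb_or => /andP[].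
move/conjc_neq0 : dw.
have ak : (1 / z^* + kappa)^* = 1 / z + kappa^* by rewrite rmorphD /= aJ.
have ad : (delta * (1 / z^*) + 1)^* = delta^* * (1 / z) + 1.
  by rewrite rmorphD rmorphM rmorph1 /= aJ.
have gJ : ((delta * (1 / z^*) + 1) / (1 / z^* + kappa))^* =
    (delta^* * (1 / z) + 1) / (1 / z + kappa^*).
  by rewrite rmorphM fmorphV /= ak ad.
have fJ : (r / (1 / z^* + kappa) ^+ n)^* = r^* / (1 / z + kappa^*) ^+ n.
  by rewrite rmorphM fmorphV rmorphXn /= ak.
rewrite gJ fJ ad; rewrite ak in wk => dw.
have zd : z + delta^* != 0.
  have -> : z + delta^* = z * (delta^* * (1 / z) + 1) by field.
  by rewrite mulf_neq0.
have zk : 1 + kappa^* * z != 0.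
  have -> : 1 + kappa^* * z = z * (1 / z + kappa^*) by field.
  by rewrite mulf_neq0.
have -> : 1 / ((delta^* * (1 / z) + 1) / (1 / z + kappa^*)) =
    (kappa^* * z + 1) / (z + delta^*).
  by rewrite [kappa^* * z + 1]addrC; field; rewrite zn0 zd zk.
suff -> : r^* / (1 / z + kappa^*) ^+ n *
    ((z * ((delta^* * (1 / z) + 1) / (1 / z + kappa^*))) ^+ n)^-1 =
  r^* / (z + delta^*) ^+ n; first reflexivity.
rewrite -mulrA; congr (_ * _); rewrite -invfM -exprMn; congr (_ ^+ n)^-1.
by field; rewrite zn0 zk.
Qed.

Lemma mob_value (delta kappa w : C) : w + kappa != 0 ->
  delta + (1 - delta * kappa) / (w + kappa) = (delta * w + 1) / (w + kappa).
Proof. by move=> w0; field. Qed.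

Lemma csym_mob f g (delta kappa r : C) : (forall z, Cplus z -> Cplus (g z)) ->
  0 <= Re kappa ->
  (forall w, Cplus w -> g w = delta + (1 - delta * kappa) / (w + kappa) /\
     f w = r / (w + kappa) ^+ n) ->
  adjpair l (mobop delta kappa r) (mobop kappa^* delta^* r^*) -> csym f g.
Proof.
move=> gC k0 fg; have E h : mobop delta kappa r h = wop f g h.
  apply: eq_wop => z z0; have [-> ->] := fg z z0.
  by rewrite mob_value// shift_neq0.
have g0 z : 0 < Re z -> 0 < Re ((delta * z + 1) / (z + kappa)).
  move=> z0; rewrite -mob_value ?shift_neq0//; have [<- _] := fg z z0; exact: gC.
apply: eq_adjpair => h bh; first exact: E.
by rewrite -E Cstar_mob.
Qed.

Lemma csym_symbols f g : (forall z, Cplus z -> Cplus (g z)) ->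
  [\/ symbol_case_i l f g, symbol_case_ii f g | symbol_case_iii l f g] ->
  csym f g.
Proof.
move=> gC [[alpha [beta [a0 fg]]]|[lambda [theta [l0 fg]]]|].
- exact: csym_rank1 fg.
- exact: csym_scale fg.
move=> [delta [kappa [r [[[d0 i0 c1 k0]|[d0 k1]] fg]]]].
  apply: (csym_mob gC k0 fg); apply: (@adjpair_mob_real R l _ _ _ (1 - Re (delta * kappa))) => //.
  - by rewrite subr_gt0.
  - by apply: complex_ext; rewrite !(RecD, ImcD, RecN, ImcN) ?i0 /= ?subr0.
  - by rewrite d0.
rewrite oppr_lt0 in d0.
have [u uE] : exists u, u = delta * kappa - 1 by eexists.
rewrite -uE in k1.
have nu : `|Re u| <= normc u := ler_normRe u.
have nu1 : - normc u <= Re u by move: nu; rewrite ler_norml => /andP[].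
have nu2 : Re u <= normc u := ler_Re u.
(* The subtracted quotient is nonnegative, because Re u >= - |u|. *)
have k0 : 0 <= Re kappa.
  apply: le_trans (_ : (Re u + normc u) / (2 * Re delta) <= _); last by lra.
  by apply: divr_ge0; lra.
have [c0|] := ltP 0 ((Re u + normc u) / (2 * Re delta ^+ 2)).
  (* The solution of u = c p^2 with c > 0 and Re p = Re delta: comparing real parts and moduli gives
     Re u + |u| = 2 c (Re delta)^2, and imaginary parts give e = Im p. The inequality of case (iii)
     then says exactly that Re (kappa - c p) >= 0. *)
  set c := (Re u + normc u) / (2 * Re delta ^+ 2) in c0.
  pose e := Im u / (2 * c * Re delta).
  have dn0 : Re delta != 0 by rewrite gt_eqF.
  have two0 : (2 : R) != 0 by rewrite pnatr_eq0.
  have cn0 : c != 0 by rewrite gt_eqF.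
  apply: (csym_mob gC k0 fg).
  apply: (@adjpair_mob_factor R l delta kappa r (Re delta +i* e) (Im delta - e) c c0) => //.
  - by apply: complex_ext => /=; ring.
  - rewrite -uE; apply: complex_ext; last first.
      by rewrite expr2 !(ImcM, RecM) /= /e; field; rewrite cn0 dn0.
    rewrite expr2 !(ImcM, RecM) /=.
    have N : normc u ^+ 2 = Re u ^+ 2 + Im u ^+ 2 := normc_sqr u.
    have cE : c * (2 * Re delta ^+ 2) = Re u + normc u.
      by rewrite /c divfK//; exact: mulf_neq0 two0 (expf_neq0 _ dn0).
    have eE : e * (2 * c * Re delta) = Im u.
      by rewrite /e divfK//; exact: mulf_neq0 (mulf_neq0 two0 cn0) dn0.
    have k2 : 2 * c * Re delta ^+ 2 != 0.
      exact: mulf_neq0 (mulf_neq0 two0 cn0) (expf_neq0 _ dn0).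
    clearbody e; move: (normc u) (Re u) (Im u) (Re delta) N cE eE k2 {k1 nu nu1 nu2 dn0 d0}.
    clearbody c; move=> m x y d N cE eE k2.
    have mE : m = c * (2 * d ^+ 2) - x by rewrite cE; ring.
    rewrite mE -eE in N.
    by apply: (mulfI k2); lra.
  - by rewrite RecD RecN RecM /= mul0r subr0 /c; apply: le_trans k1 _; rewrite le_eqVlt; apply/orP; left; apply/eqP; field.
(* Now u = - |u| is a nonpositive real. If it is 0 then [g] is constant and the operator has rank at
   most one; otherwise 1 - delta kappa is a positive real and [adjpair_mob_real] applies. *)
move=> c0.
have s0 : Re u + normc u = 0.
  apply/eqP; rewrite eq_le; apply/andP; split; last by lra.
  by move: c0; rewrite pmulr_lle0// invr_gt0 mulr_gt0// exprn_gt0.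
have u1 : normc u = - Re u by lra.
have iu : Im u = 0.
  by have := normc_sqr u; rewrite u1 sqrrN => /eqP; rewrite -[X in X == _]addr0 (inj_eq (addrI _)) eq_sym sqrf_eq0 => /eqP.
have [u0|u0] := eqVneq (Re u) 0.
  have dk : delta * kappa = 1.
    by apply/subr0_eq; rewrite -uE; apply: complex_ext.
  have dn0 : delta != 0 by apply: contra_eq_neq dk => ->; rewrite mul0r eq_sym oner_neq0.
  apply: (@csym_rank1 f g delta (r * delta ^+ n)) => // w w0.
  have [-> ->] := fg w w0; rewrite dk subrr mul0r addr0; split=> //.
  have wk := shift_neq0 w0 k0.
  have -> : 1 + delta * w = delta * (w + kappa) by rewrite mulrDr dk addrC.
  by rewrite exprMn invfM mulrA mulfK// expf_neq0.
apply: (csym_mob gC k0 fg); apply: (@adjpair_mob_real R l _ _ _ (- Re u)) => //.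
- by rewrite lt_neqAle eq_sym oppr_eq0 u0 -u1 normc_ge0.
- rewrite -[LHS]opprB -uE; apply: complex_ext; rewrite ?RecN ?ImcN //= iu oppr0//.
- exact: ltW.
Qed.

End symbols.

(** * Necessity *)

Section cocycle.
Variables (R : realType) (n : nat) (f g : R[i] -> R[i]).
Local Notation C := R[i].
Hypotheses (n0 : (0 < n)%N) (ga : analytic_on (@Cplus R) g).
Hypothesis gC : forall z, 0 < Re z -> 0 < Re (g z).
Hypothesis star : forall z w, 0 < Re z -> 0 < Re w ->
  f z / (1 + w * g z) ^+ n = f w / (1 + z * g w) ^+ n.

Lemma one_addM_neq0 (w v : C) : 0 < Re w -> 0 < Re v -> 1 + w * v != 0.
Proof.
move=> w0 v0; have wn0 := Re_neq0 w0.
have -> : 1 + w * v = w * (1 / w + v) by field.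
by rewrite mulf_neq0// Re_neq0// RecD addr_gt0// inv_gt0.
Qed.

(* Otherwise, by the intermediate value theorem, |G t - 1| takes n + 1 distinct
   values. *)
Lemma root_of_unity_path (G : R -> C) : (forall t, 0 <= t <= 1 -> ccont_at G t) ->
  (forall t, 0 <= t <= 1 -> G t ^+ n = 1) -> G 0 = 1 -> G 1 = 1.
Proof.
move=> cG Gn G0; apply/eqP; rewrite -subr_eq0 -normc_eq0; apply: contraT => r0.
pose phi t := normc (G t - 1); set r := normc _ in r0.
have rp : 0 < r by rewrite lt_neqAle eq_sym r0 normc_ge0.
have cphi : {within `[0, 1], continuous phi}.
  apply: continuous_in_subspaceT => t; rewrite inE /= in_itv /= => t01.
  apply/cvgrPdist_lt => e e0; have [d d0 hd] := cG t t01 e e0.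
  near=> s; apply: (@le_lt_trans _ _ (normc (G s - G t))); last first.
    apply: hd; rewrite distrC; near: s; exact: cvgr_dist_lt.
  rewrite /phi ler_norml; apply/andP; split.
    rewrite lerBrDr addrC lerBlDr.
    rewrite (_ : G s - 1 = (G s - G t) + (G t - 1)); last by ring.
    by rewrite addrC; exact: ler_normcD.
  rewrite lerBlDr (_ : G t - 1 = (G t - G s) + (G s - 1)); last by ring.
  by apply: le_trans (ler_normcD _ _) _; rewrite normc_distC.
have ex (k : 'I_n.+1) : exists x : C, x ^+ n = 1 /\ normc (x - 1) = r * (k%:R / n%:R).
  have nR : 0 < n%:R :> R by rewrite ltr0n.
  have [|t t01 pt] := @IVT R phi 0 1 (r * (k%:R / n%:R)) ler01 cphi.
    rewrite /phi G0 subrr ComplexField.Normc.normc0 -/r.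
    rewrite (min_l (ltW rp)) (max_r (ltW rp)); apply/andP; split.
      by apply: mulr_ge0; [exact: ltW|apply: divr_ge0; rewrite ler0n].
    rewrite ler_piMr//; first exact: ltW.
    by rewrite ler_pdivrMr// mul1r ler_nat -ltnS.
  by exists (G t); split=> //; apply: Gn; move: t01; rewrite in_itv.
have [x hx] := choice ex.
have := @max_unity_roots _ n (codom x) n0; rewrite size_codom card_ord ltnn.
have -> : all n.-unity_root (codom x).
  by apply/allP => y /codomP[k ->]; apply/unity_rootP; have [] := hx k.
have -> : uniq (codom x).
  apply/injectiveP => k k' kk; apply/val_inj => /=.
  have [_ h1] := hx k; have [_ h2] := hx k'.
  move: h1; rewrite kk h2 => /(mulfI r0) /(mulIf _) h.
  apply/eqP; rewrite -(eqr_nat R); apply/eqP/esym/h.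
  by rewrite invr_eq0 pnatr_eq0 -lt0n.
by move=> /(_ isT isT).
Unshelve. all: by end_near. Qed.

Hypothesis f_neq0 : exists2 z0, 0 < Re z0 & f z0 <> 0.

(** [star] carries a zero of [f] to every other point, so one nonzero value excludes zeros; the
    cocycle argument divides by values of [f]. *)
Lemma symbol_neq0 z : 0 < Re z -> f z != 0.
Proof.
move=> z0; have [w w0 fw] := f_neq0; apply/eqP => fz; apply: fw.
have := star z0 w0; rewrite fz mul0r => /esym/eqP; rewrite mulf_eq0 invr_eq0.
by rewrite expf_eq0 (negbTE (one_addM_neq0 z0 (gC w0))) andbF orbF => /eqP.
Qed.

Lemma cocycle z w v : 0 < Re z -> 0 < Re w -> 0 < Re v ->
  (1 + z * g w) * (1 + w * g v) * (1 + v * g z) =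
  (1 + w * g z) * (1 + v * g w) * (1 + z * g v).
Proof.
move=> z0 w0 v0.
have A x y (x0 : 0 < Re x) (y0 : 0 < Re y) := one_addM_neq0 x0 (gC y0).
(* The segment from [w] to [z], along which the first point of the triple moves. *)
pose p (t : R) := w + t%:C * (z - w).
pose F y := (1 + y * g w) * (1 + w * g v) * (1 + v * g y) /
  ((1 + w * g y) * (1 + v * g w) * (1 + y * g v)).
have Fn y : 0 < Re y -> F y ^+ n = 1.
  move=> y0; have := star y0 w0; have := star w0 v0; have := star v0 y0.
  have := symbol_neq0 y0; have := symbol_neq0 w0; have := symbol_neq0 v0.
  rewrite /F; move: (expf_neq0 n (A _ _ y0 w0)) (expf_neq0 n (A _ _ w0 v0))
    (expf_neq0 n (A _ _ v0 y0)) (expf_neq0 n (A _ _ w0 y0))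
    (expf_neq0 n (A _ _ v0 w0)) (expf_neq0 n (A _ _ y0 v0)).
  rewrite expr_div_n !exprMn.
  move: ((1 + y * g w) ^+ n) ((1 + w * g v) ^+ n) ((1 + v * g y) ^+ n) ((1 + w * g y) ^+ n)
    ((1 + v * g w) ^+ n) ((1 + y * g v) ^+ n) (f y) (f w) (f v).
  move=> a1 a2 a3 b1 b2 b3 fy fw fv a10 a20 a30 b10 b20 b30 fv0 fw0 fy0 e1 e2 e3.
  (* Each instance of [star] is solved for its factor of the numerator; the values of [f] then
     cancel around the triple. *)
  have E (x x' a b : C) : a != 0 -> b != 0 -> x != 0 -> x / b = x' / a -> a = x' * b / x.
    move=> a0 b0 xn0 h; apply: (mulIf xn0); rewrite divfK//.
    have -> : x' = x / b * a by rewrite h divfK.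
    by field.
  rewrite (E _ _ _ _ a10 b10 fy0 e3) (E _ _ _ _ a20 b20 fw0 e2) (E _ _ _ _ a30 b30 fv0 e1).
  by field; rewrite b10 b20 b30 fy0 fw0 fv0.
have Fa : analytic_on (@Cplus R) F.
  have aid := @analytic_id R (@Cplus R).
  have acst c := @analytic_cst R (@Cplus R) c.
  have aL c' : analytic_on (@Cplus R) (fun y => 1 + y * c').
    exact: (@analyticD _ _ (fun=> 1) (fun y => y * c') (acst 1)
      (@analyticM _ _ id (fun=> c') aid (acst c'))).
  have aG c : analytic_on (@Cplus R) (fun y => 1 + c * g y).
    exact: (@analyticD _ _ (fun=> 1) (fun y => c * g y) (acst 1)
      (@analyticM _ _ (fun=> c) g (acst c) ga)).
  have aN : analytic_on (@Cplus R) (fun y => (1 + y * g w) * (1 + w * g v) * (1 + v * g y)).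
    apply: (@analyticM _ _ (fun y => (1 + y * g w) * (1 + w * g v)) (fun y => 1 + v * g y) _ (aG v)).
    exact: (@analyticM _ _ (fun y => 1 + y * g w) (fun=> 1 + w * g v) (aL (g w)) (acst _)).
  have aD : analytic_on (@Cplus R) (fun y => (1 + w * g y) * (1 + v * g w) * (1 + y * g v)).
    apply: (@analyticM _ _ (fun y => (1 + w * g y) * (1 + v * g w)) (fun y => 1 + y * g v) _ (aL (g v))).
    exact: (@analyticM _ _ (fun y => 1 + w * g y) (fun=> 1 + v * g w) (aG w) (acst _)).
  have aI := @analyticV R (@Cplus R)
    (fun y => (1 + w * g y) * (1 + v * g w) * (1 + y * g v))
    (fun y (y0 : Cplus y) => mulf_neq0 (mulf_neq0 (A _ _ w0 y0) (A _ _ v0 w0)) (A _ _ y0 v0)) aD.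
  exact: (@analyticM _ _ (fun y => (1 + y * g w) * (1 + w * g v) * (1 + v * g y))
    (fun y => ((1 + w * g y) * (1 + v * g w) * (1 + y * g v))^-1) aN aI).
have p0 t : 0 <= t <= 1 -> 0 < Re (p t).
  move=> /andP[t0 t1]; rewrite /p !(RecD, RecM, RecN, ImcD, ImcN) /=.
  by move: (Re z) (Re w) z0 w0 => x y x0 y0; nra.
have F1 : F z = 1.
  have := @root_of_unity_path (fun t => F (p t)).
  have -> : F (p 0) = F w by rewrite /p mul0r addr0.
  have -> : F (p 1) = F z by rewrite /p mul1r addrC subrK.
  apply.
  - move=> t t01 e e0; have /derivable_cderiv[a ha] := Fa _ (p0 t t01).
    have [d d0 hd] := cderiv_cont ha e0.
    have N0 : 0 < normc (z - w) + 1 by rewrite ltr_wpDl// normc_ge0.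
    exists (d / (normc (z - w) + 1)); first exact: divr_gt0.
    move=> s st; apply: hd.
    have -> : p s - p t = (s - t)%:C * (z - w).
      by rewrite /p rmorphB /=; ring.
    rewrite normcM normc_real; apply: (@le_lt_trans _ _ (`|s - t| * (normc (z - w) + 1))).
      by rewrite ler_wpM2l// lerDl.
    by rewrite -ltr_pdivlMr.
  - by move=> t t01; exact/Fn/p0.
  rewrite /F [X in X / _]mulrAC divff//.
  exact: (mulf_neq0 (mulf_neq0 (A _ _ w0 w0) (A _ _ v0 w0)) (A _ _ w0 v0)).
have dn0 : (1 + w * g z) * (1 + v * g w) * (1 + z * g v) != 0.
  exact: (mulf_neq0 (mulf_neq0 (A _ _ w0 z0) (A _ _ v0 w0)) (A _ _ z0 v0)).
by move/(congr1 ( *%R^~ ((1 + w * g z) * (1 + v * g w) * (1 + z * g v)))): F1;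
  rewrite /F divfK// mul1r.
Qed.

End cocycle.

(** * Classification of the symbols *)

Section classification.
Variables (R : realType) (l : nat) (f g : R[i] -> R[i]).
Local Notation C := R[i].
Local Notation n := (l + 2)%N.
Hypothesis ga : analytic_on (@Cplus R) g.
Hypothesis gC : forall z, 0 < Re z -> 0 < Re (g z).
Hypothesis star : forall z w, 0 < Re z -> 0 < Re w ->
  f z / (1 + w * g z) ^+ n = f w / (1 + z * g w) ^+ n.
Hypothesis f_neq0 : exists2 z0, 0 < Re z0 & f z0 <> 0.

(** [Y] is unrestricted, so with a nonzero [y] it could be chosen to make the form vanish. *)
Lemma mobius_real_coef (x y : R) (x0 : R) : 0 <= x0 ->
  (forall X Y : R, x0 < X -> 0 < x * X + y * Y) -> y = 0 /\ 0 < x.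
Proof.
move=> x00 H.
have y0 : y = 0.
  apply/eqP; apply: contraT => yn0.
  have := H (x0 + 1) (- (x * (x0 + 1)) / y); rewrite mulrC [y * _]mulrC divfK//.
  by rewrite mulrC subrr ltxx; apply; rewrite ltrDl.
split=> //; have := H (x0 + 1) 0; rewrite mulr0 addr0.
by rewrite pmulr_lgt0; [apply; rewrite ltrDl|rewrite ltr_pwDr].
Qed.

(** With z + kappa = X + i Y and c = 1 - delta kappa, positivity of the real part reads Re delta
    (X^2 + Y^2) + Re c X + Im c Y > 0 for X > Re kappa. For Re delta < 0 it fails at large X, and
    for Re delta = 0 it is linear. For Re delta > 0 it fails exactly on the closed disc with centre
    - c / (2 Re delta) and radius |c| / (2 Re delta), which must therefore lie in X <= Re kappa. *)
Lemma mobius_constraints (delta kappa : C) : 0 <= Re kappa -> 1 - delta * kappa != 0 ->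
  (forall z, 0 < Re z -> 0 < Re (delta + (1 - delta * kappa) / (z + kappa))) ->
  [/\ Re delta = 0, Im (delta * kappa) = 0, Re (delta * kappa) < 1 & 0 <= Re kappa] \/
  (- Re delta < 0 /\
   0 <= Re kappa - (Re (delta * kappa - 1) + normc (delta * kappa - 1)) / (2 * Re delta)).
Proof.
set c := 1 - delta * kappa => k0 c0 pos.
have posu (X Y : R) : Re kappa < X ->
    0 < Re delta * (X ^+ 2 + Y ^+ 2) + (Re c * X + Im c * Y).
  move=> kX; have := pos ((X - Re kappa) +i* (Y - Im kappa)); rewrite /= subr_gt0 => /(_ kX).
  have -> : ((X - Re kappa) +i* (Y - Im kappa)) + kappa = (X +i* Y).
    by apply: complex_ext; rewrite !(RecD, ImcD) /=; ring.
  rewrite RecD RecDiv RecM RecJ ImcJ normc_sqr /= mulrN opprK.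
  have N0 : 0 < X ^+ 2 + Y ^+ 2.
    by apply: ltr_pwDl; [rewrite exprn_gt0// (le_lt_trans k0)|exact: sqr_ge0].
  rewrite -(pmulr_lgt0 _ N0) mulrDl divfK ?gt_eqF//.
have cE : delta * kappa - 1 = - c by rewrite /c opprB.
rewrite cE RecN normc_opp.
have [d0|d0|d0] := ltgtP (Re delta) 0.
- exfalso; pose X := Re kappa + 1 + (`|Re c|) / - Re delta.
  have nd : 0 < - Re delta by rewrite oppr_gt0.
  have X1 : Re kappa < X.
    have : 0 <= `|Re c| / - Re delta by rewrite divr_ge0// ltW.
    by rewrite /X; lra.
  have := posu X 0 X1; rewrite expr0n addr0 mulr0 addr0.
  have X2 : 0 < X by apply: le_lt_trans X1.
  have -> : Re delta * X ^+ 2 + Re c * X = (Re delta * X + Re c) * X by ring.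
  rewrite pmulr_lgt0//.
  have : Re delta * X = Re delta * (Re kappa + 1) - `|Re c|.
    by rewrite /X; field; rewrite lt_eqF.
  have : Re c <= `|Re c| := ler_norm _.
  have : Re delta * (Re kappa + 1) < 0 by rewrite nmulr_rlt0//; lra.
  by lra.
- right; split; first by rewrite oppr_lt0.
  rewrite leNgt; apply/negP => h.
  (* The abscissa of the rightmost point of the disc where positivity fails. *)
  pose S := (normc c - Re c) / (2 * Re delta).
  have kS : Re kappa < S by move: h; rewrite /S addrC; lra.
  have := posu S (- Im c / (2 * Re delta)) kS.
  have := normc_sqr c; rewrite /S.
  move: (normc c) (Re c) (Im c) (Re delta) d0 => m x y d d0 N.
  have -> : d * (((m - x) / (2 * d)) ^+ 2 + (- y / (2 * d)) ^+ 2) +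
      (x * ((m - x) / (2 * d)) + y * (- y / (2 * d))) = (m ^+ 2 - (x ^+ 2 + y ^+ 2)) / (4 * d).
    by field; rewrite gt_eqF.
  by rewrite N subrr mul0r ltxx.
- left; have [|i0 r0] := @mobius_real_coef (Re c) (Im c) (Re kappa) k0.
    by move=> X Y kX; have := posu X Y kX; rewrite d0 mul0r add0r.
  have {}cE : delta * kappa = 1 - c by rewrite /c; ring.
  split=> //.
    by rewrite cE ImcD ImcN i0 /= subrr.
  by rewrite cE RecD RecN /=; lra.
Qed.

Lemma star_symbols :
  [\/ symbol_case_i l f g, symbol_case_ii f g | symbol_case_iii l f g].
Proof.
have n0 : (0 < n)%N by rewrite addn2.
have coc := cocycle n0 ga gC star f_neq0.
have r1 : 0 < Re (1 : C) by exact: ltr01.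
have r2 : 0 < Re (2%:C : C) by rewrite /= ltr0n.
pose a := g 1; pose b := g 2%:C.
have a0 : 0 < Re a by exact: gC.
have b0 : 0 < Re b by exact: gC.
have two : 2%:C = 1 + 1 :> C by apply: complex_ext => /=; ring.
(* The cocycle at z, 1, 2 rearranges to (s + p z) g z = p + q z, with coefficients in the values of
   [g] at 1 and 2. *)
pose p := 2%:C * a - b; pose q := (b - a) + a * b; pose s := 1 + 2%:C * (b - a).
have mob z : 0 < Re z -> (s + p * z) * g z = p + q * z.
  move=> z0; have := coc z 1 2%:C z0 r1 r2; rewrite -/a -/b !mul1r => E.
  apply/subr0_eq; move/eqP: E; rewrite -subr_eq0 => /eqP <-.
  by rewrite /s /p /q two; ring.
have sv z w : 0 < Re z -> 0 < Re w -> f z = f w / (1 + z * g w) ^+ n * (1 + w * g z) ^+ n.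
  move=> z0 w0; rewrite -star// divfK// expf_neq0//.
  by rewrite (one_addM_neq0 w0)//; exact: gC.
have [pE|p0] := eqVneq p 0.
  have bE : b = 2%:C * a by apply/esym/subr0_eq.
  have gE z : 0 < Re z -> g z = a * z.
    move=> z0; have := mob z z0; rewrite pE mul0r addr0 add0r.
    have -> : q = s * a by rewrite /q /s bE two; ring.
    have sn0 : s != 0.
      by rewrite /s bE two; apply: Re_neq0; rewrite !(RecD, RecM, RecN, ImcD, ImcN) /=; lra.
    by rewrite -mulrA => /(mulfI sn0).
  apply: Or32; exists (Re a), (f 1); split=> //.
  have ia : Im a = 0.
    apply/eqP; apply: contraT => i0.
    (* At this point a z has real part - Re a, which is negative. *)
    have := gC (z := 1 +i* (2 * Re a / Im a)); rewrite /= => /(_ ltr01).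
    rewrite gE /=; last exact: ltr01.
    rewrite RecM /= mulr1 mulrC divfK//; lra.
  have aE : a = (Re a)%:C by apply: complex_ext.
  move=> w w0; split; first by rewrite gE// -aE.
  rewrite (sv w 1 w0 r1) (gE w w0) mul1r -/a [w * a]mulrC divfK//.
  by rewrite expf_neq0// [a * w]mulrC (one_addM_neq0 w0 a0).
pose delta := q / p; pose kappa := s / p.
have mob' z : 0 < Re z -> (z + kappa) * g z = 1 + delta * z.
  move=> z0; apply: (mulfI p0); rewrite mulrA.
  rewrite (_ : p * (z + kappa) = s + p * z); last by rewrite /kappa; field.
  by rewrite mob// /delta; field.
have [dk|dk] := eqVneq (1 - delta * kappa) 0.
  have dkE : delta * kappa = 1 by apply/esym/subr0_eq.
  have dn0 : delta != 0 by apply: contra_eq_neq dkE => ->; rewrite mul0r eq_sym oner_neq0.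
  have kE : kappa = 1 / delta by apply: (mulfI dn0); rewrite dkE; field.
  have gd z : 0 < Re z -> z + kappa != 0 -> g z = delta.
    move=> z0 zk; apply: (mulfI zk); rewrite mob'// kE; field; exact: dn0.
  have d0 : 0 < Re delta.
    (* [gd] asks that z + kappa be nonzero; [kappa] is not both -1 and -2, so one of the points 1
       and 2 qualifies. *)
    have [e1|e1] := eqVneq (1 + kappa) 0; last by rewrite -(gd 1 r1 e1).
    have e2 : 2%:C + kappa != 0 by rewrite two -addrA e1 addr0 oner_neq0.
    by rewrite -(gd 2%:C r2 e2).
  have k0 : 0 < Re kappa by rewrite kE inv_gt0.
  apply: Or31; exists delta, (f 1 * (1 + delta) ^+ n); split=> // w w0.
  have gE z : 0 < Re z -> g z = delta by move=> z0; apply: gd; rewrite ?shift_neq0// ltW.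
  split; first exact: gE.
  by rewrite (sv w 1 w0 r1) !gE// mul1r mulrAC [w * delta]mulrC.
(* At a zero of z + kappa, [mob'] would read 0 = 1 + delta z = 1 - delta kappa. *)
have zk z : 0 < Re z -> z + kappa != 0.
  move=> z0; apply: contra dk => /eqP e; have := mob' z z0; rewrite e mul0r => /esym h.
  have -> : kappa = - z by apply/eqP; rewrite -addr_eq0 addrC e.
  by rewrite mulrN opprK h.
have k0 : 0 <= Re kappa.
  rewrite leNgt; apply/negP => kn; have := zk (- kappa).
  by rewrite RecN oppr_gt0 addNr eqxx => /(_ kn).
have gE z : 0 < Re z -> g z = delta + (1 - delta * kappa) / (z + kappa).
  move=> z0; have z1 := zk z z0; apply: (mulfI z1); rewrite mob'//.
  by field.
apply: Or33; exists delta, kappa, (f 1 * (1 + kappa) ^+ n); split.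
  by apply: mobius_constraints => // z z0; rewrite -gE//; exact: gC.
move=> w w0; split; first exact: gE.
rewrite (sv w 1 w0 r1).
have w1 := zk w w0; have o1 := zk 1 r1.
have E : 1 + 1 * g w = (1 + w * g 1) * ((1 + kappa) / (w + kappa)).
  by rewrite !gE//; field; rewrite w1 o1.
have n1 : (1 + w * g 1) != 0 by rewrite (one_addM_neq0 w0)//; exact: gC.
rewrite E exprMn -[LHS]mulrA mulKf ?expf_neq0//.
by rewrite expr_div_n mulrA.
Qed.

End classification.

(** * Adjoints, selfadjointness and maximality *)

Section operators.
Variables (R : realType) (l : nat).
Local Notation C := R[i].
Local Notation n := (l + 2)%N.
Local Notation hip := (hip l).
Local Notation nsq := (nsq l).
Local Notation kernel := (@kernel R l).
Local Notation bergman := (@bergman R l).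
Local Notation Cs := (@Cstar R l).
Implicit Types (h k u v f g : C -> C) (A W : operator R).

Lemma hipBl h k u : bergman h -> bergman k -> bergman u ->
  hip (fun z => h z - k z) u = hip h u - hip k u.
Proof.
move=> bh bk bu; rewrite addrC -mulN1r -(hip_comb (-1) bk bh bu).
by apply: (@eq_hip R l) => // z _; rewrite mulN1r addrC.
Qed.

Lemma bergman_ext h k : bergman h -> bergman k ->
  (forall z, 0 < Re z -> h z = k z) -> h = k.
Proof.
move=> [_ h0 _] [_ k0 _] e; apply/funext => z.
have [/e//|z0] := boolP (0 < Re z).
by rewrite h0 ?k0//; exact/negP.
Qed.

(** Testing against the kernels recovers the values of [u] and [v]. *)
Lemma hip_ext u v : bergman u -> bergman v ->
  (forall h, bergman h -> hip h u = hip h v) -> u = v.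
Proof.
move=> bu bv e; apply: bergman_ext => // z z0.
have [bk _] := bergman_kernel l z0; have c0 := rep_cst_gt0 R l.
have cn0 : (rep_cst R l)%:C != 0 :> C by rewrite -normc_gt0 normc_real normr_gt0 gt_eqF.
apply: (mulfI cn0); rewrite -(reproducing bu z0) -(reproducing bv z0).
by rewrite (hip_conj bk bu) (hip_conj bk bv) e.
Qed.

(** This makes the value of the adjoint unique, so that it is the one [xget] returns. *)
Lemma dense_hip_ext A u v : dom A `<=` bergman -> densely_defined l A ->
  bergman u -> bergman v -> (forall h, dom A h -> hip h u = hip h v) -> u = v.
Proof.
move=> Ab Ad bu bv e; apply: hip_ext => // h bh.
apply/eqP; rewrite -subr_eq0 -normc_eq0; apply: contraT => r0.
set r := normc _ in r0.
have rp : 0 < r by rewrite lt_neqAle eq_sym r0 normc_ge0.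
(* By [hip_cs], the functionals of [u] and [v] at h - k differ by at most M sqrt (nsq (h - k)); the
   summand 1 keeps [M] positive. The factor sqrt (1 / pi) below converts between [bergman_norm] and
   [nsq]. *)
pose M := 2 * Num.sqrt (nsq u) + 2 * Num.sqrt (nsq v) + 1.
have M0 : 0 < M by rewrite /M; have := sqrtr_ge0 (nsq u); have := sqrtr_ge0 (nsq v); lra.
have pi0 : 0 < Num.sqrt (pi^-1 : R) by rewrite sqrtr_gt0 invr_gt0 pi_gt0.
have e0 : 0 < Num.sqrt pi^-1 * (r / M) by rewrite mulr_gt0// divr_gt0.
have [k Ak] := Ad h bh _ e0; have bk := Ab k Ak; have bd := bergmanB bh bk.
rewrite (bergman_normE bd) sqrtrM ?invr_ge0 ?pi_ge0// (ltr_pM2l pi0) => sM.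
have : r <= Num.sqrt (nsq (fun z => h z - k z)) * M.
  have -> : r = normc (hip (fun z => h z - k z) u - hip (fun z => h z - k z) v).
    by rewrite /r (hipBl bh bk bu) (hipBl bh bk bv) (e k Ak); congr normc; ring.
  apply: le_trans (ler_normcD _ _) _; rewrite normc_opp.
  have := hip_cs bd bu; have := hip_cs bd bv; rewrite !sqrtrM ?nsq_ge0//.
  have := sqrtr_ge0 (nsq (fun z => h z - k z)); rewrite /M.
  move: (Num.sqrt _) (Num.sqrt _) (Num.sqrt _) (normc _) (normc _) => x y z a b; nra.
by move/(le_lt_trans)/(_ (_ : _ < r)); rewrite ltxx; apply; rewrite -ltr_pdivlMr.
Qed.

Lemma adjoint_relP A u v : linear_operator l A ->
  adjoint_rel l A u v <->
  [/\ bergman u, bergman v & forall h, dom A h -> hip (app A h) u = hip h v].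
Proof.
move=> [Ab Aa _ _].
have pi0 : ((pi^-1)%:C : C) != 0.
  by rewrite -normc_gt0 normc_real normr_gt0 invr_eq0 gt_eqF// pi_gt0.
split=> -[bu bv e]; (split; [exact: bu|exact: bv|move=> h Ah]);
    have bh := Ab h Ah; have bAh := Aa h Ah.
  by apply: (mulfI pi0); rewrite -(bergman_ipE bAh bu) -(bergman_ipE bh bv) e.
by rewrite (bergman_ipE bAh bu) (bergman_ipE bh bv) e.
Qed.

Lemma adjoint_val A u v : linear_operator l A -> densely_defined l A ->
  adjoint_rel l A u v -> app (adjoint l A) u = v.
Proof.
move=> Al Ad uv; rewrite /adjoint /=; apply: xget_unique => // w uw.
have [_ bv e] := (adjoint_relP u v Al).1 uv.
have [_ bw e'] := (adjoint_relP u w Al).1 uw.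
have [Ab _ _ _] := Al.
by apply: (dense_hip_ext Ab Ad bw bv) => h Ah; rewrite -e// -e'.
Qed.

Lemma Cstar_kernel w z : 0 < Re w -> 0 < Re z ->
  Cs (kernel w) z = ((1 + w * z) ^+ n)^-1.
Proof.
move=> w0 z0; rewrite Cstarv// kernelE ?ReVJ_gt0//.
have zn0 := Re_neq0 z0.
have -> : (((1 / z^* + w^*) ^+ n)^-1)^* = ((1 / z + w) ^+ n)^-1.
  by rewrite fmorphV rmorphXn rmorphD /= conjcK !div1r fmorphV /= conjcK.
by rewrite -invfM -exprMn; congr (_ ^+ n)^-1; field.
Qed.

Lemma selfadjoint_star f g W : (forall z, Cplus z -> Cplus (g z)) ->
  linear_operator l W -> ople W (wcomp_max l f g) ->
  conj_selfadjoint l Cs W -> forall z w, 0 < Re z -> 0 < Re w ->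
  f z / (1 + w * g z) ^+ n = f w / (1 + z * g w) ^+ n.
Proof.
move=> gC Wl [Wd Wa] [_ Wdense [_ [sWd sWa]]] z w z0 w0.
have gw := gC w w0; have [bkw _] := bergman_kernel l w0.
have [bkg _] := bergman_kernel l gw; have [Wb _ _ _] := Wl.
have rel : adjoint_rel l W (kernel w) (fun y => (f w)^* * kernel (g w) y).
  apply/(adjoint_relP _ _ Wl); split; [exact: bkw|exact: bergmanZ|] => h Wh.
  have bh := Wb h Wh; have bWh : bergman (app W h) by have [_ Wb' _ _] := Wl; exact: Wb'.
  rewrite (hipZr _ bh bkg) (reproducing bWh w0) (reproducing bh gw) conjcK (Wa h Wh) /=.
  by rewrite extend0E// mulrCA.
have bck := bergman_Cstar bkw.
have sd : dom (sandwich l Cs (adjoint l W)) (Cs (kernel w)).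
  split; first exact: bck.
  by rewrite (bergmanCK bkw); exists (fun y => (f w)^* * kernel (g w) y).
(* The inclusion of the conjugated adjoint in [W] puts C_star k_w in the domain of [W]; both
   operators are then evaluated on it at [z]. *)
have := sWa _ sd.
rewrite -[app (sandwich _ _ _) _]/(Cs (app (adjoint l W) (Cs (Cs (kernel w))))) (bergmanCK bkw) (adjoint_val Wl Wdense rel).
rewrite (Wa _ (sWd _ sd)) => /(congr1 (fun F : C -> C => F z)).
rewrite [RHS]extend0E// (Cstar_kernel w0 (gC z z0)) => <-.
have := Cstar_kernel gw z0; rewrite !Cstarv// rmorphM /= conjcK mulrCA => ->.
by rewrite [g w * z]mulrC.
Qed.

(** With [f] zero nothing is known about the form of [g]; this case is settled apart so that
    selfadjointness always yields [csym]. *)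
Lemma csym_zero f g : (forall z, 0 < Re z -> f z = 0) -> csym l f g.
Proof.
move=> f0; have W0 h : wop f g h = (fun=> 0).
  by apply/funext => z; rewrite /wop /extend0; case: ifP => // /f0 ->; rewrite mul0r.
apply: eq_adjpair (adjpair_scalar l 0) => h bh.
  by rewrite W0; apply/funext => z; rewrite mul0r.
have c0 : (0 : C)^* = 0 by exact: conjc0.
rewrite W0; apply/funext => z; rewrite -[LHS]/((0 : C)^* * h z) c0 mul0r.
rewrite /Cstar /extend0; case: ifP => // _.
by rewrite -[RHS]/(1 / z ^+ n * (0 : C)^*) c0 mulr0.
Qed.

Lemma selfadjoint_symbols f g W : analytic_on (@Cplus R) g ->
  (forall z, Cplus z -> Cplus (g z)) ->
  linear_operator l W -> ople W (wcomp_max l f g) ->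
  conj_selfadjoint l Cs W -> (exists2 w, Cplus w & f w <> 0) ->
  [\/ symbol_case_i l f g, symbol_case_ii f g | symbol_case_iii l f g].
Proof.
move=> ga gC Wl Wm sa f0; apply: (star_symbols ga gC _ f0).
exact: selfadjoint_star gC Wl Wm sa.
Qed.

Lemma selfadjoint_csym f g W : analytic_on (@Cplus R) g ->
  (forall z, Cplus z -> Cplus (g z)) ->
  linear_operator l W -> ople W (wcomp_max l f g) ->
  conj_selfadjoint l Cs W -> csym l f g.
Proof.
move=> ga gC Wl Wm sa.
have [f0|f0] := pselect (exists2 w, Cplus w & f w <> 0).
  exact: csym_symbols gC (selfadjoint_symbols ga gC Wl Wm sa f0).
apply: csym_zero => z z0; apply: contrapT => fz; apply: f0.
by exists z.
Qed.

Lemma csym_adjoint_rel f g W u : linear_operator l W ->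
  ople W (wcomp_max l f g) -> csym l f g -> bergman u ->
  adjoint_rel l W u (Cs (wop f g (Cs u))).
Proof.
move=> Wl [Wd Wa] [_ sB sE] bu; apply/(adjoint_relP _ _ Wl).
split; [exact: bu|exact: sB|move=> h Wh].
have [Wb _ _ _] := Wl; rewrite (Wa h Wh).
exact: sE (Wb h Wh) bu.
Qed.

(** [W] restricts an everywhere defined operator that has an everywhere defined adjoint, so the
    adjoint of [W] is defined everywhere. Hence so is its conjugate by C_star, which is contained in
    [W]. *)
Lemma csym_maximal f g W : linear_operator l W -> ople W (wcomp_max l f g) ->
  csym l f g -> conj_selfadjoint l Cs W -> dom W = bergman.
Proof.
move=> Wl Wm cs [_ _ [_ [sWd _]]]; have [Wb _ _ _] := Wl.
apply/seteqP; split; first exact: Wb.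
move=> h bh; apply: sWd; split; first exact: bh.
exists (Cs (wop f g (Cs (Cs h)))); exact: (csym_adjoint_rel Wl Wm cs (bergman_Cstar bh)).
Qed.

Lemma csym_bounded f g W : ople W (wcomp_max l f g) -> csym l f g ->
  dom W = bergman -> bounded_operator l W.
Proof.
move=> [_ Wa] [[K K0 hK] _ _] Wd; split; first exact: Wd.
(* [K] may be 0, while the bound has to be positive. *)
exists (Num.sqrt K + 1) => [|h bh]; first by rewrite ltr_wpDl// sqrtr_ge0.
have Wh : dom W h by rewrite Wd.
have [bWh le] := hK h bh; rewrite (Wa h Wh) (bergman_normE bh).
have -> : app (wcomp_max l f g) h = wop f g h by [].
rewrite (bergman_normE bWh).
have pi0 : 0 <= (pi^-1 : R) by rewrite invr_ge0 pi_ge0.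
apply: (@le_trans _ _ (Num.sqrt K * Num.sqrt (pi^-1 * nsq h))).
  rewrite -sqrtrM// ler_sqrt; last by rewrite mulr_ge0// mulr_ge0// nsq_ge0.
  by rewrite mulrCA ler_wpM2l.
by rewrite ler_wpM2r ?sqrtr_ge0// lerDl.
Qed.

Lemma csym_selfadjoint f g W : linear_operator l W ->
  opeq W (wcomp_max l f g) -> csym l f g -> conj_selfadjoint l Cs W.
Proof.
move=> Wl [Wm [mW _]] cs; have [Wb _ _ _] := Wl; have [[K K0 hK] sB sE] := cs.
have Wd : dom W = bergman.
  apply/seteqP; split; first exact: Wb.
  by move=> h bh; apply: mW; split; [exact: bh|have [] := hK h bh].
have Wdense : densely_defined l W.
  move=> h bh e e0; exists h; first by rewrite Wd.
  have -> : (fun z => h z - h z) = (fun z => 0 * h z).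
    by apply/funext => z; rewrite subrr mul0r.
  rewrite (bergman_normE (bergmanZ 0 bh)) (nsqZ 0 bh).
  by rewrite ComplexField.Normc.normc0 expr0n mul0r mulr0 sqrtr0.
have val h : bergman h ->
    app (sandwich l Cs (adjoint l W)) h = app W h.
  move=> bh; have bC := bergman_Cstar bh.
  rewrite -[LHS]/(Cs (app (adjoint l W) (Cs h))) (adjoint_val Wl Wdense (csym_adjoint_rel Wl Wm cs bC)).
  rewrite (bergmanCK bh) bergmanCK; last by have [] := hK h bh.
  by have [_ ->] := Wm; rewrite ?Wd.
split; [exact: Wl|exact: Wdense|split; split].
- move=> h Wh; have bh := Wb h Wh; split; first exact: bh.
  exists (Cs (wop f g (Cs (Cs h)))); exact: (csym_adjoint_rel Wl Wm cs (bergman_Cstar bh)).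
- by move=> h Wh; rewrite (val h (Wb h Wh)).
- by move=> h [bh _]; rewrite Wd.
- by move=> h [bh _]; rewrite (val h bh).
Qed.

End operators.

(** If [f] vanishes on the half-plane, [W] is zero on its domain whatever [g] is, so selfadjointness
    cannot reveal the form of [g]. The passage to the symbols is therefore claimed for an [f] with a
    nonzero value, and the converse and boundedness for every [f]. *)
Theorem theorem6p4 (R : realType) (l : nat) (f g : R[i] -> R[i])
    (W : operator R)
    (f_analytic : analytic_on (@Cplus R) f)
    (g_analytic : analytic_on (@Cplus R) g)
    (g_Cplus : forall z, Cplus z -> Cplus (g z))
    (W_linear : linear_operator l W)
    (W_wcomp : ople W (wcomp_max l f g)) :
  let maximal := opeq W (wcomp_max l f g) in
  let symbols :=
    [\/ symbol_case_i l f g, symbol_case_ii f g | symbol_case_iii l f g] in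
  [/\ (exists2 w, Cplus w & f w <> 0) ->
        (conj_selfadjoint l (Cstar l) W <-> maximal /\ symbols),
      maximal /\ symbols -> conj_selfadjoint l (Cstar l) W
    & conj_selfadjoint l (Cstar l) W -> bounded_operator l W].
Proof.
move=> maximal symbols.
have sufficient : maximal /\ symbols -> conj_selfadjoint l (Cstar l) W.
  move=> [Wmax sym]; apply: (csym_selfadjoint W_linear Wmax).
  exact: csym_symbols g_Cplus sym.
have sym_csym : conj_selfadjoint l (Cstar l) W -> csym l f g.
  exact: selfadjoint_csym g_analytic g_Cplus W_linear W_wcomp.
split; [|exact: sufficient|].
  move=> f0; split; [move=> sa|exact: sufficient].
  split; last exact: (selfadjoint_symbols g_analytic g_Cplus W_linear W_wcomp sa f0).
  have Wd := csym_maximal W_linear W_wcomp (sym_csym sa) sa.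
  split; [exact: W_wcomp|split=> [h [bh _]|h [bh _]]]; first by rewrite Wd.
  by have [_ ->] := W_wcomp; rewrite ?Wd.
move=> sa; have cs := sym_csym sa.
exact: csym_bounded W_wcomp cs (csym_maximal W_linear W_wcomp cs sa).
Qed.
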